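(* Let $k\ge3$, let $\mathfrak{D}_k$ be the ideal polygon with $k$ boundary edges, let $S_{\partial\mathfrak{D}_k}$ be a strand-set for $\mathfrak{D}_k$, and let $\lambda$ be an ideal triangulation of $\mathfrak{D}_k$, with $N=2\cdot\#\{\text{edges of }\lambda\}+\#\{\text{triangles of }\lambda\}$. Then the boundary-fixed Knutson–Tao cone $\mathscr{C}^+_\lambda(S_{\partial\mathfrak{D}_k})\subseteq\mathscr{C}^+_\lambda\subseteq\mathbb{Z}^N_{\ge0}$ indexes a linear basis for the invariant space $V(S_{\partial\mathfrak{D}_k})^{\mathrm{SL}_3(\mathbb{C})}$ (that is, there is a linear basis of this space in bijection with $\mathscr{C}^+_\lambda(S_{\partial\mathfrak{D}_k})$).
   Context: **Polygon.** $\mathfrak{D}_k$ is the oriented closed disk with $k$ boundary points (punctures) removed; its boundary consists of $k$ ideal arcs, the boundary edges. An ideal triangulation $\lambda$ is a triangulation of the disk with vertex set the $k$ punctures, the boundary edges counting as edges of $\lambda$. **Strand-sets and representations.** A strand-set $S_{\partial\mathfrak{D}_k}=\{S_E\}_E$ assigns to each boundary edge $E$ a finite, possibly empty, set $S_E$ of disjoint oriented strands on $E$. Let $n^{\mathrm{in}}_E$ (resp. $n^{\mathrm{out}}_E$) be the number of strands of $S_E$ oriented into (resp. out of) $\mathfrak{D}_k$. Finite-dimensional irreducible representations of $\mathrm{SL}_3(\mathbb{C})$ correspond to pairs $(n^{\mathrm{in}},n^{\mathrm{out}})\in\mathbb{Z}_{\ge0}^2$ via highest weights $n^{\mathrm{in}}\omega_1+n^{\mathrm{out}}\omega_2$,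 with $(1,0)$ the defining representation $V$ and $(0,1)$ its dual $V^*$. Let $V_E$ be the irreducible representation corresponding to $(n_E^{\mathrm{in}},n_E^{\mathrm{out}})$ and $V(S_{\partial\mathfrak{D}_k})=\bigotimes_E V_E$ over boundary edges $E$. For a representation $U$ of $\mathrm{SL}_3(\mathbb{C})$, $U^{\mathrm{SL}_3(\mathbb{C})}$ is its subspace of invariant vectors. **Cones.** Put two dots on each edge of $\lambda$ and one dot in each triangle ($N$ dots); identify $\mathbb{Z}^N$ with functions from dots to $\mathbb{Z}$. For a triangle, number its edges $1,2,3$ clockwise; let $a_{i1},a_{i2}$ be the values on the left and right dots of edge $i$, as viewed from inside the triangle facing the edge, and $a$ the value on the triangle dot. The rhombus numbers are, with $i$ mod $3$, $$r_{i1}=\tfrac{a_{i+1,2}+a_{i+2,1}-a}{3},\quad r_{i2}=\tfrac{a+a_{i+2,2}-a_{i,1}-a_{i+2,1}}{3},\quad r_{i3}=\tfrac{a_{i+1,1}+a-a_{i,2}-a_{i+1,2}}{3}.$$ $\mathscr{C}^+_\lambda$ is the set of $c\in\mathbb{Z}^N$ such that for every triangle of $\lambda$ all nine rhombus numbers of the restriction of $c$ are non-negative integers. $\mathscr{C}^+_\lambda(S_{\partial\mathfrak{D}_k})$ is the set of points of $\mathscr{C}^+_\lambda$ such that on every boundary edge $E$ the values on the left and right dots (viewed from the adjacent triangle) are $2n^{\mathrm{in}}_E+n^{\mathrm{out}}_E$ and $n^{\mathrm{in}}_E+2n^{\mathrm{out}}_E$, respectively. *)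

(* Defs.v *)
From mathcomp Require Import all_boot all_order all_algebra.
From mathcomp Require Import reals.
From mathcomp.real_closed Require Import complex.
From mathcomp Require Import mpoly.

Set Implicit Arguments.
Unset Strict Implicit.
Unset Printing Implicit Defensive.

Import GRing.Theory Num.Theory.
Local Open Scope ring_scope.

(* The field of complex numbers is R[i], with R : realType. *)

(** * Ideal polygons, ideal triangulations, strand-sets *)

(* The punctures of the ideal k-gon are the elements of 'I_k, numbered
   clockwise along the boundary of the oriented disk.  The boundary edge E
   joins the punctures E and ordS E (the successor modulo k), so boundary
   edges are indexed by 'I_k as well.  Up to isotopy an ideal arc is determined
   by its two distinct endpoints and is encoded by the set of these. *)

Definition crossing (k : nat) (e f : {set 'I_k}) : bool :=
  [exists a : 'I_k, exists b : 'I_k, exists c : 'I_k, exists d : 'I_k,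
    [&& (a < b)%N, (b < c)%N, (c < d)%N &
        ((e == [set a; c]) && (f == [set b; d]))
        || ((e == [set b; d]) && (f == [set a; c]))]].

Definition boundary_edge (k : nat) (E : 'I_k) : {set 'I_k} := [set E; ordS E].

(* An ideal triangulation, given by its set of edges: a maximal collection of
   pairwise non-crossing, pairwise non-isotopic ideal arcs, the boundary edges
   being included. *)
Definition ideal_triangulation (k : nat) (lam : {set {set 'I_k}}) : Prop :=
  [/\ forall e, e \in lam -> #|e| = 2%N,
      forall E : 'I_k, boundary_edge E \in lam,
      forall e f, e \in lam -> f \in lam -> ~~ crossing e f
    & forall e : {set 'I_k}, #|e| = 2%N ->
        (forall f, f \in lam -> ~~ crossing e f) -> e \in lam].

(* A triangle is encoded by its vertices x < y < z, thus listed clockwise.  As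
   all the vertices of the triangulation lie on the boundary of the disk, three
   edges that join three punctures pairwise always bound a face. *)
Definition triangles (k : nat) (lam : {set {set 'I_k}}) :
    {set 'I_k * 'I_k * 'I_k} :=
  [set t : 'I_k * 'I_k * 'I_k |
         [&& (t.1.1 < t.1.2)%N, (t.1.2 < t.2)%N,
               [set t.1.1; t.1.2] \in lam, [set t.1.2; t.2] \in lam
             & [set t.2; t.1.1] \in lam]].

Inductive orientation := Inward | Outward.

Definition is_inward (o : orientation) : bool :=
  if o is Inward then true else false.

(* The strands on a boundary edge are disjoint, hence linearly ordered along
   that edge: they are listed in this order by their orientations. *)
Definition strand_set (k : nat) := 'I_k -> seq orientation.

Definition n_in (k : nat) (S : strand_set k) (E : 'I_k) : nat :=
  count is_inward (S E).
Definition n_out (k : nat) (S : strand_set k) (E : 'I_k) : nat :=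
  count (predC is_inward) (S E).

(** * Dots and Knutson-Tao cones *)

Section Cone.
Variables (k : nat) (lam : {set {set 'I_k}}).

(* The ordered pair (p, q) stands for the one of the two dots on the edge
   {p, q} that is closer to p. *)
Definition edge_dot := {d : 'I_k * 'I_k | [set d.1; d.2] \in lam}.
Definition triangle_dot := {t : 'I_k * 'I_k * 'I_k | t \in triangles lam}.
Definition dot := (edge_dot + triangle_dot)%type.

Definition coords := {ffun dot -> int}.

(* The default value 0 is never used for an edge {p, q} of lam. *)
Definition edge_value (c : coords) (p q : 'I_k) : int :=
  if insub (p, q) is Some d then c (inl d) else 0.

(* Seen from inside a region whose boundary runs clockwise from p to q along
   the edge {p, q}, the dot closer to p is on the left. *)
Definition left_value (c : coords) (p q : 'I_k) : int := edge_value c p q.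
Definition right_value (c : coords) (p q : 'I_k) : int := edge_value c q p.

Section Rhombus.
Variables (c : coords) (t : triangle_dot).

(* The edges 1, 2, 3 of the triangle are indexed by i : 'I_3 (addition is
   modulo 3); edge i runs clockwise from vertex i to vertex i + 1. *)
Definition vertex (i : 'I_3) : 'I_k :=
  tnth [tuple (val t).1.1; (val t).1.2; (val t).2] i.

Definition a1 (i : 'I_3) : int := left_value c (vertex i) (vertex (i + 1)).
Definition a2 (i : 'I_3) : int := right_value c (vertex i) (vertex (i + 1)).
Definition a0 : int := c (inr t).

Definition rhombus1 (i : 'I_3) : rat :=
  (a2 (i + 1) + a1 (i + 2%:R) - a0)%:~R / 3%:R.
Definition rhombus2 (i : 'I_3) : rat :=
  (a0 + a2 (i + 2%:R) - a1 i - a1 (i + 2%:R))%:~R / 3%:R.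
Definition rhombus3 (i : 'I_3) : rat :=
  (a1 (i + 1) + a0 - a2 i - a2 (i + 1))%:~R / 3%:R.

End Rhombus.

Definition KT_cone : {pred coords} := fun c =>
  [forall t : triangle_dot, forall i : 'I_3,
    [&& rhombus1 c t i \is a Num.nat, rhombus2 c t i \is a Num.nat
      & rhombus3 c t i \is a Num.nat]].

Definition KT_cone_bdry (S : strand_set k) : {pred coords} := fun c =>
  (c \in KT_cone) &&
  [forall E : 'I_k,
    (left_value c E (ordS E) == (2 * n_in S E + n_out S E)%N :> int)
    && (right_value c E (ordS E) == (n_in S E + 2 * n_out S E)%N :> int)].

Definition nonneg_coords : {pred coords} := fun c =>
  [forall x : dot, 0 <= c x].

End Cone.

Arguments KT_cone {k} lam _.
Arguments KT_cone_bdry {k} lam S _.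
Arguments nonneg_coords {k} lam _.

(* The number N of coordinates. *)
Lemma card_dot k (lam : {set {set 'I_k}}) : ideal_triangulation lam ->
  #|{: dot lam}| = (2 * #|lam| + #|triangles lam|)%N.
Proof.
case=> card2 _ _ _; rewrite card_sum !card_sig; congr (_ + _)%N.
rewrite -[LHS]sum1_card (partition_big (fun d : 'I_k * 'I_k => [set d.1; d.2]) (mem lam)) //=.
rewrite mulnC -sum_nat_const; apply: eq_bigr => e le.
have /eqP/cards2P[p [q [npq ee]]] := card2 e le.
rewrite (eq_bigl (mem [set (p, q); (q, p)])) ?sum1_card ?cards2 ?xpair_eqE ?(negPf npq) //.
move=> [x y]; rewrite !inE /= !xpair_eqE; apply/andP/orP.
  case=> _ /eqP E; rewrite ee in E.
  have : x \in [set p; q] by rewrite -E set21.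
  have : y \in [set p; q] by rewrite -E set22.
  have : p \in [set x; y] by rewrite E set21.
  have : q \in [set x; y] by rewrite E set22.
  rewrite !inE ![p == _]eq_sym ![q == _]eq_sym.
  case: (eqVneq x p) => [->|_]; case: (eqVneq y q) => [->|_]; rewrite ?eqxx ?(negPf npq) ?(eq_sym q p) ?(negPf npq) /=;
  do ?[case: (_ == _) => /=]; auto.
case=> /andP[/eqP-> /eqP->]; first by rewrite -ee le.
by rewrite setUC -ee le.
Qed.

(** * Representations of SL_3(C) *)

Section Representations.
Variable R : realType.
Local Notation C := (R[i]).

Definition SL3 : {pred 'M[C]_3} := fun g => \det g == 1.

(* A representation on the space of column vectors 'cV[C]_d is given by its
   matrices (acting on the left); rho matters only on SL3.  As usual for an
   algebraic group, it is required to be rational: on SL_3(C), the entries of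
   rho g are polynomials in the nine entries of g. *)
Definition rational_rep (d : nat) (rho : 'M[C]_3 -> 'M[C]_d) : Prop :=
  [/\ rho 1%:M = 1%:M,
      forall g h, g \in SL3 -> h \in SL3 -> rho (g *m h) = rho g *m rho h
    & exists p : 'M[{mpoly C[3 * 3]}]_d, forall g, g \in SL3 ->
        forall i j, rho g i j = (p i j).@[mxvec g 0]].

Definition irreducible_rep (d : nat) (rho : 'M[C]_3 -> 'M[C]_d) : Prop :=
  (0 < d)%N /\
  forall U : {vspace 'cV[C]_d},
    (forall g u, g \in SL3 -> u \in U -> rho g *m u \in U) ->
    U = 0%VS \/ U = fullv.

Definition upper_unitriangular : {pred 'M[C]_3} := fun g =>
  [forall i : 'I_3, g i i == 1] && is_trig_mx g^T.

(* The fundamental weights send diag(t_0, t_1, t_2) to t_0 for omega_1 and to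
   t_0 t_1 for omega_2; highest weight vectors are those of the Borel subgroup
   of upper triangular matrices. *)
Definition has_highest_weight (d : nat) (rho : 'M[C]_3 -> 'M[C]_d)
    (n m : nat) : Prop :=
  exists v : 'cV[C]_d,
    [/\ v != 0,
        forall u, u \in upper_unitriangular -> rho u *m v = v
      & forall t : 'rV[C]_3, diag_mx t \in SL3 ->
          rho (diag_mx t) *m v =
            (t 0 0 ^+ n * (t 0 0 * t 0 1) ^+ m) *: v].

Definition irrep_of_weight (n m d : nat) (rho : 'M[C]_3 -> 'M[C]_d) : Prop :=
  [/\ rational_rep rho, irreducible_rep rho & has_highest_weight rho n m].

Section Tensor.
Variables (I : finType) (d : I -> nat).

(* Coordinates on the tensor product of the C^(d E), E : I: the standard basis
   is indexed by the multi-indices picking a coordinate in each factor. *)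
Definition multi_index := {dffun forall E : I, 'I_(d E)}.

Definition index_of (i : 'I_#|{: multi_index}|) : multi_index := enum_val i.

Definition tensor_mx (A : forall E : I, 'M[C]_(d E)) :
    'M[C]_#|{: multi_index}| :=
  \matrix_(i, j) \prod_E A E (index_of i E) (index_of j E).

Definition tensor_rep (rho : forall E : I, 'M[C]_3 -> 'M[C]_(d E)) :
    'M[C]_3 -> 'M[C]_#|{: multi_index}| :=
  fun g => tensor_mx (fun E => rho E g).

Definition pure_tensor (v : forall E : I, 'cV[C]_(d E)) :
    'cV[C]_#|{: multi_index}| :=
  \col_i \prod_E v E (index_of i E) 0.

End Tensor.

Definition is_invariant (d : nat) (rho : 'M[C]_3 -> 'M[C]_d) (v : 'cV[C]_d) :
    Prop :=
  forall g, g \in SL3 -> rho g *m v = v.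

End Representations.

(* The matrices tensor_mx A are those of the tensor products of the maps A E. *)
Lemma distr_multi_index (R : comNzRingType) (I : finType) (d : I -> nat)
    (F : forall E, 'I_(d E) -> R) :
  \prod_E \sum_j F E j = \sum_(m : multi_index d) \prod_E F E (m E).
Proof.
pose T_ E : finType := 'I_(d E).
transitivity (\sum_(t : fprod T_) \prod_E F E (t E)); last first.
  rewrite [RHS](reindex (@dffun_of_fprod I T_)) /=; last exact/onW_bij/dffun_of_fprod_bij.
  by apply: eq_bigr => t _; apply: eq_bigr => E _; congr (F E _); rewrite [RHS]ffunE.
pose P_ E : {ffun T_ E -> R} := [ffun j => F E j].
transitivity (\sum_(t : fprod T_) \prod_(E in I) P_ E (t E)); last first.
  by apply: eq_bigr => t _; apply: eq_bigr => E _; rewrite ffunE.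
rewrite big_fprod -(@bigA_distr_big_dep _ _ _ _ _ _ _ (fun E => tagged_with T_ E) (fun E u => untag 0 (P_ E) u)).
apply: eq_bigr => E _; rewrite -(big_tag (P_ : forall E, T_ E -> R) E).
by apply: eq_bigr => j _; rewrite ffunE.
Qed.

Lemma tensor_mx_pure (R : realType) (I : finType) (d : I -> nat)
    (A : forall E, 'M[R[i]]_(d E)) (v : forall E, 'cV[R[i]]_(d E)) :
  tensor_mx A *m pure_tensor v = pure_tensor (fun E => A E *m v E).
Proof.
apply/colP => i; rewrite !mxE.
transitivity (\prod_E \sum_j A E (index_of i E) j * v E j 0); last first.
  by apply: eq_bigr => E _; rewrite mxE.
rewrite distr_multi_index (reindex (@index_of I d)) /=; last exact/onW_bij/enum_val_bij.
by apply: eq_bigr => j _; rewrite !mxE -big_split.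
Qed.

(* The subspace with membership predicate W has a linear basis in bijection
   with the (necessarily finite) set A; s enumerates A without repetition. *)
Definition indexes_basis (T : eqType) (A : {pred T}) (K : fieldType)
    (V : vectType K) (W : V -> Prop) : Prop :=
  exists (s : seq T) (b : T -> V),
    [/\ uniq s, s =i A, free [seq b x | x <- s]
      & forall v, v \in <<[seq b x | x <- s]>>%VS <-> W v].

(* Main.v *)
(* The representation ring of SL_3 is Z[x, y], x and y being the characters of V
   and V^*; with h_n, k_n the complete symmetric characters of V and V^*, the
   irreducible character of highest weight (a, b) is
   chi(a, b) = h_a k_b - h_{a-1} k_{b-1}.

   Combinatorics.  Peeling off corner arcs turns the expansion of
   chi(l) chi(m) into an identity between the h's and k's, and the terms of the
   expansion are exactly the Knutson-Tao points of a triangle with two sides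
   prescribed, each weighted by the character read on the third side.  Gluing
   triangles along the edges {p, q} of the triangulation, by induction on q - p,
   the product of all boundary characters but one is the sum of the characters
   read on the last edge over all the cone points, so the number of cone points
   with prescribed boundary is the multiplicity of chi(0, 0) in the product of
   all boundary characters.

   Representations.  In a representation with rho(g^* ) = rho(g)^* the matrix
   coefficient <rho(g) w, w> of a highest weight vector w is determined on the
   big cell U^- T U, hence everywhere: it is |w|^2 g_11^a Delta(g)^b, where Delta
   is the leading 2 x 2 minor.  So the module generated by w depends only on the
   highest weight, its U-fixed vectors are the multiples of w, and orthogonal
   complements decompose every such representation; every irreducible
   representation is of this kind.  Decomposing the tensor products with V and
   V^* gives the Pieri rule, which determines the characters, and the dimension
   of the space of invariants is the multiplicity of chi(0, 0). *)
Require Import Defs.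
From mathcomp Require Import all_boot all_order all_algebra.
From mathcomp Require Import boolp reals.
From mathcomp.real_closed Require Import complex mxtens.
From mathcomp Require Import mpoly.
From mathcomp Require Import zify ring.

Set Implicit Arguments.
Unset Strict Implicit.
Unset Printing Implicit Defensive.

Import Order.TTheory GRing.Theory Num.Theory.
Local Open Scope ring_scope.

(** * Characters *)

Section Characters.
Variables (A : comNzRingType) (x y : A).

(** The two halves meet only through values: a character is evaluated at arbitrary elements [x], [y]
    of a commutative ring. Traces give an identity of characters on the torus only, but every pair
    (x, y) comes from a torus element, and one monomial specialisation then turns equality of values
    into equality of multiplicities. The cone side cannot be a bare count: gluing the next triangle
    requires the type on the moving edge, so the induction carries the character of that type as a
    weight, and the last edge is prescribed only at the very end. On the representation side, a
    given irreducible representation comes with no invariant Hermitian form. A covector fixed by the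
    lower unitriangular group replaces the form and yields an embedding into a star representation;
    this embedding is tensored over the boundary edges to transport invariants. Regularity of matrix
    coefficients enters only along polynomial curves, through the fact that a polynomial vanishing
    at every point is zero. *)

Fixpoint hstate (x y : A) (n : nat) : A * A * A :=
  if n is n'.+1 then
    let: (p, q, r) := hstate x y n' in (q, r, x * r - y * q + p)
  else (0, 0, 1).

(* Indices are shifted by two: hsym n is h_{n-2}, with h_{-1} = h_{-2} = 0. *)
Definition hsym (x y : A) (n : nat) : A := (hstate x y n).1.1.

(** The generating series is 1 / (1 - x t + y t^2 - t^3), the last coefficient being the determinant
    1; [hstate] carries the window (h_{n-2}, h_{n-1}, h_n). *)
Lemma hsymS3 u v n :
  hsym u v n.+3 = u * hsym u v n.+2 - v * hsym u v n.+1 + hsym u v n.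
Proof. by rewrite /hsym /=; case: (hstate u v n) => [[p q] r]. Qed.

Lemma hsym0 u v : hsym u v 0 = 0. Proof. by []. Qed.
Lemma hsym1 u v : hsym u v 1 = 0. Proof. by []. Qed.
Lemma hsym2 u v : hsym u v 2 = 1. Proof. by []. Qed.

(** Addition formula of a recurrence of order three: advancing by [n] is linear in the window at
    [a]. The induction needs the whole window at once. The formula brings product identities between
    characters within reach of [ring]. *)
Lemma hsymD u v n a :
  [/\ hsym u v (a + n).+2 = hsym u v n.+2 * hsym u v a.+2
        - v * hsym u v n.+1 * hsym u v a.+1
        + hsym u v n.+1 * hsym u v a + hsym u v n * hsym u v a.+1,
      hsym u v (a + n).+1 = hsym u v n.+2 * hsym u v a.+1
        + hsym u v n.+1 * hsym u v a.+2
        - u * hsym u v n.+1 * hsym u v a.+1 + hsym u v n * hsym u v a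
    & hsym u v (a + n) = hsym u v n.+2 * hsym u v a
        + hsym u v n.+1 * hsym u v a.+1
        - u * hsym u v n.+1 * hsym u v a + hsym u v n * hsym u v a.+2
        - u * hsym u v n * hsym u v a.+1 + v * hsym u v n * hsym u v a].
Proof.
elim: n => [|n [IH1 IH2 IH3]].
  by rewrite addn0 hsym2 hsym1 hsym0; split; ring.
rewrite addnS (hsymS3 u v n) (hsymS3 u v (a + n)) IH1 IH2 IH3.
by split; [ring | ring | ring].
Qed.

(* Indices are shifted by one: chiS a b is chi(a - 1, b - 1), and it vanishes on
   the walls a = 0 and b = 0. *)
Definition chiS (a b : nat) : A :=
  hsym x y a.+1 * hsym y x b.+1 - hsym x y a * hsym y x b.

Definition chi (a b : nat) : A := chiS a.+1 b.+1.

Lemma chiS0l b : chiS 0 b = 0.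
Proof. by rewrite /chiS hsym1 hsym0 !mul0r subrr. Qed.

Lemma chiS0r a : chiS a 0 = 0.
Proof. by rewrite /chiS hsym1 hsym0 !mulr0 subrr. Qed.

Lemma chi00 : chi 0 0 = 1.
Proof. by rewrite /chi /chiS !hsym2 !hsym1; ring. Qed.

(** One summand for each weight of V. The last two are chi(a - 1, b + 1) and chi(a, b - 1), written
    with [chiS] so that they vanish by themselves on the walls. *)
Lemma pieri_x a b :
  x * chi a b = chi a.+1 b + chiS a b.+2 + chiS a.+1 b.
Proof. by rewrite /chi /chiS (hsymS3 x y) (hsymS3 y x); ring. Qed.

Lemma pieri_y a b :
  y * chi a b = chi a b.+1 + chiS a.+2 b + chiS a b.+1.
Proof. by rewrite /chi /chiS (hsymS3 x y) (hsymS3 y x); ring. Qed.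

(** Inclusion-exclusion over the two orientations of an arc around the common corner isolates the
    part of the product without such arcs. It consists of two strips that share their top term
    chi(n1 + n2, m1 + m2), which is therefore subtracted once. *)
Lemma chi_prod4 n1 m1 n2 m2 :
  chiS n1.+1 m1.+1 * chiS n2.+1 m2.+1 - chiS n1 m1.+1 * chiS n2.+1 m2
    - chiS n1.+1 m1 * chiS n2 m2.+1 + chiS n1 m1 * chiS n2 m2 =
  (hsym x y n1.+2 * chiS n2.+1 (m1 + m2).+1
     - hsym x y n1.+1 * chiS n2.+1 (m1 + m2))
  + (hsym y x m1.+2 * chiS (n1 + n2).+1 m2.+1
     - hsym y x m1.+1 * chiS (n1 + n2) m2.+1)
  - chiS (n1 + n2).+1 (m1 + m2).+1.
Proof.
rewrite /chiS; case: (hsymD x y n2 n1) => -> -> ->.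
case: (hsymD y x m2 m1) => -> -> ->.
ring.
Qed.

End Characters.

(** Three rhombus numbers are the parameters and the six inequalities are the nonnegativity of the
    other six. They also keep the subtractions of [lr_weight] from being truncated. *)
Definition lr_ok (l m : nat * nat) (t : nat * nat * nat) : bool :=
  let: (b, g, d) := t in
  [&& b <= m.2, g <= l.1, d <= l.2, d <= m.1,
      d + b <= g + l.2 & d + g <= b + m.1]%N.

Definition lr_seq (l m : nat * nat) : seq (nat * nat * nat) :=
  [seq t <- [seq (p, d) | p <- [seq (b, g) | b <- iota 0 m.2.+1, g <- iota 0 l.1.+1],
                          d <- iota 0 l.2.+1] | lr_ok l m t].

Definition lr_weight (l m : nat * nat) (t : nat * nat * nat) : nat * nat :=
  let: (b, g, d) := t in
  (l.1 + m.1 + b - 2 * g - d, l.2 + m.2 + g - 2 * b - d)%N.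

Lemma mem_lr_seq l m t : (t \in lr_seq l m) = lr_ok l m t.
Proof.
rewrite mem_filter; case: t => [[b g] d].
case: (boolP (lr_ok _ _ _)) => [ok|_]; last by [].
rewrite andTb; apply: allpairs_f.
  by apply: allpairs_f; rewrite mem_iota; move: ok => /=; lia.
by rewrite mem_iota; move: ok => /=; lia.
Qed.

Lemma lr_seq_uniq l m : uniq (lr_seq l m).
Proof.
rewrite filter_uniq // allpairs_uniq ?iota_uniq //; last by move=> [[? ?] ?] [[? ?] ?].
by rewrite allpairs_uniq ?iota_uniq // => -[? ?] [? ?].
Qed.

(** * Expansion of the product of two irreducible characters *)

Section ProductFormula.
Variables (A : comNzRingType) (x y : A).
Local Notation chixy := (chi x y).
Local Notation chiSxy := (chiS x y).

Definition chiw (w : nat * nat) : A := chixy w.1 w.2.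

(** The Pieri rule for h_n, with the terms that contract V against V^* removed by the subtraction.
    Splitting off [h = 0] leaves the strip of n - 1, a - 1 and b + 1. *)
Lemma chi_strip n a b :
  \sum_(h < (minn n a).+1) chixy (a + n - 2 * h) (b + h) =
  hsym x y n.+2 * chiSxy a.+1 b.+1 - hsym x y n.+1 * chiSxy a.+1 b.
Proof.
elim: n a b => [|n IH] [|a] b.
- by rewrite big_ord1 hsym2 hsym1 /= muln0 !addn0 /chi; ring.
- rewrite min0n big_ord1 hsym2 hsym1 /= muln0 subn0 !addn0 /chi; ring.
- rewrite minn0 big_ord1 muln0 subn0 add0n addn0.
  rewrite /chi /chiS !hsym2 !hsym1; ring.
rewrite minnSS big_ord_recl.
rewrite (eq_bigr (fun h : 'I_(minn n a).+1 => chixy (a + n - 2 * h) (b.+1 + h))); last first.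
  by move=> i _; congr (chixy _ _); rewrite /= /bump /=; lia.
rewrite IH muln0 subn0 addn0 /chi /chiS.
have [E1 E2 E3] := hsymD x y n.+1 a.+1.
rewrite addSn in E1 E2 E3.
rewrite [(a.+1 + n.+1)%N]addSn E1 E2 !(hsymS3 x y) (hsymS3 y x).
ring.
Qed.

End ProductFormula.

Lemma chiS_sym (A : comNzRingType) (x y : A) a b : chiS y x b a = chiS x y a b.
Proof. by rewrite /chiS [RHS]addrC; rewrite ![hsym x y _ * _]mulrC addrC. Qed.

(* The summands with no arc around the corner shared by the two edges. *)
Definition lr_flat (l m : nat * nat) : seq (nat * nat * nat) :=
  (0, 0, 0)%N :: [seq (0, h, 0)%N | h <- iota 1 (minn l.1 m.1)]
     ++ [seq (h, 0, 0)%N | h <- iota 1 (minn l.2 m.2)].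

Lemma lr_flat_uniq l m : uniq (lr_flat l m).
Proof.
rewrite /lr_flat cons_uniq cat_uniq !map_inj_uniq ?iota_uniq ?andbT /=;
  try by move=> ? ? [].
rewrite mem_cat negb_or -andbA; apply/and3P; split.
- by apply/mapP => -[h]; rewrite mem_iota => /andP[h0 _] [] h00; rewrite -h00 in h0.
- by apply/mapP => -[h]; rewrite mem_iota => /andP[h0 _] [] h00; rewrite -h00 in h0.
- apply/hasPn => _ /mapP[h /[!mem_iota]/andP[h0 _] ->].
  by apply/mapP => -[h' _ []] E; rewrite E in h0.
Qed.

Lemma mem_lr_flat l m t : (t \in lr_flat l m) =
  [&& lr_ok l m t, t.2 == 0%N & (t.1.1 == 0%N) || (t.1.2 == 0%N)].
Proof.
case: l m t => [n1 m1] [n2 m2] [[b g] d].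
rewrite inE mem_cat; apply/idP/idP.
  case/or3P; first by move/eqP=> [-> -> ->] /=; lia.
    by move/mapP => [h]; rewrite mem_iota /= => ? [-> -> ->] /=; lia.
  by move/mapP => [h]; rewrite mem_iota /= => ? [-> -> ->] /=; lia.
rewrite /lr_ok /= => /and3P[ok /eqP d0 bg].
have [-> | g0] := eqVneq g 0%N; have [-> | b0] := eqVneq b 0%N.
- by rewrite d0 eqxx.
- apply/or3P/Or33/mapP; exists b; last by rewrite d0.
  by rewrite mem_iota /=; lia.
- apply/or3P/Or32/mapP; exists g; last by rewrite d0.
  by rewrite mem_iota /=; lia.
- by move: bg; rewrite (negPf g0) (negPf b0).
Qed.

Definition lr_bottom (l m : nat * nat) := [seq t <- lr_seq l m | t.2 == 0%N].

Lemma lr_bottom_uniq l m : uniq (lr_bottom l m).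
Proof. exact: filter_uniq (lr_seq_uniq l m). Qed.

(** A corner arc of one orientation adds a strand to each of the two sides and raises [b] and [g]
    together, so the weight on the third side does not change. *)
Lemma lr_bottom_perm n1 m1 n2 m2 :
  perm_eq (lr_bottom (n1.+1, m1) (n2, m2.+1))
    (lr_flat (n1.+1, m1) (n2, m2.+1) ++
     [seq (t.1.1.+1, t.1.2.+1, t.2) | t <- lr_bottom (n1, m1) (n2, m2)]).
Proof.
apply: uniq_perm; first exact: lr_bottom_uniq.
  rewrite cat_uniq lr_flat_uniq map_inj_uniq ?lr_bottom_uniq ?andbT.
    by apply/hasPn => _ /mapP[t _ ->]; rewrite mem_lr_flat !andbF.
  by move=> [[? ?] ?] [[? ?] ?] [-> -> ->].
move=> [[b g] d]; rewrite mem_cat mem_filter mem_lr_seq mem_lr_flat.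
apply/idP/idP.
  move=> ok; apply/orP; case: b g ok => [|b] [|g] ok; [left|left|left|right].
  - by move: ok => /=; lia.
  - by move: ok => /=; lia.
  - by move: ok => /=; lia.
  apply/mapP; exists (b, g, d) => //.
  by rewrite mem_filter mem_lr_seq; move: ok => /=; lia.
case/orP; first by rewrite /=; lia.
case/mapP => -[[b' g'] d']; rewrite mem_filter mem_lr_seq /= => ok [-> -> ->].
by lia.
Qed.

(** Corner arcs of the opposite orientation are counted by [d]; adding one again leaves the third
    side unchanged. *)
Lemma lr_seq_perm n1 m1 n2 m2 :
  perm_eq (lr_seq (n1, m1.+1) (n2.+1, m2))
    (lr_bottom (n1, m1.+1) (n2.+1, m2) ++
     [seq (t.1, t.2.+1) | t <- lr_seq (n1, m1) (n2, m2)]).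
Proof.
apply: uniq_perm; first exact: lr_seq_uniq.
  rewrite cat_uniq lr_bottom_uniq map_inj_uniq ?lr_seq_uniq ?andbT.
    by apply/hasPn => _ /mapP[t _ ->]; rewrite mem_filter.
  by move=> [[? ?] ?] [[? ?] ?] [-> -> ->].
move=> [[b g] d]; rewrite mem_cat mem_lr_seq mem_filter mem_lr_seq.
apply/idP/idP.
  case: d => [|d] ok; apply/orP; [left|right].
    by move: ok => /=; lia.
  apply/mapP; exists (b, g, d) => //.
  by rewrite mem_lr_seq; move: ok => /=; lia.
case/orP; first by rewrite /=; lia.
case/mapP => -[[b' g'] d']; rewrite mem_lr_seq /= => ok [-> -> ->].
by lia.
Qed.

Section ProductFormula2.
Variables (A : comNzRingType) (x y : A).
Local Notation chixy := (chi x y).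
Local Notation chiSxy := (chiS x y).
Local Notation chiwxy := (chiw x y).

Lemma big_iota1 (F : nat -> A) n :
  \sum_(j <- iota 1 n) F j = \sum_(i < n) F (lift ord0 i).
Proof.
have -> : iota 1 n = index_iota 1 n.+1 by rewrite /index_iota subSS subn0.
rewrite big_add1 /= big_mkord; exact: eq_bigr.
Qed.

Lemma lr_flat_sum l m :
  \sum_(t <- lr_flat l m) chiwxy (lr_weight l m t) =
  chiSxy l.1.+1 l.2.+1 * chiSxy m.1.+1 m.2.+1 - chiSxy l.1 l.2.+1 * chiSxy m.1.+1 m.2
    - chiSxy l.1.+1 l.2 * chiSxy m.1 m.2.+1 + chiSxy l.1 l.2 * chiSxy m.1 m.2.
Proof.
case: l m => [n1 m1] [n2 m2] /=; rewrite chi_prod4.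
(* The second strip is the first one with the roles of V and V^* exchanged. *)
have E1 := chi_strip x y n1 n2 (m1 + m2); have E2 := chi_strip y x m1 m2 (n1 + n2).
rewrite !(chiS_sym x y) in E2; rewrite -{}E1 -{}E2.
rewrite big_cons big_cat !big_map !big_ord_recl.
set w := lr_weight _ _.
have -> : chiwxy (w (0, 0, 0)%N) = chiSxy (n1 + n2).+1 (m1 + m2).+1.
  by congr (chiS x y _.+1 _.+1); rewrite /=; lia.
have -> : \sum_(j <- iota 1 (minn n1 n2)) chiwxy (w (0, j, 0)%N)
  = \sum_(i < minn n1 n2) chixy (n2 + n1 - 2 * lift ord0 i) (m1 + m2 + lift ord0 i).
  rewrite big_iota1; apply: eq_bigr => i _.
  by congr (chi x y _ _); rewrite /= /bump /=; lia.
have -> : \sum_(j <- iota 1 (minn m1 m2)) chiwxy (w (j, 0, 0)%N)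
  = \sum_(i < minn m1 m2) chi y x (m2 + m1 - 2 * lift ord0 i) (n1 + n2 + lift ord0 i).
  rewrite big_iota1; apply: eq_bigr => i _.
  by rewrite /chi chiS_sym; congr (chiS x y _.+1 _.+1); rewrite /= /bump /=; lia.
have -> : chixy (n2 + n1 - 2 * @ord0 (minn n1 n2)) (m1 + m2 + @ord0 (minn n1 n2))
  = chiSxy (n1 + n2).+1 (m1 + m2).+1.
  by congr (chiS x y _.+1 _.+1); rewrite /=; lia.
have -> : chi y x (m2 + m1 - 2 * @ord0 (minn m1 m2)) (n1 + n2 + @ord0 (minn m1 m2))
  = chiSxy (n1 + n2).+1 (m1 + m2).+1.
  by rewrite /chi chiS_sym; congr (chiS x y _.+1 _.+1); rewrite /=; lia.
rewrite /=; ring.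
Qed.

(** The four-term differences of [lr_flat_sum] telescope along the arcs that raise [b] and [g]. The
    induction starts where [l.1] or [m.2] is 0: no such arc fits, and the wall terms vanish. *)
Lemma lr_bottom_sum l m :
  \sum_(t <- lr_bottom l m) chiwxy (lr_weight l m t) =
  chiSxy l.1.+1 l.2.+1 * chiSxy m.1.+1 m.2.+1 - chiSxy l.1.+1 l.2 * chiSxy m.1 m.2.+1.
Proof.
have base l' m' : (l'.1 == 0%N) || (m'.2 == 0%N) ->
    perm_eq (lr_bottom l' m') (lr_flat l' m').
  move=> z; apply: uniq_perm; rewrite ?lr_flat_uniq ?lr_bottom_uniq //.
  move=> t; rewrite mem_lr_flat mem_filter mem_lr_seq.
  by case: l' m' t z => [? ?] [? ?] [[? ?] ?] /=; lia.
case: l m => [n1 m1] [n2 m2]; elim: n1 m2 => [|n1 IH] [|m2].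
- by rewrite (perm_big _ (base _ _ _)) // lr_flat_sum /= !chiS0l; ring.
- by rewrite (perm_big _ (base _ _ _)) // lr_flat_sum /= !chiS0l; ring.
- by rewrite (perm_big _ (base _ _ _)) // lr_flat_sum /= !chiS0r; ring.
rewrite (perm_big _ (lr_bottom_perm _ _ _ _)) big_cat big_map lr_flat_sum /=.
have := IH m2; rewrite /= => IH2.
set S := (X in _ + X); have -> : S = chiSxy n1.+1 m1.+1 * chiSxy n2.+1 m2.+1 - chiSxy n1.+1 m1 * chiSxy n2 m2.+1.
  rewrite -IH2; apply: eq_big_seq => -[[b g] d].
  rewrite mem_filter mem_lr_seq => /andP[/= d0 ok].
  by congr (chiwxy (_, _)); lia.
ring.
Qed.

(** Second telescoping, along the arcs counted by [d]. *)
Lemma chi_product l m :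
  chiwxy l * chiwxy m = \sum_(t <- lr_seq l m) chiwxy (lr_weight l m t).
Proof.
have base l' m' : (l'.2 == 0%N) || (m'.1 == 0%N) ->
    lr_seq l' m' = lr_bottom l' m'.
  move=> z; apply/esym/all_filterP/allP => t; rewrite mem_lr_seq.
  by case: l' m' t z => [? ?] [? ?] [[? ?] ?] /=; lia.
case: l m => [n1 m1] [n2 m2]; elim: m1 n2 => [|m1 IH] [|n2].
- by rewrite base // lr_bottom_sum /= !chiS0r /chiw /= /chi; ring.
- by rewrite base // lr_bottom_sum /= !chiS0r /chiw /= /chi; ring.
- by rewrite base // lr_bottom_sum /= !chiS0l /chiw /= /chi; ring.
rewrite (perm_big _ (lr_seq_perm _ _ _ _)) big_cat big_map lr_bottom_sum /=.
set S := (X in _ + X); have -> : S = chiwxy (n1, m1) * chiwxy (n2, m2).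
  rewrite IH; apply: eq_big_seq => -[[b g] d].
  by rewrite mem_lr_seq => ok; congr (chiwxy (_, _)); move: ok => /=; lia.
rewrite /chiw /= /chi; ring.
Qed.

End ProductFormula2.

(** * Linear independence of the characters as functions of x and y *)

Section Independence.
Variable F : numFieldType.

Lemma horner0_eq0 (p : {poly F}) : (forall z, p.[z] = 0) -> p = 0.
Proof.
move=> p0; apply/eqP/negPn/negP => nz.
pose rs := [seq i%:R : F | i <- iota 0 (size p)].
have: (size rs < size p)%N.
  apply: max_poly_roots => //; first by apply/allP => z _; rewrite /root p0.
  by rewrite map_inj_uniq ?iota_uniq // => i j /eqP; rewrite eqr_nat => /eqP.
by rewrite size_map size_iota ltnn.
Qed.

(** Replacing x^2 by y lowers the degree when q < 2p, so x h_{n-1} dominates the recurrence. *)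
Lemma size_hsym_sub (p q n : nat) : (0 < p)%N -> (q < 2 * p)%N ->
  (size (hsym 'X^p 'X^q n.+2 - 'X^(n * p) : {poly F})%R <= n * p)%N.
Proof.
move=> p0 qp; have [m le_nm] := ubnP n; elim: m n le_nm => // m IH [|[|[|n]]] le_nm.
- by rewrite hsym2 mul0n expr0 subrr size_poly0.
- rewrite hsymS3 hsym2 hsym1 hsym0 mul1n mulr0 mulr1 subr0 addr0 subrr.
  by rewrite size_poly0.
- have -> : hsym 'X^p 'X^q 4 - 'X^(2 * p) = - 'X^q :> {poly F}.
    by rewrite !hsymS3 hsym2 hsym1 hsym0 mulSn mul1n exprD; ring.
  by rewrite size_polyN size_polyXn.
have := IH n.+2; have := IH n.+1; have := IH n.
move: (hsym _ _ n.+4) (hsym _ _ n.+3) (hsym _ _ n.+2) (hsymS3 'X^p 'X^q n.+2 : hsym ('X^p : {poly F}) _ _ = _).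
move=> h2 h1 h0 -> H0 H1 H2.
have {}H0 : (size h0 <= (n * p).+1)%N.
  rewrite -[h0](subrK 'X^(n * p)) (leq_trans (size_polyD _ _)) // geq_max.
  by rewrite size_polyXn leqnn andbT (leq_trans (H0 _)) //; lia.
have {}H1 : (size h1 <= (n.+1 * p).+1)%N.
  rewrite -[h1](subrK 'X^(n.+1 * p)) (leq_trans (size_polyD _ _)) // geq_max.
  by rewrite size_polyXn leqnn andbT (leq_trans (H1 _)) //; lia.
have -> : 'X^p * h2 - 'X^q * h1 + h0 - 'X^(n.+3 * p) =
   'X^p * (h2 - 'X^(n.+2 * p)) - 'X^q * h1 + h0.
  by rewrite mulrBr -exprD -mulSn; ring.
rewrite (leq_trans (size_polyD _ _)) // geq_max; apply/andP; split; last first.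
  by apply: leq_trans H0 _; nia.
rewrite (leq_trans (size_polyD _ _)) // geq_max size_polyN; apply/andP; split.
  apply: leq_trans (size_polyMleq _ _) _; rewrite size_polyXn addSn /=.
  by rewrite mulSn leq_add2l H2 //; lia.
apply: leq_trans (size_polyMleq _ _) _; rewrite size_polyXn addSn /=.
by apply: (@leq_trans (q + (n.+1 * p).+1)); [rewrite leq_add2l | nia].
Qed.

Lemma leq_pred2 m n : (m <= n)%N -> (m.-1 <= n.-1)%N.
Proof. by rewrite -!subn1 => /leq_sub2r. Qed.

Lemma size_chi_sub (p q a b : nat) :
  (0 < p)%N -> (0 < q)%N -> (q < 2 * p)%N -> (p < 2 * q)%N ->
  (size (chi 'X^p 'X^q a b - 'X^(a * p + b * q) : {poly F})%R <= a * p + b * q)%N.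
Proof.
move=> p0 q0 qp pq.
have sz u v n : (0 < u)%N -> (v < 2 * u)%N ->
    (size (hsym ('X^u : {poly F}) 'X^v n.+2)%R <= (n * u).+1)%N.
  move=> u0 vu; rewrite -[hsym _ _ _](subrK 'X^(n * u)).
  rewrite (leq_trans (size_polyD _ _)) // geq_max size_polyXn leqnn andbT.
  by rewrite (leq_trans (size_hsym_sub _ _ _)).
have Ha := @size_hsym_sub p q a p0 qp; have Hb := @size_hsym_sub q p b q0 pq.
rewrite /chi /chiS.
have -> : hsym 'X^p 'X^q a.+2 * hsym 'X^q 'X^p b.+2
     - hsym 'X^p 'X^q a.+1 * hsym 'X^q 'X^p b.+1 - 'X^(a * p + b * q) =
   (hsym 'X^p 'X^q a.+2 - 'X^(a * p)) * hsym 'X^q 'X^p b.+2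
   + 'X^(a * p) * (hsym 'X^q 'X^p b.+2 - 'X^(b * q))
   - hsym 'X^p 'X^q a.+1 * hsym 'X^q 'X^p b.+1 :> {poly F}.
  by rewrite exprD; ring.
rewrite (leq_trans (size_polyD _ _)) // geq_max size_polyN; apply/andP; split.
  rewrite (leq_trans (size_polyD _ _)) // geq_max; apply/andP; split.
    apply: leq_trans (size_polyMleq _ _) _.
    apply: leq_trans (leq_pred2 (leq_add Ha (sz q p b q0 pq))) _.
    by rewrite addnS.
  apply: leq_trans (size_polyMleq _ _) _; rewrite size_polyXn addSn /=.
  by rewrite leq_add2l.
case: a {Ha} => [|a]; first by rewrite hsym1 mul0r size_poly0.
case: b {Hb} => [|b]; first by rewrite hsym1 mulr0 size_poly0.
apply: leq_trans (size_polyMleq _ _) _.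
apply: leq_trans (leq_pred2 (leq_add (sz p q a p0 qp) (sz q p b q0 pq))) _.
by rewrite addSn addnS /= !mulSn; lia.
Qed.

Lemma sum_count (V : nmodType) (T : eqType) (L U : seq T) (G : T -> V) :
  uniq U -> {subset L <= U} ->
  \sum_(t <- L) G t = \sum_(w <- U) G w *+ count_mem w L.
Proof.
move=> uU sLU; elim: L sLU => [|t L IH] sLU.
  by rewrite big_nil big1 // => w _; rewrite mulr0n.
rewrite big_cons IH; last by move=> w wL; rewrite sLU // inE wL orbT.
under [in RHS]eq_bigr => w _ do rewrite /= mulrnDr.
rewrite big_split /=; congr (_ + _).
rewrite (bigD1_seq t) ?sLU ?mem_head //= eqxx mulr1n big1 ?addr0 // => w.
by rewrite eq_sym => /negPf ->; rewrite mulr0n.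
Qed.

(* Under x = z^K, y = z^(K+1) with K large, the characters become monic
   polynomials in z of distinct degrees a K + b (K + 1). *)
Lemma chi_count (L1 L2 : seq (nat * nat)) :
  (forall x y : F, \sum_(w <- L1) chiw x y w = \sum_(w <- L2) chiw x y w) ->
  forall w, count_mem w L1 = count_mem w L2.
Proof.
move=> eqL w0; set U := undup (L1 ++ L2).
(* Larger than every second component, so that a K + b (K + 1) modulo [K] recovers b, and at least
   2, so that K + 1 < 2 K. *)
pose K := (\max_(w <- U) w.2).+2.
have ltK w : w \in U -> (w.2.+1 < K)%N.
  by move=> wU; rewrite /K !ltnS (leq_bigmax_seq w).
pose P (w : nat * nat) : {poly F} := chiw ('X^K : {poly F}) 'X^(K.+1) w.
pose deg (w : nat * nat) := (w.1 * K + w.2 * K.+1)%N.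
have deg_inj : {in U &, injective deg}.
  move=> [a b] [a' b'] /ltK /= bK /ltK /= bK'; rewrite /deg /= => E.
  have E1 : ((a + b) * K + b = (a' + b') * K + b')%N by lia.
  have := congr1 (modn ^~ K) E1; rewrite !modnMDl !modn_small; try lia.
  by move=> Eb; congr (_, _); nia.
have coefP w n : (deg w <= n)%N -> (P w)`_n = (n == deg w)%:R.
  move=> len; rewrite -[P w](subrK 'X^(deg w)) coefD coefXn nth_default ?add0r //.
  by apply: leq_trans len; apply: size_chi_sub; rewrite /K; lia.
have hornerP w z : (P w).[z] = chiw (z ^+ K) (z ^+ K.+1) w.
  have hh u v n : (hsym ('X^u : {poly F}) 'X^v n).[z] = hsym (z ^+ u) (z ^+ v) n.
    have [m le_nm] := ubnP n; elim: m n le_nm => // m IH [|[|[|n]]] le_nm.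
    - by rewrite hsym0 horner0.
    - by rewrite hsym1 horner0.
    - by rewrite hsym2 hornerC.
    by rewrite !hsymS3 !(hornerD, hornerN, hornerM, hornerXn) !IH //; lia.
  by rewrite /P /chiw /chi /chiS !(hornerD, hornerN, hornerM) !hh.
have uU : uniq U := undup_uniq _.
have sub1 : {subset L1 <= U} by move=> w wL; rewrite mem_undup mem_cat wL.
have sub2 : {subset L2 <= U} by move=> w wL; rewrite mem_undup mem_cat wL orbT.
have D0 : \sum_(w <- U) P w *+ count_mem w L1 = \sum_(w <- U) P w *+ count_mem w L2.
  rewrite -!sum_count //; apply/eqP; rewrite -subr_eq0; apply/eqP/horner0_eq0 => z.
  rewrite hornerD hornerN !horner_sum.
  under eq_bigr do rewrite hornerP.
  under [X in _ - X]eq_bigr do rewrite hornerP.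
  by rewrite eqL subrr.
apply/eqP/negPn/negP => ne0.
pose bad := [seq w <- U | count_mem w L1 != count_mem w L2].
have w0bad : w0 \in bad.
  rewrite mem_filter ne0 /=; apply: contraNT ne0 => w0U.
  have n1 : w0 \notin L1 by apply: contraNN w0U => /sub1.
  have n2 : w0 \notin L2 by apply: contraNN w0U => /sub2.
  by rewrite (count_memPn n1) (count_memPn n2).
(* Take a weight of maximal degree among those with different multiplicities. In that degree the
   other such weights have coefficient 0, and the weights of equal multiplicity cancel. *)
have [w wbad wmax] : exists2 w, w \in bad & forall v, v \in bad -> (deg v <= deg w)%N.
  have exd : exists n, n \in map deg bad by exists (deg w0); apply: map_f.
  have bd n : n \in map deg bad -> (n <= \max_(v <- bad) deg v)%N.
    by case/mapP => v vb ->; apply: leq_bigmax_seq.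
  case: (ex_maxnP exd bd) => _ /mapP[w wb ->] mx; exists w => // v vb.
  by apply: mx; apply: map_f.
move: (wbad); rewrite mem_filter => /andP[/negP new wU]; apply: new.
have := congr1 (fun p : {poly F} => p`_(deg w)) D0.
rewrite !coef_sum !(bigD1_seq w wU uU) /= !coefMn !coefP // !eqxx.
set S1 := \sum_(v <- U | v != w) _; set S2 := \sum_(v <- U | v != w) _.
have -> : S1 = S2; last by move/addIr/eqP; rewrite eqr_nat.
rewrite /S1 /S2 big_seq_cond [in RHS]big_seq_cond; apply: eq_bigr => v /andP[vU vw].
rewrite !coefMn; have [->//|vbad] := eqVneq (count_mem v L1) (count_mem v L2).
rewrite coefP; last by apply: wmax; rewrite mem_filter vbad.
case: eqP => [/(deg_inj _ _ wU vU) E|]; first by rewrite E eqxx in vw.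
by rewrite !mul0rn.
Qed.

End Independence.

(** * The big cell *)

Definition o0 : 'I_3 := Ordinal (isT : 0 < 3)%N.
Definition o1 : 'I_3 := Ordinal (isT : 1 < 3)%N.
Definition o2 : 'I_3 := Ordinal (isT : 2 < 3)%N.

Lemma ord3P (P : 'I_3 -> Prop) : P o0 -> P o1 -> P o2 -> forall i, P i.
Proof.
move=> P0 P1 P2 [[|[|[|//]]] lt_i3].
- by rewrite (_ : Ordinal _ = o0) //; apply: val_inj.
- by rewrite (_ : Ordinal _ = o1) //; apply: val_inj.
- by rewrite (_ : Ordinal _ = o2) //; apply: val_inj.
Qed.

Lemma sum3 (V : nmodType) (F : 'I_3 -> V) : \sum_i F i = F o0 + F o1 + F o2.
Proof.
rewrite !big_ord_recl big_ord0 addr0 addrA.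
by congr (F _ + F _ + F _); apply: val_inj.
Qed.

Section Matrix3.
Variable T : comNzRingType.

Definition mx3 (a b c d e f g h i : T) : 'M[T]_3 :=
  \matrix_(r, s) nth 0 (nth [::] [:: [:: a; b; c]; [:: d; e; f]; [:: g; h; i]] r) s.

Lemma mx3_eta (A : 'M[T]_3) : A = mx3 (A o0 o0) (A o0 o1) (A o0 o2)
  (A o1 o0) (A o1 o1) (A o1 o2) (A o2 o0) (A o2 o1) (A o2 o2).
Proof. by apply/matrixP; elim/ord3P; elim/ord3P; rewrite mxE. Qed.

Lemma mulmx3 a b c d e f g h i a' b' c' d' e' f' g' h' i' :
  mx3 a b c d e f g h i *m mx3 a' b' c' d' e' f' g' h' i' =
  mx3 (a * a' + b * d' + c * g') (a * b' + b * e' + c * h') (a * c' + b * f' + c * i')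
      (d * a' + e * d' + f * g') (d * b' + e * e' + f * h') (d * c' + e * f' + f * i')
      (g * a' + h * d' + i * g') (g * b' + h * e' + i * h') (g * c' + h * f' + i * i').
Proof. by apply/matrixP; elim/ord3P; elim/ord3P; rewrite !mxE sum3 !mxE. Qed.

Lemma det_mx3 a b c d e f g h i : \det (mx3 a b c d e f g h i) =
  a * (e * i - f * h) - b * (d * i - f * g) + c * (d * h - e * g).
Proof.
rewrite (expand_det_row _ o0) sum3 /cofactor.
rewrite !(expand_det_row _ (ord0 : 'I_2)) !big_ord_recl !big_ord0 /cofactor.
rewrite !det_mx11 !mxE /= /bump /= !add1n !addn0 !addn1 !expr0 !expr1 !expr2.
ring.
Qed.

Definition upper (x y z : T) := mx3 1 x y 0 1 z 0 0 1.
Definition lower (x y z : T) := mx3 1 0 0 x 1 0 y z 1.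
Definition diag3 (a b c : T) := mx3 a 0 0 0 b 0 0 0 c.

Lemma det_upper x y z : \det (upper x y z) = 1.
Proof. by rewrite det_mx3; ring. Qed.

Lemma det_lower x y z : \det (lower x y z) = 1.
Proof. by rewrite det_mx3; ring. Qed.

Lemma det_diag3 a b c : \det (diag3 a b c) = a * b * c.
Proof. by rewrite det_mx3; ring. Qed.

Lemma diag_mx3 (t : 'rV[T]_3) : diag_mx t = diag3 (t 0 o0) (t 0 o1) (t 0 o2).
Proof. by apply/matrixP; elim/ord3P; elim/ord3P; rewrite !mxE. Qed.

Lemma tr_mx3 a b c d e f g h i : (mx3 a b c d e f g h i)^T = mx3 a d g b e h c f i.
Proof. by apply/matrixP; elim/ord3P; elim/ord3P; rewrite !mxE. Qed.

Lemma mx3_1 : 1%:M = diag3 1 1 1.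
Proof. by apply/matrixP; elim/ord3P; elim/ord3P; rewrite !mxE. Qed.

Definition minor2 (g : 'M[T]_3) : T := g o0 o0 * g o1 o1 - g o0 o1 * g o1 o0.

End Matrix3.

Lemma map_mx3 (T T' : comNzRingType) (f : T -> T') a b c d e g h i j :
  map_mx f (mx3 a b c d e g h i j) = mx3 (f a) (f b) (f c) (f d) (f e) (f g) (f h) (f i) (f j).
Proof. by apply/matrixP; elim/ord3P; elim/ord3P; rewrite !mxE. Qed.

Section PolynomialFunctions.
Variable C : fieldType.
Implicit Type F : 'M[C]_3 -> C.

Local Notation at_ z G := (map_mx (horner_eval z) G).

(* All that is used of regular functions on SL_3: their restrictions to
   polynomial curves are polynomials. *)
Definition pcurve F := forall G : 'M[{poly C}]_3,
  exists q : {poly C}, forall z, \det (at_ z G) = 1 -> F (at_ z G) = q.[z].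

Lemma pcurve_entry i j : pcurve (fun g => g i j).
Proof. by move=> G; exists (G i j) => z _; rewrite mxE. Qed.

Lemma pcurve_cst c : pcurve (fun=> c).
Proof. by move=> G; exists c%:P => z _; rewrite hornerC. Qed.

Lemma pcurveD F1 F2 : pcurve F1 -> pcurve F2 -> pcurve (fun g => F1 g + F2 g).
Proof.
move=> h1 h2 G; have [q1 e1] := h1 G; have [q2 e2] := h2 G.
by exists (q1 + q2) => z dz; rewrite hornerD e1 ?e2.
Qed.

Lemma pcurveM F1 F2 : pcurve F1 -> pcurve F2 -> pcurve (fun g => F1 g * F2 g).
Proof.
move=> h1 h2 G; have [q1 e1] := h1 G; have [q2 e2] := h2 G.
by exists (q1 * q2) => z dz; rewrite hornerM e1 ?e2.
Qed.

Lemma pcurveN F1 : pcurve F1 -> pcurve (fun g => - F1 g).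
Proof.
move=> h1 G; have [q1 e1] := h1 G.
by exists (- q1) => z dz; rewrite hornerN e1.
Qed.

Lemma pcurveB F1 F2 : pcurve F1 -> pcurve F2 -> pcurve (fun g => F1 g - F2 g).
Proof. by move=> h1 h2; apply: pcurveD => //; apply: pcurveN. Qed.

Lemma pcurveX F1 n : pcurve F1 -> pcurve (fun g => F1 g ^+ n).
Proof.
by move=> h1 G; have [q1 e1] := h1 G; exists (q1 ^+ n) => z dz; rewrite horner_exp e1.
Qed.

Lemma pcurve_sum (I : finType) (Fs : I -> 'M[C]_3 -> C) :
  (forall i, pcurve (Fs i)) -> pcurve (fun g => \sum_i Fs i g).
Proof.
move=> h G; have /choice[q e] i := h i G.
by exists (\sum_i q i) => z dz; rewrite horner_sum; apply: eq_bigr => i _; rewrite e.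
Qed.

Lemma pcurve_prod (I : finType) (Fs : I -> 'M[C]_3 -> C) :
  (forall i, pcurve (Fs i)) -> pcurve (fun g => \prod_i Fs i g).
Proof.
move=> h G; have /choice[q e] i := h i G.
by exists (\prod_i q i) => z dz; rewrite horner_prod; apply: eq_bigr => i _; rewrite e.
Qed.

Lemma pcurve_ext F1 F2 :
  (forall g, \det g = 1 -> F1 g = F2 g) -> pcurve F1 -> pcurve F2.
Proof.
by move=> e h G; have [q eq] := h G; exists q => z dz; rewrite -e // eq.
Qed.

Lemma pcurve_minor2 : pcurve (@minor2 C).
Proof. by apply: pcurveB; apply: pcurveM; apply: pcurve_entry. Qed.

(** Gaussian elimination; the last pivot is the inverse of the leading minor because the determinant
    is 1. *)
Lemma ldu (g : 'M[C]_3) : \det g = 1 -> g o0 o0 != 0 -> minor2 g != 0 ->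
  exists l1 l2 l3 u1 u2 u3, g = lower l1 l2 l3 *m
    diag3 (g o0 o0) (minor2 g / g o0 o0) (minor2 g)^-1 *m upper u1 u2 u3.
Proof.
rewrite [g]mx3_eta /minor2 !mxE /=.
move: (g o0 o0) (g o0 o1) (g o0 o2) (g o1 o0) (g o1 o1) (g o1 o2) (g o2 o0) (g o2 o1) (g o2 o2).
move=> a b c d e f p q r; rewrite det_mx3 => det1 a0 D0.
exists (d / a), (p / a), ((a * q - b * p) / (a * e - b * d)).
exists (b / a), (c / a), ((a * f - c * d) / (a * e - b * d)).
have Dr : (a * e - b * d)^-1 * a = r * a - (p * c) - (a * q - b * p) * (a * f - c * d) / (a * e - b * d).
  apply: (mulfI D0); rewrite mulrA divff // mul1r -{1}[a]mulr1 -det1.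
  by field.
rewrite /lower /upper /diag3 !mulmx3.
have Er : r = (a * e - b * d)^-1 + p * c / a
      + (a * q - b * p) * (a * f - c * d) / (a * e - b * d) / a.
  apply: (mulIf a0); rewrite !mulrDl Dr !mulfVK //; ring.
by congr mx3; rewrite ?{1}Er; field; rewrite ?a0 ?D0.
Qed.

End PolynomialFunctions.

Section BigCell.
Variable C : numFieldType.
Local Notation at_ z G := (map_mx (horner_eval z) G).

(* Every g is the value at z = 0 of the curve u(z) g, where u(z) is upper
   unitriangular with entries z, z^2, z^3, which meets the big cell. *)
Lemma bigcell_dense (F : 'M[C]_3 -> C) : pcurve F ->
  (forall g, \det g = 1 -> g o0 o0 != 0 -> minor2 g != 0 -> F g = 0) ->
  forall g, \det g = 1 -> F g = 0.
Proof.
move=> pF F0 g det_g.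
pose G : 'M[{poly C}]_3 := upper 'X 'X^2 'X^3 *m map_mx polyC g.
have GE z : at_ z G = upper z (z ^+ 2) (z ^+ 3) *m g.
  rewrite /G map_mxM /upper map_mx3 /= /horner_eval !hornerE; congr (_ *m _).
  by apply/matrixP => i j; rewrite !mxE /horner_eval hornerC.
have [q Fq] := pF G.
(* By Cauchy-Binet, the exponents 1, 2, 3 put the three minors of the first two columns of [g] into
   the coefficients of degrees 0, 3 and 4. They cannot all vanish, nor can the first column, so both
   polynomials are nonzero. *)
pose P (i j : 'I_3) := g i o0 * g j o1 - g i o1 * g j o0.
pose phi1 := Poly [:: g o0 o0; g o1 o0; g o2 o0].
pose phi2 := Poly [:: P o0 o1; 0; - P o1 o2; P o0 o2; P o1 o2].
have E1 z : (at_ z G) o0 o0 = phi1.[z].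
  by rewrite GE [g in LHS]mx3_eta /upper mulmx3 mxE /= horner_Poly /=; ring.
have E2 z : minor2 (at_ z G) = phi2.[z].
  rewrite GE [g in LHS]mx3_eta /upper mulmx3 /minor2 !mxE /= horner_Poly /= /P; ring.
have detG z : \det (at_ z G) = 1 by rewrite GE det_mulmx det_upper det_g mul1r.
have q0 : q * (phi1 * phi2) = 0.
  apply: horner0_eq0 => z; rewrite !hornerM -Fq // -E1 -E2.
  have [->|n1] := eqVneq (at_ z G o0 o0) 0; first by rewrite mul0r mulr0.
  have [->|n2] := eqVneq (minor2 (at_ z G)) 0; first by rewrite !mulr0.
  by rewrite F0 ?mul0r.
have := det_g; rewrite {1}[g]mx3_eta det_mx3 => det_g'.
have n1 : phi1 != 0.
  apply/eqP => p0; have c i := congr1 (fun p : {poly C} => p`_i) p0.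
  move: (c 0%N) (c 1%N) (c 2%N); rewrite !coef_Poly !coef0 /= => z0 z1 z2.
  move: det_g'; rewrite z0 z1 z2 => /eqP; rewrite eq_sym.
  by rewrite (_ : _ - _ + _ = 0) ?oner_eq0 //; ring.
have n2 : phi2 != 0.
  apply/eqP => p0; have c i := congr1 (fun p : {poly C} => p`_i) p0.
  move: (c 0%N) (c 3%N) (c 4%N); rewrite !coef_Poly !coef0 /= => z0 z1 z2.
  have : g o0 o2 * P o1 o2 - g o1 o2 * P o0 o2 + g o2 o2 * P o0 o1 = 1.
    by rewrite -det_g' /P; ring.
  by rewrite z0 z1 z2 => /eqP; rewrite !mulr0 subrr addr0 eq_sym oner_eq0.
have {}q0 : q = 0.
  by apply/eqP; move/eqP: q0; rewrite !mulf_eq0 (negPf n1) (negPf n2) !orbF.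
have := Fq 0 (detG 0); rewrite q0 horner0 GE.
rewrite !expr0n /= (_ : upper 0 0 0 = 1%:M) ?mul1mx //.
by rewrite mx3_1.
Qed.

End BigCell.

(** * Representations *)

Section LinearAlgebra.
Variable C : numClosedFieldType.

Definition hc m n (A : 'M[C]_(m, n)) : 'M[C]_(n, m) := map_mx Num.conj A^T.

Lemma hcE m n (A : 'M[C]_(m, n)) i j : hc A i j = (A j i)^*.
Proof. by rewrite !mxE. Qed.

Lemma hcK m n (A : 'M[C]_(m, n)) : hc (hc A) = A.
Proof. by apply/matrixP => i j; rewrite !hcE conjCK. Qed.

Lemma hcM m n p (A : 'M[C]_(m, n)) (B : 'M[C]_(n, p)) :
  hc (A *m B) = hc B *m hc A.
Proof. by rewrite /hc trmx_mul map_mxM. Qed.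

Lemma hcB m n (A B : 'M[C]_(m, n)) : hc (A - B) = hc A - hc B.
Proof. by rewrite /hc linearB map_mxB. Qed.

Lemma hcD m n (A B : 'M[C]_(m, n)) : hc (A + B) = hc A + hc B.
Proof. by rewrite /hc linearD map_mxD. Qed.

Lemma hc0 m n : hc (0 : 'M[C]_(m, n)) = 0.
Proof. by rewrite /hc trmx0 map_mx0. Qed.

Lemma hc_sum m n I (r : seq I) (P : pred I) (F : I -> 'M[C]_(m, n)) :
  hc (\sum_(i <- r | P i) F i) = \sum_(i <- r | P i) hc (F i).
Proof. exact: (big_morph _ (@hcD m n) (@hc0 m n)). Qed.

Lemma hcZ m n a (A : 'M[C]_(m, n)) : hc (a *: A) = a^* *: hc A.
Proof. by rewrite /hc linearZ map_mxZ. Qed.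

Lemma hc1 n : hc (1%:M : 'M[C]_n) = 1%:M.
Proof. by rewrite /hc trmx1 map_mx1. Qed.

Lemma det_hc n (A : 'M[C]_n) : \det (hc A) = (\det A)^*.
Proof. by rewrite /hc det_map_mx det_tr. Qed.

Lemma hc_mul_eq0 m n (A : 'M[C]_(m, n)) : hc A *m A = 0 -> A = 0.
Proof.
move=> AA0; apply/matrixP => i j; rewrite mxE.
have := congr1 (fun M : 'M_n => M j j) AA0; rewrite !mxE => /eqP.
rewrite psumr_eq0 => [/allP/(_ i (mem_index_enum i))|k _]; last first.
  by rewrite hcE mulrC mul_conjC_ge0.
by rewrite hcE mulrC mul_conjC_eq0 => /eqP.
Qed.

Lemma sqnorm_eq0 n (w : 'cV[C]_n) : ((hc w *m w) 0 0 == 0) = (w == 0).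
Proof.
apply/eqP/eqP => [z|->]; last by rewrite mulmx0 mxE.
by apply: hc_mul_eq0; apply/matrixP => i j; rewrite !ord1 z mxE.
Qed.

Definition cols (T : Type) n r (F : T -> 'cV[C]_n) (x : 'I_r -> T) : 'M[C]_(n, r) :=
  \matrix_(i, j) F (x j) i 0.

Lemma mulmx_cols T m n r (M : 'M_(m, n)) (F : T -> 'cV[C]_n) (x : 'I_r -> T) :
  M *m cols F x = cols (fun t => M *m F t) x.
Proof.
by apply/matrixP => i j; rewrite !mxE; apply: eq_bigr => k _; rewrite !mxE.
Qed.

Lemma cols_mul T n r (F : T -> 'cV[C]_n) (x : 'I_r -> T) (c : 'cV_r) :
  cols F x *m c = \sum_j c j 0 *: F (x j).
Proof.
apply/colP => i; rewrite !mxE summxE; apply: eq_bigr => j _.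
by rewrite !mxE mulrC.
Qed.

Lemma cols_eq0 T n r (F : T -> 'cV[C]_n) (x : 'I_r -> T) :
  (forall j, F (x j) = 0) -> cols F x = 0.
Proof. by move=> z; apply/matrixP => i j; rewrite !mxE z mxE. Qed.

Lemma span_family (T : Type) n (F : T -> 'cV[C]_n) :
  exists r (x : 'I_r -> T),
    (exists L : 'M_(r, n), L *m cols F x = 1%:M) /\
    forall t, exists c : 'cV_r, F t = cols F x *m c.
Proof.
pose P r := `[< exists x : 'I_r -> T, row_free (cols F x)^T >].
have P0 : exists r, P r.
  exists 0%N; apply/asboolP; exists (fun i : 'I_0 => match i with Ordinal _ h => False_rect T (notF h) end).
  by rewrite /row_free eqn_leq rank_leq_row.
have Pb r : P r -> (r <= n)%N.
  by move=> /asboolP[x /eqP <-]; apply: rank_leq_col.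
case: (ex_maxnP P0 Pb) => r /asboolP[x free_x] max_r; exists r, x; split.
  have /row_freeP[B AB] := free_x; exists B^T.
  by apply: trmx_inj; rewrite trmx_mul trmxK trmx1.
move=> t; suff /submxP[D FD] : ((F t)^T <= (cols F x)^T)%MS.
  by exists D^T; apply: trmx_inj; rewrite FD trmx_mul trmxK.
apply/negPn/negP => nsub.
have : P (1 + r)%N.
  apply/asboolP; exists (fun i => match split i with inl _ => t | inr j => x j end).
  set x' := fun _ => _; have -> : (cols F x')^T = col_mx (F t)^T (cols F x)^T.
    apply/matrixP => i j; rewrite !mxE /x'; case: splitP => k _; rewrite !mxE //.
    by rewrite ord1.
  rewrite /row_free eqn_leq rank_leq_row /=.
  rewrite -addsmxE -[X in (1 + X)%N](eqP free_x) ltn_neqAle mxrankS ?addsmxSr // andbT.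
  apply: contra nsub => /eqP e; apply: submx_trans (addsmxSl _ (cols F x)^T) _.
  by have := mxrank_leqif_sup (addsmxSr (F t)^T (cols F x)^T) => -[_]; rewrite e eqxx.
by move/max_r; rewrite ltnn.
Qed.

Lemma lin_ext (T : Type) n n' (F : T -> 'cV[C]_n) (F' : T -> 'cV[C]_n') :
  (forall r (x : 'I_r -> T) (c : 'I_r -> C),
     \sum_j c j *: F (x j) = 0 -> \sum_j c j *: F' (x j) = 0) ->
  exists J : 'M_(n', n), forall t, J *m F t = F' t.
Proof.
move=> rel; have [r [x [[L LA] sp]]] := span_family F.
exists (cols F' x *m L) => t; have [c Ft] := sp t.
rewrite {1}Ft -mulmxA [L *m _]mulmxA LA mul1mx.
(* The expansion of [F t] in the chosen subfamily is written as a relation, with coefficient -1 on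
   [t], and transferred to [F']. *)
pose x' (i : 'I_(1 + r)) := match split i with inl _ => t | inr j => x j end.
pose c' (i : 'I_(1 + r)) := match split i with inl _ => -1 | inr j => c j 0 end.
have sE m (G : T -> 'cV[C]_m) : \sum_j c' j *: G (x' j) = cols G x *m c - G t.
  rewrite big_split_ord big_ord1 /= cols_mul addrC; congr (_ + _).
    by apply: eq_bigr => j _; rewrite /c' /x' -[rshift _ _]/(unsplit (inr j)) unsplitK.
  by rewrite /c' /x' -[lshift _ _]/(unsplit (inl (ord0 : 'I_1))) unsplitK scaleN1r.
have := rel _ x' c'; rewrite !sE -Ft subrr => /(_ erefl)/eqP.
by rewrite subr_eq0 => /eqP.
Qed.

(** The projector A (A^* A)^{-1} A^*; the Gram matrix is invertible since [A] is injective and the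
    form positive definite. *)
Lemma orthproj n r (A : 'M[C]_(n, r)) (L : 'M_(r, n)) : L *m A = 1%:M ->
  exists Q : 'M_n, [/\ hc Q = Q, Q *m Q = Q, Q *m A = A & exists B, Q = A *m B].
Proof.
move=> LA; pose G := hc A *m A.
have hG : hc G = G by rewrite /G hcM hcK.
have uG : G \in unitmx.
  rewrite -row_free_unit -kermx_eq0; apply/eqP.
  have := mulmx_ker G; move: (kermx G) => u uG0.
  have Au : A *m hc u = 0.
    by apply: hc_mul_eq0; rewrite hcM hcK mulmxA -[_ *m A]mulmxA -/G uG0 mul0mx.
  have : hc u = 0 by rewrite -[hc u]mul1mx -LA -mulmxA Au mulmx0.
  by move/(congr1 (@hc _ _)); rewrite hcK hc0.
have hV : hc (invmx G) = invmx G.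
  have : hc (invmx G) *m G = 1%:M by rewrite -[G in X in _ *m X]hG -hcM mulmxV // hc1.
  by move/(congr1 (fun M => M *m invmx G)); rewrite -mulmxA mulmxV // mulmx1 mul1mx.
exists (A *m (invmx G *m hc A)); split; last by exists (invmx G *m hc A).
- by rewrite !hcM hcK hV mulmxA.
- rewrite -!mulmxA; congr (_ *m _); rewrite [hc A *m (A *m _)]mulmxA -/G.
  by rewrite [invmx G *m (G *m _)]mulmxA mulVmx // mul1mx.
- by rewrite -!mulmxA -/G mulVmx // mulmx1.
Qed.

End LinearAlgebra.

(** * Highest weight vectors and their matrix coefficients *)

Section Representations.
Variable C : numClosedFieldType.

Record polyrep n (s : 'M[C]_3 -> 'M[C]_n) : Prop := Polyrep {
  rep1 : s 1%:M = 1%:M;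
  repM : forall g h, \det g = 1 -> \det h = 1 -> s (g *m h) = s g *m s h;
  rep_pcurve : forall i j, pcurve (fun g => s g i j) }.

Definition mono (e : nat * nat * nat) (a b c : C) : C :=
  a ^+ e.1.1 * b ^+ e.1.2 * c ^+ e.2.

(** Unitary on SU(3), in coordinates that diagonalise the torus. Natural exponents suffice because a
    weight may be multiplied by powers of a b c = 1. *)
Record star_rep n (s : 'M[C]_3 -> 'M[C]_n) : Prop := StarRep {
  star_poly :> polyrep s;
  rep_star : forall g, \det g = 1 -> s (hc g) = hc (s g);
  rep_diag : exists e : 'I_n -> nat * nat * nat, forall a b c, a * b * c = 1 ->
      s (diag3 a b c) = diag_mx (\row_i mono (e i) a b c) }.

Definition ufixed n (s : 'M[C]_3 -> 'M[C]_n) (v : 'cV[C]_n) : Prop :=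
  forall x y z, s (upper x y z) *m v = v.

Definition wvec n (s : 'M[C]_3 -> 'M[C]_n) (v : 'cV[C]_n) e : Prop :=
  forall a b c, a * b * c = 1 -> s (diag3 a b c) *m v = mono e a b c *: v.

Record hwv n (s : 'M[C]_3 -> 'M[C]_n) (v : 'cV[C]_n) (w : nat * nat) : Prop := Hwv {
  hwv_neq0 : v != 0;
  hwv_fixed : ufixed s v;
  hwv_weight : wvec s v (w.1 + w.2, w.2, 0)%N }.

Definition hwfun (w : nat * nat) (g : 'M[C]_3) : C := g o0 o0 ^+ w.1 * minor2 g ^+ w.2.

Lemma pcurve_coef n (s : 'M[C]_3 -> 'M[C]_n) (l : 'rV_n) (v : 'cV_n) :
  polyrep s -> pcurve (fun g => (l *m s g *m v) 0 0).
Proof.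
move=> rs; apply: (@pcurve_ext _ (fun g => \sum_j (\sum_i l 0 i * s g i j) * v j 0)).
  by move=> g _; rewrite mxE; apply: eq_bigr => j _; rewrite mxE.
apply: pcurve_sum => j; apply: pcurveM; last exact: pcurve_cst.
apply: pcurve_sum => i; apply: pcurveM; first exact: pcurve_cst.
exact: (rep_pcurve rs).
Qed.

Section MatrixCoefficient.
Variables (n : nat) (s : 'M[C]_3 -> 'M[C]_n) (rs : polyrep s).
Variables (l : 'rV[C]_n) (v : 'cV[C]_n) (e : nat * nat * nat).
Hypotheses (l_fix : forall x y z, l *m s (lower x y z) = l).
Hypotheses (v_fix : ufixed s v) (v_wt : wvec s v e).

Lemma coef_bigcell g : \det g = 1 -> g o0 o0 != 0 -> minor2 g != 0 ->
  (l *m s g *m v) 0 0 =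
  (l *m v) 0 0 * mono e (g o0 o0) (minor2 g / g o0 o0) (minor2 g)^-1.
Proof.
move=> dg g0 D0; have [l1 [l2 [l3 [u1 [u2 [u3 gE]]]]]] := ldu dg g0 D0.
rewrite {1}gE.
set a := g o0 o0; set D := minor2 g.
have abc : a * (D / a) * D^-1 = 1 by rewrite /a /D; field; rewrite g0 D0.
have dd : \det (diag3 a (D / a) D^-1) = 1 by rewrite det_diag3.
rewrite !repM ?det_mulmx ?det_lower ?det_upper ?dd ?mulr1 //.
rewrite mulmxA [l *m _]mulmxA l_fix -!mulmxA v_fix v_wt // -scalemxAr mxE mulrC.
by [].
Qed.

(** If dominance failed, clearing the denominator in [coef_bigcell] would give an identity of
    regular functions, valid everywhere by density, and contradicted where the cleared factor
    vanishes. *)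
Lemma weight_dominant : (l *m v) 0 0 != 0 -> (e.1.2 <= e.1.1)%N && (e.2 <= e.1.2)%N.
Proof.
move=> lv0; move: coef_bigcell; rewrite /mono; move: e => [[p q] r] /= cB.
pose F g := (l *m s g *m v) 0 0.
have pF : pcurve F by apply: pcurve_coef.
rewrite [(q <= p)%N]leqNgt [(r <= q)%N]leqNgt -negb_or; apply/negP => /orP[lt_pq|lt_qr].
  pose F1 g := F g * g o0 o0 ^+ (q - p) * minor2 g ^+ r - (l *m v) 0 0 * minor2 g ^+ q.
  have pF1 : pcurve F1.
    apply: pcurveB; last by apply: pcurveM; [exact: pcurve_cst | apply: pcurveX; exact: pcurve_minor2].
    apply: pcurveM; last by apply: pcurveX; exact: pcurve_minor2.
    by apply: pcurveM => //; apply: pcurveX; exact: pcurve_entry.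
  have F10 g : \det g = 1 -> g o0 o0 != 0 -> minor2 g != 0 -> F1 g = 0.
    move=> dg g0 D0; rewrite /F1 /F cB // !exprMn !exprVn.
    have -> : g o0 o0 ^+ q = g o0 o0 ^+ (q - p) * g o0 o0 ^+ p.
      by rewrite -exprD subnK // ltnW.
    by field; rewrite !expf_neq0.
  (* A lift of the first simple reflection: corner entry 0, leading minor 1. The second case uses
     the other simple reflection, where these values are exchanged. *)
  pose g1 : 'M[C]_3 := mx3 0 1 0 (-1) 0 0 0 0 1.
  have dg1 : \det g1 = 1 by rewrite det_mx3; ring.
  have g10 : g1 o0 o0 = 0 by rewrite mxE.
  have D1 : minor2 g1 = 1 by rewrite /minor2 !mxE /=; ring.
  have := bigcell_dense pF1 F10 dg1; rewrite /F1 g10 D1.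
  rewrite expr0n subn_eq0 leqNgt lt_pq mulr0 mul0r sub0r.
  by rewrite expr1n mulr1 => /eqP; rewrite oppr_eq0 (negPf lv0).
pose F1 g := F g * g o0 o0 ^+ q * minor2 g ^+ (r - q) - (l *m v) 0 0 * g o0 o0 ^+ p.
have pF1 : pcurve F1.
  apply: pcurveB; last by apply: pcurveM; [exact: pcurve_cst | apply: pcurveX; exact: pcurve_entry].
  apply: pcurveM; last by apply: pcurveX; exact: pcurve_minor2.
  by apply: pcurveM => //; apply: pcurveX; exact: pcurve_entry.
have F10 g : \det g = 1 -> g o0 o0 != 0 -> minor2 g != 0 -> F1 g = 0.
  move=> dg g0 D0; rewrite /F1 /F cB // !exprMn !exprVn.
  have -> : minor2 g ^+ r = minor2 g ^+ (r - q) * minor2 g ^+ q.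
    by rewrite -exprD subnK // ltnW.
  by field; rewrite !expf_neq0.
pose g1 : 'M[C]_3 := mx3 1 0 0 0 0 1 0 (-1) 0.
have dg1 : \det g1 = 1 by rewrite det_mx3; ring.
have g10 : g1 o0 o0 = 1 by rewrite mxE.
have D1 : minor2 g1 = 0 by rewrite /minor2 !mxE /=; ring.
have := bigcell_dense pF1 F10 dg1; rewrite /F1 g10 D1.
rewrite expr0n subn_eq0 leqNgt lt_qr mulr0 sub0r.
by rewrite expr1n mulr1 => /eqP; rewrite oppr_eq0 (negPf lv0).
Qed.

Lemma coef_hwfun (w : nat * nat) : e = (w.1 + w.2, w.2, 0)%N ->
  forall g, \det g = 1 -> (l *m s g *m v) 0 0 = (l *m v) 0 0 * hwfun w g.
Proof.
move=> eE g dg; apply/eqP; rewrite -subr_eq0; apply/eqP; move: g dg.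
apply: bigcell_dense => [|g dg g0 D0].
  apply: pcurveB; first exact: pcurve_coef.
  apply: pcurveM; first exact: pcurve_cst.
  by apply: pcurveM; apply: pcurveX; [exact: pcurve_entry | exact: pcurve_minor2].
rewrite coef_bigcell // eE /mono /hwfun /= !exprMn !exprVn exprD.
by field; rewrite expf_neq0.
Qed.

End MatrixCoefficient.
End Representations.

(** * Orthogonal projectors onto cyclic modules *)

Section CyclicModules.
Variable C : numClosedFieldType.

Record projr n (s : 'M[C]_3 -> 'M[C]_n) (P : 'M[C]_n) : Prop := Projr {
  projH : hc P = P;
  projI : P *m P = P;
  projC : forall g, \det g = 1 -> P *m s g = s g *m P }.

(* [Q] is the orthogonal projector onto the linear span of the orbit of [w]. *)
Record cyc n (s : 'M[C]_3 -> 'M[C]_n) (w : 'cV[C]_n) (Q : 'M[C]_n) : Prop := Cyc {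
  cyc_proj :> projr s Q;
  cyc_id : Q *m w = w;
  cyc_min : forall m (M : 'M_(m, n)),
    (forall g, \det g = 1 -> M *m (s g *m w) = 0) -> M *m Q = 0 }.

Definition sl3 := {g : 'M[C]_3 | \det g = 1}.

Lemma det_hc1 (g : 'M[C]_3) : \det g = 1 -> \det (hc g) = 1.
Proof. by rewrite det_hc => ->; rewrite rmorph1. Qed.

Lemma det_mul1 (g h : 'M[C]_3) : \det g = 1 -> \det h = 1 -> \det (g *m h) = 1.
Proof. by move=> dg dh; rewrite det_mulmx dg dh mulr1. Qed.

Definition sl3M (g h : sl3) : sl3 := exist _ _ (det_mul1 (svalP g) (svalP h)).

Lemma projr0 n (s : 'M[C]_3 -> 'M[C]_n) : projr s 0.
Proof. by split=> [||g _]; rewrite ?hc0 ?mul0mx ?mulmx0. Qed.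

Lemma projrB n (s : 'M[C]_3 -> 'M[C]_n) P Q :
  projr s P -> projr s Q -> P *m Q = Q -> projr s (P - Q).
Proof.
move=> pP pQ PQ; have QP : Q *m P = Q.
  by rewrite -[Q]hcK -[P]hcK -hcM (projH pP) (projH pQ) PQ (projH pQ).
split; first by rewrite hcB (projH pP) (projH pQ).
  by rewrite mulmxBl !mulmxBr (projI pP) (projI pQ) PQ QP subrr subr0.
by move=> g dg; rewrite mulmxBl mulmxBr (projC pP) // (projC pQ).
Qed.

Lemma projrD n (s : 'M[C]_3 -> 'M[C]_n) P Q :
  projr s P -> projr s Q -> P *m Q = 0 -> projr s (P + Q).
Proof.
move=> pP pQ PQ; have QP : Q *m P = 0.
  by rewrite -[Q]hcK -[P]hcK -hcM (projH pP) (projH pQ) PQ hc0.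
split; first by rewrite hcD (projH pP) (projH pQ).
  by rewrite mulmxDl !mulmxDr (projI pP) (projI pQ) PQ QP addr0 add0r.
by move=> g dg; rewrite mulmxDl mulmxDr (projC pP) // (projC pQ).
Qed.

Lemma cyc_exists n (s : 'M[C]_3 -> 'M[C]_n) (w : 'cV[C]_n) :
  star_rep s -> exists Q, cyc s w Q.
Proof.
move=> ss; pose F (g : sl3) := s (sval g) *m w.
have [r [x [[L LA] sp]]] := span_family F.
have [Q [hQ QQ QA [B QB]]] := orthproj LA.
have QF g : \det g = 1 -> Q *m (s g *m w) = s g *m w.
  move=> dg; have [c] := sp (exist _ g dg); rewrite /F /= => ->.
  by rewrite mulmxA QA.
have Qmin m (M : 'M_(m, n)) :
    (forall g, \det g = 1 -> M *m (s g *m w) = 0) -> M *m Q = 0.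
  move=> M0; rewrite QB mulmxA mulmx_cols cols_eq0 ?mul0mx // => j.
  by apply: M0; case: (x j).
exists Q; split=> //.
  split=> // h dh.
  (* Stability of the span. The adjoint of this relation at g^* is Q s(g) Q = Q s(g), and the two
     together give commutation. *)
  have QsQ g : \det g = 1 -> Q *m s g *m Q = s g *m Q.
    move=> dg; apply/eqP; rewrite -subr_eq0 -mulmxBl; apply/eqP/Qmin => g' dg'.
    rewrite mulmxBl -mulmxA [s g *m _]mulmxA -(repM ss) //.
    by rewrite QF ?det_mul1 // subrr.
  rewrite -QsQ //; have := congr1 (@hc C _ _) (QsQ _ (det_hc1 dh)).
  by rewrite !hcM hQ -(rep_star ss) ?det_hc1 // hcK mulmxA.
by have := QF 1%:M; rewrite det1 (rep1 ss) mul1mx => /(_ erefl).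
Qed.

Lemma cyc_ext n (s : 'M[C]_3 -> 'M[C]_n) (w : 'cV[C]_n) Q m (M N : 'M_(m, n)) :
  cyc s w Q -> (forall g, \det g = 1 -> M *m (s g *m w) = N *m (s g *m w)) ->
  M *m Q = N *m Q.
Proof.
move=> cQ MN; apply/eqP; rewrite -subr_eq0 -mulmxBl; apply/eqP/(cyc_min cQ) => g dg.
by rewrite mulmxBl MN // subrr.
Qed.

Lemma cyc_orbit n (s : 'M[C]_3 -> 'M[C]_n) (w : 'cV[C]_n) Q g :
  cyc s w Q -> \det g = 1 -> Q *m (s g *m w) = s g *m w.
Proof. by move=> cQ dg; rewrite mulmxA (projC cQ) // -mulmxA (cyc_id cQ). Qed.

Lemma hc_ufixed n (s : 'M[C]_3 -> 'M[C]_n) (v : 'cV[C]_n) :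
  star_rep s -> ufixed s v -> forall x y z, hc v *m s (lower x y z) = hc v.
Proof.
move=> ss fv x y z; rewrite -[s _]hcK -(rep_star ss) ?det_lower // -hcM.
by rewrite /hc /lower tr_mx3 map_mx3 rmorph0 rmorph1 fv.
Qed.

Lemma gram_hwfun n (s : 'M[C]_3 -> 'M[C]_n) (w : 'cV[C]_n) l g :
  star_rep s -> hwv s w l -> \det g = 1 ->
  (hc w *m s g *m w) 0 0 = (hc w *m w) 0 0 * hwfun l g.
Proof.
move=> ss hw dg; apply: (coef_hwfun ss _ (hwv_fixed hw) (hwv_weight hw)) => //.
by apply: hc_ufixed => //; apply: hwv_fixed hw.
Qed.

Lemma star_dominant n (s : 'M[C]_3 -> 'M[C]_n) (v : 'cV[C]_n) e :
  star_rep s -> v != 0 -> ufixed s v -> wvec s v e ->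
  (e.1.2 <= e.1.1)%N && (e.2 <= e.1.2)%N.
Proof.
move=> ss v0 fv wv; apply: (weight_dominant ss _ fv wv).
  exact: hc_ufixed.
by rewrite sqnorm_eq0.
Qed.

Lemma star_hwv n (s : 'M[C]_3 -> 'M[C]_n) (v : 'cV[C]_n) e :
  star_rep s -> v != 0 -> ufixed s v -> wvec s v e ->
  hwv s v (e.1.1 - e.1.2, e.1.2 - e.2)%N.
Proof.
move=> ss v0 fv wv; have /andP[] := star_dominant ss v0 fv wv.
move: wv; case: e => [[p q] r] /= wv le_qp le_rq; split=> // a b c abc.
rewrite wv //; congr (_ *: _); rewrite /mono /= expr0 mulr1.
rewrite (_ : p - q + (q - r) = p - r)%N; last by lia.
rewrite -{1}(subnK (leq_trans le_rq le_qp)) -{1}(subnK le_rq) !exprD.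
rewrite [LHS](_ : _ = a ^+ (p - r) * b ^+ (q - r) * (a * b * c) ^+ r).
  by rewrite abc expr1n mulr1.
by rewrite !exprMn; ring.
Qed.

Lemma star_zero n (s : 'M[C]_3 -> 'M[C]_n) (w : 'cV[C]_n) l r (x : 'I_r -> sl3) c :
  star_rep s -> hwv s w l ->
  \sum_j c j *: (s (sval (x j)) *m w) = 0 <->
  forall h : sl3, \sum_j c j * hwfun l (sval h *m sval (x j)) = 0.
Proof.
move=> ss hw; have nw : (hc w *m w) 0 0 != 0 by rewrite sqnorm_eq0 (hwv_neq0 hw).
have coefE (h : sl3) : (hc w *m (s (sval h) *m \sum_j c j *: (s (sval (x j)) *m w))) 0 0 =
    (hc w *m w) 0 0 * \sum_j c j * hwfun l (sval h *m sval (x j)).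
  rewrite !mulmx_sumr summxE mulr_sumr; apply: eq_bigr => j _.
  rewrite -!scalemxAr mxE mulrCA; congr (_ * _).
  rewrite [s _ *m (s _ *m _)]mulmxA -(repM ss) ?(svalP h) ?(svalP (x j)) //.
  by rewrite mulmxA (gram_hwfun ss hw) // (svalP (sl3M h (x j))).
split=> [z h|z].
  by apply: (mulfI nw); rewrite -coefE z !mulmx0 mxE mulr0.
set v := \sum_j _ in coefE *; apply/eqP; rewrite -sqnorm_eq0; apply/eqP.
rewrite {1}/v hc_sum mulmx_suml summxE big1 // => j _.
rewrite hcZ -scalemxAl mxE.
rewrite hcM -(rep_star ss) ?(svalP (x j)) //.
rewrite -mulmxA.
have := coefE (exist _ _ (det_hc1 (svalP (x j)))).
by rewrite z mulr0 /= => ->; rewrite mulr0.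
Qed.

Lemma star_intertwiner n (s : 'M[C]_3 -> 'M[C]_n) w n' (s' : 'M[C]_3 -> 'M[C]_n') w' l :
  star_rep s -> hwv s w l -> star_rep s' -> hwv s' w' l ->
  exists J : 'M_(n', n), forall g, \det g = 1 -> J *m (s g *m w) = s' g *m w'.
Proof.
move=> ss hw ss' hw'.
have [|J JE] := @lin_ext C sl3 _ _ (fun g => s (sval g) *m w) (fun g => s' (sval g) *m w').
  by move=> r x c /(star_zero _ _ ss hw) z; apply/(star_zero _ _ ss' hw').
by exists J => g dg; apply: (JE (exist _ g dg)).
Qed.

(** The intertwiners in the two directions are inverse to each other on the images of [Q] and [Q'];
    cyclicity of the trace concludes. *)
Lemma cyc_trace n (s : 'M[C]_3 -> 'M[C]_n) w Q n' (s' : 'M[C]_3 -> 'M[C]_n') w' Q' l :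
  star_rep s -> hwv s w l -> cyc s w Q ->
  star_rep s' -> hwv s' w' l -> cyc s' w' Q' ->
  forall g, \det g = 1 -> \tr (Q *m s g) = \tr (Q' *m s' g).
Proof.
move=> ss hw cQ ss' hw' cQ' g dg.
have [J JE] := star_intertwiner ss hw ss' hw'.
have [J' JE'] := star_intertwiner ss' hw' ss hw.
have JJQ : J' *m Q' *m J *m Q = Q.
  rewrite -[RHS]mul1mx; apply: (cyc_ext cQ) => h dh.
  by rewrite -mulmxA JE // mul1mx -mulmxA cyc_orbit // JE'.
have JsQ : J *m s g *m Q = s' g *m J *m Q.
  apply: (cyc_ext cQ) => h dh; rewrite -!mulmxA JE //.
  by rewrite [s g *m _]mulmxA -(repM ss) // JE ?det_mul1 // mulmxA (repM ss').
have QJ : J *m Q *m J' *m Q' = Q'.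
  rewrite -[RHS]mul1mx; apply: (cyc_ext cQ') => h dh.
  by rewrite -!mulmxA JE' // mul1mx cyc_orbit // JE.
transitivity (\tr ((J' *m Q') *m (s' g *m (J *m Q)))).
  by rewrite -{1}JJQ -mulmxA (projC cQ) // -[_ *m J *m _]mulmxA [J *m _]mulmxA JsQ !mulmxA.
rewrite -mulmxA mxtrace_mulC.
transitivity (\tr ((Q' *m s' g) *m (J *m Q *m J'))); first by rewrite !mulmxA.
by rewrite mxtrace_mulC !mulmxA QJ.
Qed.

(** The coefficient <s(g) w, v> is <w, v> times [hwfun l g], so orthogonality to [w] spreads to the
    whole orbit. *)
Lemma cyc_ufixed0 n (s : 'M[C]_3 -> 'M[C]_n) w Q l v :
  star_rep s -> hwv s w l -> cyc s w Q -> ufixed s v -> Q *m v = v ->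
  (hc v *m w) 0 0 = 0 -> v = 0.
Proof.
move=> ss hw cQ fv Qv vw; suff : hc v = 0 by move/(congr1 (@hc C _ _)); rewrite hcK hc0.
rewrite -Qv hcM (projH cQ); apply: (cyc_min cQ) => g dg; rewrite mulmxA.
apply/matrixP => i j; rewrite !ord1 [RHS]mxE.
rewrite (coef_hwfun ss _ (hwv_fixed hw) (hwv_weight hw) erefl) ?vw ?mul0r //.
exact: hc_ufixed.
Qed.

(** One step of a filtration: [v] is [U]-fixed only modulo the image of [P0], but its component
    orthogonal to that image is genuinely [U]-fixed, hence zero or a highest weight vector. The
    fourth clause bounds [P1] by what the image of [P0] and the orbit of [v] generate. *)
Lemma proj_step n (s : 'M[C]_3 -> 'M[C]_n) P0 v e :
  star_rep s -> projr s P0 -> wvec s v e ->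
  (forall x y z, (1%:M - P0) *m (s (upper x y z) *m v - v) = 0) ->
  exists P1, [/\ projr s P1, P1 *m P0 = P0, P1 *m v = v,
    forall m (M : 'M_(m, n)), M *m P0 = 0 ->
      (forall g, \det g = 1 -> M *m (s g *m v) = 0) -> M *m P1 = 0
  & (1%:M - P0) *m v = 0 /\ P1 = P0 \/
    [/\ (e.1.2 <= e.1.1)%N, (e.2 <= e.1.2)%N & exists z Q,
      [/\ hwv s z (e.1.1 - e.1.2, e.1.2 - e.2)%N, cyc s z Q & P1 = P0 + Q]]].
Proof.
move=> ss pP0 wv fv; set z := (1%:M - P0) *m v.
have zC g : \det g = 1 -> s g *m z = (1%:M - P0) *m (s g *m v).
  by move=> dg; rewrite /z mulmxA mulmxBr mulmx1 -(projC pP0) // mulmxBl mulmxBl mul1mx mulmxA.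
have [z0|z0] := eqVneq z 0.
  exists P0; split=> //; first exact: (projI pP0).
    by apply/esym/eqP; rewrite -subr_eq0 -[X in X - _]mul1mx -mulmxBl; apply/eqP.
  by left.
have fz : ufixed s z.
  move=> a b c; rewrite zC ?det_upper //; apply/eqP.
  by rewrite -subr_eq0 /z -mulmxBr fv.
have wz : wvec s z e.
  by move=> a b c abc; rewrite zC ?det_diag3 // wv // -scalemxAr.
have [Q cQ] := cyc_exists z ss.
have P0z : P0 *m z = 0.
  by rewrite /z mulmxA mulmxBr mulmx1 (projI pP0) subrr mul0mx.
have PQ : P0 *m Q = 0.
  by apply: (cyc_min cQ) => g dg; rewrite mulmxA (projC pP0) // -mulmxA P0z mulmx0.
have QP : Q *m P0 = 0.
  by rewrite -[Q]hcK -[P0]hcK -hcM (projH pP0) (projH cQ) PQ hc0.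
exists (P0 + Q); split.
- exact: (projrD pP0 (cyc_proj cQ) PQ).
- by rewrite mulmxDl (projI pP0) QP addr0.
- have Qv : Q *m v = z.
    rewrite -[RHS](cyc_id cQ) /z [RHS]mulmxA mulmxBr mulmx1 QP subr0 //.
  by rewrite mulmxDl Qv /z mulmxBl mul1mx addrC subrK.
- move=> m M MP Mg; rewrite mulmxDr MP add0r; apply: (cyc_min cQ) => g dg.
  by rewrite zC // mulmxA mulmxBr MP subr0 mulmx1 Mg.
- have /andP[d1 d2] := star_dominant ss z0 fz wz.
  by right; split=> //; exists z, Q; split=> //; apply: star_hwv.
Qed.

End CyclicModules.

(** * Vectors fixed by the upper unitriangular group *)

Section ExtremalVectors.
Variable C : numClosedFieldType.

Lemma max_norm (r : seq C) : r != [::] ->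
  exists2 m, m \in r & forall z, z \in r -> `|z| <= `|m|.
Proof.
elim: r => // x r IH _; have [->|/IH[m mr mmax]] := eqVneq r [::].
  by exists x; rewrite ?mem_head // => z; rewrite inE => /eqP ->.
have [le_xm|lt_mx] := real_leP (normr_real x) (normr_real m).
  exists m; rewrite ?inE ?mr ?orbT // => z; rewrite inE => /predU1P[->//|].
  exact: mmax.
exists x; rewrite ?mem_head // => z; rewrite inE => /predU1P[->//|zr].
exact: le_trans (mmax z zr) (ltW lt_mx).
Qed.

Definition torus_elt (al : nat) : 'M[C]_3 :=
  diag3 (2 ^+ al.+1) 2 ((2 ^+ al.+2)^-1).

Lemma torus_elt_prod al : 2 ^+ al.+1 * 2 * (2 ^+ al.+2)^-1 = 1 :> C.
Proof. by rewrite -exprSr divff // expf_neq0 // pnatr_eq0. Qed.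

Lemma det_torus_elt al : \det (torus_elt al) = 1.
Proof. by rewrite det_diag3 torus_elt_prod. Qed.

(** Conjugation by [torus_elt al] multiplies the entries (0, 1), (0, 2), (1, 2) by 2 to the powers
    al, 2 al + 3, al + 3. With these exponents of [t], it amounts to doubling [t]. *)
Definition ucurve (al : nat) (x y z t : C) : 'M[C]_3 :=
  upper (x * t ^+ al) (y * t ^+ (al + al.+3)) (z * t ^+ al.+3).

Lemma torus_ucurve al x y z t :
  torus_elt al *m ucurve al x y z t = ucurve al x y z (2 * t) *m torus_elt al.
Proof.
rewrite /torus_elt /ucurve /upper /diag3 !mulmx3 !exprMn !exprD !exprS.
by congr mx3; field; rewrite ?mulf_neq0 ?expf_neq0 ?pnatr_eq0.
Qed.

Variables (n : nat) (s : 'M[C]_3 -> 'M[C]_n) (ss : polyrep s).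

(* The coefficient of t^k in s (ucurve t) v is an eigenvector of s (torus_elt)
   for the eigenvalue 2^k mu. *)
Lemma extremal_ufixed (P : 'M[C]_n) (al : nat) (v : 'cV[C]_n) (mu : C) :
  (0 < al)%N ->
  (forall g, \det g = 1 -> P *m s g = s g *m P) -> P *m v = v ->
  s (torus_elt al) *m v = mu *: v ->
  (forall k (u : 'cV_n), (0 < k)%N -> P *m u = u ->
     s (torus_elt al) *m u = (2 ^+ k * mu) *: u -> u = 0) ->
  ufixed s v.
Proof.
move=> al0 PC Pv Dv ext x y z; set D := s (torus_elt al) in Dv ext.
pose G : 'M[{poly C}]_3 :=
  upper (x%:P * 'X^al) (y%:P * 'X^(al + al.+3)) (z%:P * 'X^(al.+3)).
have GE t : map_mx (horner_eval t) G = ucurve al x y z t.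
  rewrite /G /ucurve; move: (al.+3) => b.
  by rewrite /upper map_mx3 /= /horner_eval !(hornerM, hornerC, hornerXn).
have dc t : \det (ucurve al x y z t) = 1 by apply: det_upper.
have pv i : pcurve (fun g => (s g *m v) i 0).
  apply: (@pcurve_ext _ (fun g => \sum_j s g i j * v j 0)).
    by move=> g _; rewrite mxE.
  by apply: pcurve_sum => j; apply: pcurveM; [apply: (rep_pcurve ss)|apply: pcurve_cst].
have /choice[q qE] i := pv i G.
have {}qE i t : (s (ucurve al x y z t) *m v) i 0 = (q i).[t] by rewrite -GE qE // GE.
pose V k : 'cV[C]_n := \col_i (q i)`_k.
have lin (M : 'M_n) k i : (M *m V k) i 0 = (\sum_j (M i j)%:P * q j)`_k.
  by rewrite mxE coef_sum; apply: eq_bigr => j _; rewrite mxE coefCM.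
have linh (M : 'M_n) t i :
    (\sum_j (M i j)%:P * q j).[t] = (M *m (s (ucurve al x y z t) *m v)) i 0.
  by rewrite mxE horner_sum; apply: eq_bigr => j _; rewrite hornerM hornerC qE.
have PV k : P *m V k = V k.
  apply/colP => i; rewrite lin mxE.
  suff -> : \sum_j (P i j)%:P * q j = q i by [].
  apply/eqP; rewrite -subr_eq0; apply/eqP/horner0_eq0 => t; rewrite hornerD hornerN linh -qE.
  by rewrite mulmxA PC // -mulmxA Pv subrr.
have DV k : D *m V k = (2 ^+ k * mu) *: V k.
  apply/colP => i; rewrite lin !mxE.
  pose q' := \poly_(j < size (q i)) (2 ^+ j * mu * (q i)`_j).
  have -> : \sum_j (D i j)%:P * q j = q'.
    apply/eqP; rewrite -subr_eq0; apply/eqP/horner0_eq0 => t.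
    rewrite hornerD hornerN linh horner_poly.
    have -> : D *m (s (ucurve al x y z t) *m v) = mu *: (s (ucurve al x y z (2 * t)) *m v).
      rewrite mulmxA -(repM ss) ?det_torus_elt // torus_ucurve.
      by rewrite (repM ss) ?det_torus_elt // -mulmxA Dv -scalemxAr.
    rewrite mxE qE horner_coef mulr_sumr -sumrB big1 // => j _.
    by rewrite exprMn; ring.
  rewrite coef_poly; case: ltnP => // le_sz; by rewrite nth_default ?mulr0.
(* Extremality kills all nonconstant coefficients, so the curve s(ucurve t) v is constant. At t = 1
   it passes through the given matrix, and at t = 0 through the identity, as [al] is positive. *)
have V0 k : (0 < k)%N -> V k = 0 by move=> k0; apply: (ext k).
have qC i : q i = ((q i)`_0)%:P.
  apply/polyP => -[|k]; first by rewrite coefC.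
  by rewrite coefC /=; have /colP/(_ i) := V0 k.+1 isT; rewrite !mxE.
have c1 : ucurve al x y z 1 = upper x y z by rewrite /ucurve !expr1n !mulr1.
have c0 : ucurve al x y z 0 = 1%:M.
  rewrite /ucurve mx3_1 /upper /diag3 !expr0n !mulr0 addnS /=.
  by rewrite eqn0Ngt al0 !mulr0.
apply/colP => i; rewrite -c1 qE qC hornerC.
have := qE i 0; rewrite qC hornerC => <-.
by rewrite coefC c0 (rep1 ss) mul1mx.
Qed.

(** An eigenvalue mu of maximal modulus is extremal: it is nonzero as the torus element is
    invertible, so 2^k mu is strictly larger. Stated for [polyrep], this also serves an arbitrary
    irreducible representation. *)
Lemma exists_ufixed : (0 < n)%N -> exists v, v != 0 /\ ufixed s v.
Proof.
move=> n0; set D := s (torus_elt 1).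
have Dinv : exists E, E *m D = 1%:M.
  exists (s (diag3 ((2 ^+ 2)^-1) 2^-1 (2 ^+ 3))).
  have n2 : 2 != 0 :> C by rewrite pnatr_eq0.
  rewrite -(repM ss) ?det_torus_elt //; last by rewrite det_diag3; field; rewrite ?n2.
  rewrite /torus_elt /diag3 mulmx3 -(rep1 ss) mx3_1; congr s.
  by congr mx3; field; rewrite ?n2.
pose p := char_poly D^T.
have szp : size p = n.+1 by apply: size_char_poly.
have [r pE] := closed_field_poly_normal p.
have lp : lead_coef p = 1 by apply/eqP; apply: char_poly_monic.
have rP m : (m \in r) = eigenvalue D^T m.
  by rewrite eigenvalue_root_char -/p pE lp scale1r root_prod_XsubC.
have rn : r != [::].
  apply/eqP => r0; move: szp; rewrite pE r0 big_nil lp scale1r size_poly1.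
  by case => n00; rewrite -n00 in n0.
have [m mr mmax] := max_norm rn.
have eigP mu (u : 'cV_n) : u != 0 -> D *m u = mu *: u -> mu \in r.
  move=> u0 Du; rewrite rP; apply/eigenvalueP; exists u^T; last by rewrite trmx_eq0.
  by rewrite -trmx_mul Du linearZ.
have [u uD u0] : exists2 u : 'rV_n, u *m D^T = m *: u & u != 0.
  by move: mr; rewrite rP => /eigenvalueP.
have Dv : D *m u^T = m *: u^T by rewrite -[D]trmxK -trmx_mul uD linearZ.
have v0 : u^T != 0 by rewrite trmx_eq0.
have m0 : m != 0.
  apply/eqP => m0; have [E ED] := Dinv.
  by case/eqP: v0; rewrite -[u^T]mul1mx -ED -mulmxA Dv m0 scale0r mulmx0.
exists u^T; split=> //; apply: (@extremal_ufixed 1%:M 1 _ m) => //.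
- by move=> g _; rewrite mul1mx mulmx1.
- by rewrite mul1mx.
move=> k w k0 _ Dw; apply/eqP; apply/negPn/negP => w0.
have := mmax _ (eigP _ _ w0 Dw); rewrite normrM ger_pMl ?normr_gt0 //.
rewrite normrX ger0_norm ?ler0n // real_leNgt ?rpredX ?realn // ?real1 //.
by rewrite exprn_egt1 ?ltr1n // -lt0n k0.
Qed.

End ExtremalVectors.

Section HighestWeights.
Variables (C : numClosedFieldType) (n : nat) (s : 'M[C]_3 -> 'M[C]_n).
Hypothesis ss : star_rep s.

(* For al large, torus_elt al separates the weights, so an extremal eigenvector
   of it is a weight vector. *)
Lemma exists_hwv (P : 'M[C]_n) : projr s P -> P != 0 ->
  exists v l, P *m v = v /\ hwv s v l.
Proof.
move=> pP P0; have [e eE] := rep_diag ss.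
(* Equality of two eigenvalues compares (al + 1)(p + t') + (q + t') with its counterpart. Remainders
   below al + 1 force both digits to agree, so the weights differ by a multiple of (1, 1, 1). *)
pose al := (2 * \max_i ((e i).1.2 + (e i).2)).+1.
have alM i : (2 * ((e i).1.2 + (e i).2) < al)%N.
  by rewrite /al ltnS leq_mul2l (leq_bigmax_cond (F := fun i => ((e i).1.2 + (e i).2)%N)).
pose d i : C := mono (e i) (2 ^+ al.+1) 2 ((2 ^+ al.+2)^-1).
have DE : s (torus_elt C al) = diag_mx (\row_i d i) by rewrite eE ?torus_elt_prod.
(* The columns of [P] are eigenvectors, since [P] commutes with the diagonal torus element; only
   eigenvalues of nonzero columns compete for the maximum. *)
pose r := [seq d i | i <- enum 'I_n & col i P != 0].
have n2 : 2 != 0 :> C by rewrite pnatr_eq0.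
have rn : r != [::].
  apply: contraNneq P0 => r0; apply/eqP/matrixP => i j; rewrite mxE.
  have [cj|cj] := eqVneq (col j P) 0; first by have /colP/(_ i) := cj; rewrite !mxE.
  suff : d j \in r by rewrite r0.
  by apply: map_f; rewrite mem_filter cj mem_enum.
have [m mr mmax] := max_norm rn.
have [i ci mE] : exists2 i, col i P != 0 & m = d i.
  by case/mapP: mr => i; rewrite mem_filter => /andP[ci _] ->; exists i.
have d0 j : d j != 0.
  by rewrite /d /mono !mulf_neq0 ?expf_neq0 ?invr_eq0 ?expf_neq0.
have Pd j k : P j k != 0 -> d j = d k.
  have := congr1 (fun M : 'M_n => M j k) (projC pP (det_torus_elt C al)).
  rewrite DE mul_diag_mx mul_mx_diag !mxE mulrC => /eqP.
  rewrite -subr_eq0 -mulrBl mulf_eq0 subr_eq0 => /orP[/eqP-> //|/eqP->].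
  by rewrite eqxx.
have sep j k : d j = d k -> forall a b c, a * b * c = 1 ->
    mono (e j) a b c = mono (e k) a b c.
  have := alM j; have := alM k; rewrite /d /mono.
  case: (e j) (e k) => [[p q] t] [[p' q'] t'] /= Hk Hj djk a b c abc.
  have E2 : 2 ^+ (al.+1 * p + q + al.+2 * t') = 2 ^+ (al.+1 * p' + q' + al.+2 * t) :> C.
    move: djk; move: (al.+1) (al.+2) => A B.
    have B0 : (2 ^+ B : C) != 0 by rewrite expf_neq0.
    move/eqP; rewrite !exprVn eqr_div ?(expf_neq0 _ B0) // => /eqP.
    by rewrite !exprD !exprM.
  have {}E2 : (al.+1 * p + q + al.+2 * t' = al.+1 * p' + q' + al.+2 * t)%N.
    apply/eqP; move/eqP: E2; rewrite -!natrX eqr_nat eqn_exp2l //.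
  have [e1 e3] : (p + t' = p' + t)%N /\ (q + t' = q' + t)%N.
    have E3 : ((p + t') * al.+1 + (q + t') = (p' + t) * al.+1 + (q' + t))%N by lia.
    have := congr1 (divn ^~ al.+1) E3; have := congr1 (modn ^~ al.+1) E3.
    rewrite !modnMDl !divnMDl // !modn_small; try lia.
    by rewrite !divn_small ?addn0; lia.
  rewrite -[LHS]mulr1 -[RHS]mulr1 -[in LHS](expr1n _ t') -[in RHS](expr1n _ t) -abc.
  rewrite !exprMn [LHS](_ : _ = a ^+ (p + t') * b ^+ (q + t') * c ^+ (t + t')).
    by rewrite e1 e3 [(t + t')%N]addnC !exprD; ring.
  by rewrite !exprD; ring.
pose v := col i P.
have Pv : P *m v = v by rewrite /v colE mulmxA (projI pP).
have vj j : v j 0 != 0 -> d j = d i by rewrite mxE; apply: Pd.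
have Dv : s (torus_elt C al) *m v = m *: v.
  apply/colP => j; rewrite DE mul_diag_mx mE !mxE.
  by have [->|Pji] := eqVneq (P j i) 0; rewrite ?mulr0 // (Pd j i).
have fv : ufixed s v.
  apply: (extremal_ufixed ss _ (projC pP) Pv Dv) => // k u k0 Pu Du.
  apply/eqP; apply/negPn/negP => u0.
  have uj j : u j 0 != 0 -> d j = 2 ^+ k * m.
    move=> uj0; have /colP/(_ j) := Du; rewrite DE mul_diag_mx !mxE.
    by move/(mulIf uj0).
  have [j uj0 cj] : exists2 j, u j 0 != 0 & col j P != 0.
    apply/exists2P; apply: contrapT => /forallNP nj; case/eqP: u0; rewrite -Pu.
    apply/colP => h; rewrite !mxE big1 // => j _.
    have [->|uj0] := eqVneq (u j 0) 0; first by rewrite mulr0.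
    have [cj|cj] := eqVneq (col j P) 0; last by case: (nj j).
    by have /colP/(_ h) := cj; rewrite !mxE => ->; rewrite mul0r.
  have dr : d j \in r by apply: map_f; rewrite mem_filter cj mem_enum.
  have := mmax _ dr; rewrite uj // normrM ger_pMl ?normr_gt0 ?mE //.
  rewrite normrX ger0_norm ?ler0n // real_leNgt ?rpredX ?realn // ?real1 //.
  by rewrite exprn_egt1 ?ltr1n // -lt0n k0.
have wv : wvec s v (e i).
  move=> a b c abc; apply/colP => j; rewrite eE // mul_diag_mx !mxE.
  by have [->|Pji] := eqVneq (P j i) 0; rewrite ?mulr0 // (sep _ j i (Pd _ _ Pji)).
by exists v, ((e i).1.1 - (e i).1.2, (e i).1.2 - (e i).2)%N; split=> //; apply: star_hwv.
Qed.

End HighestWeights.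

(** * Tensor products and the Pieri rule *)

Lemma sum_mxtens (V : nmodType) m n (F : 'I_(m * n) -> V) :
  \sum_k F k = \sum_i \sum_j F (mxtens_index (i, j)).
Proof.
rewrite pair_bigA (reindex (@mxtens_index m n)) /=; last first.
  by exists (@mxtens_unindex m n) => ij _; rewrite ?mxtens_indexK ?mxtens_unindexK.
by apply: eq_bigr => -[].
Qed.

Section BinaryTensor.
Variable C : numClosedFieldType.

Definition tv m n (u : 'cV[C]_m) (w : 'cV[C]_n) : 'cV[C]_(m * n) := u *t w.

Lemma tvE m n (u : 'cV[C]_m) (w : 'cV[C]_n) i j k :
  tv u w (mxtens_index (i, j)) k = u i 0 * w j 0.
Proof. by rewrite /tv mxE mxtens_indexK /= !ord1. Qed.

Lemma tvP m n (u v : 'cV[C]_(m * n)) :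
  (forall i j, u (mxtens_index (i, j)) 0 = v (mxtens_index (i, j)) 0) -> u = v.
Proof. by move=> uv; apply/colP => k; case: (mxtens_indexP k) => i j; apply: uv. Qed.

Lemma tvDl m n (u u' : 'cV[C]_m) (w : 'cV[C]_n) : tv (u + u') w = tv u w + tv u' w.
Proof. by apply: tvP => i j; rewrite [RHS]mxE !tvE mxE mulrDl. Qed.

Lemma tvZl m n a (u : 'cV[C]_m) (w : 'cV[C]_n) : tv (a *: u) w = a *: tv u w.
Proof. by apply: tvP => i j; rewrite [RHS]mxE !tvE mxE mulrA. Qed.

Lemma tvZr m n a (u : 'cV[C]_m) (w : 'cV[C]_n) : tv u (a *: w) = a *: tv u w.
Proof. by apply: tvP => i j; rewrite [RHS]mxE !tvE mxE mulrCA. Qed.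

Lemma tv_neq0 m n (u : 'cV[C]_m) (w : 'cV[C]_n) : u != 0 -> w != 0 -> tv u w != 0.
Proof.
move=> /matrix0Pn[i [k ui]] /matrix0Pn[j [l wj]]; apply/matrix0Pn.
rewrite ord1 in ui; rewrite ord1 in wj.
by exists (mxtens_index (i, j)), 0; rewrite tvE mulf_neq0.
Qed.

Lemma tens_tv m n p q (A : 'M_(m, n)) (B : 'M_(p, q)) (u : 'cV[C]_n) (w : 'cV[C]_q) :
  (A *t B) *m tv u w = tv (A *m u) (B *m w).
Proof. exact: (tensmx_mul A B u w). Qed.

Lemma hc_tens m n p q (A : 'M[C]_(m, n)) (B : 'M[C]_(p, q)) :
  hc (A *t B) = hc A *t hc B.
Proof. by rewrite /hc trmx_tens map_mxT. Qed.

Lemma tens11 m n : (1%:M : 'M[C]_m) *t (1%:M : 'M[C]_n) = 1%:M.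
Proof.
apply/matrixP => k l; case: (mxtens_indexP k) => i j; case: (mxtens_indexP l) => i' j'.
rewrite tensmxE !mxE (can_eq (@mxtens_indexK _ _)) xpair_eqE.
by case: (i == i'); case: (j == j'); rewrite ?mulr1n ?mulr0n ?mul1r ?mul0r.
Qed.

Lemma trace_tens m n (A : 'M[C]_m) (B : 'M[C]_n) : \tr (A *t B) = \tr A * \tr B.
Proof.
rewrite /mxtrace mulr_suml; under [RHS]eq_bigr do rewrite mulr_sumr.
rewrite sum_mxtens; apply: eq_bigr => i _; apply: eq_bigr => j _.
by rewrite tensmxE.
Qed.

Definition tensrep m n (s1 : 'M[C]_3 -> 'M[C]_m) (s2 : 'M[C]_3 -> 'M[C]_n) g :=
  s1 g *t s2 g.

Lemma mono_add e f a b c : mono e a b c * mono f a b c =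
  mono (e.1.1 + f.1.1, e.1.2 + f.1.2, e.2 + f.2)%N a b c :> C.
Proof. by rewrite /mono /= !exprD; ring. Qed.

Lemma tens_star m n (s1 : 'M[C]_3 -> 'M[C]_m) (s2 : 'M[C]_3 -> 'M[C]_n) :
  star_rep s1 -> star_rep s2 -> star_rep (tensrep s1 s2).
Proof.
move=> h1 h2; split; first split.
- by rewrite /tensrep (rep1 h1) (rep1 h2) tens11.
- by move=> g h dg dh; rewrite /tensrep (repM h1) // (repM h2) // tensmx_mul.
- move=> k l; case: (mxtens_indexP k) => i j; case: (mxtens_indexP l) => i' j'.
  apply: (@pcurve_ext _ (fun g => s1 g i i' * s2 g j j')).
    by move=> g _; rewrite tensmxE.
  by apply: pcurveM; [apply: (rep_pcurve h1) | apply: (rep_pcurve h2)].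
- by move=> g dg; rewrite /tensrep (rep_star h1) // (rep_star h2) // hc_tens.
have [e1 E1] := rep_diag h1; have [e2 E2] := rep_diag h2.
exists (fun k => let: (i, j) := mxtens_unindex k in
  ((e1 i).1.1 + (e2 j).1.1, (e1 i).1.2 + (e2 j).1.2, (e1 i).2 + (e2 j).2)%N).
move=> a b c abc; rewrite /tensrep E1 // E2 //; apply/matrixP => k l.
case: (mxtens_indexP k) => i j; case: (mxtens_indexP l) => i' j'.
rewrite tensmxE !mxE mxtens_indexK (can_eq (@mxtens_indexK _ _)) xpair_eqE.
by case: (i == i'); case: (j == j'); rewrite ?mulr0n ?mulr1n ?mul0r ?mulr0 // mono_add.
Qed.

Lemma wvec_tens m n (s1 : 'M[C]_3 -> 'M[C]_m) (s2 : 'M[C]_3 -> 'M[C]_n) u w e f :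
  wvec s1 u e -> wvec s2 w f ->
  wvec (tensrep s1 s2) (tv u w) (e.1.1 + f.1.1, e.1.2 + f.1.2, e.2 + f.2)%N.
Proof.
move=> h1 h2 a b c abc; rewrite tens_tv h1 // h2 // tvZl tvZr scalerA.
by rewrite mono_add.
Qed.

Definition tslice m n p (M : 'M[C]_(p, m * n)) (i : 'I_m) : 'M[C]_(p, n) :=
  \matrix_(r, j) M r (mxtens_index (i, j)).

Lemma tslice_tv m n p (M : 'M[C]_(p, m * n)) i (y : 'cV[C]_n) :
  M *m tv (delta_mx i 0) y = tslice M i *m y.
Proof.
apply/colP => r; rewrite !mxE sum_mxtens.
rewrite (bigD1 i) //= [X in _ + X]big1 ?addr0 => [|i' ne]; last first.
  by rewrite big1 // => j _; rewrite tvE mxE (negPf ne) mul0r mulr0.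
by apply: eq_bigr => j _; rewrite tvE !mxE !eqxx mul1r.
Qed.

(** A matrix on the tensor product splits into slices, one per basis vector of the first factor, and
    [cyc_min] applies to each. *)
Lemma tens1_eq0 m n p (s : 'M[C]_3 -> 'M[C]_n) w Q (M : 'M[C]_(p, m * n)) :
  cyc s w Q ->
  (forall i g, \det g = 1 -> M *m tv (delta_mx i 0) (s g *m w) = 0) ->
  M *m ((1%:M : 'M_m) *t Q) = 0.
Proof.
move=> cQ M0.
have sQ i : tslice M i *m Q = 0.
  by apply: (cyc_min cQ) => g dg; rewrite -tslice_tv M0.
apply/matrixP => r k; case: (mxtens_indexP k) => i j.
rewrite [LHS]mxE [RHS]mxE sum_mxtens.
rewrite (bigD1 i) //= [X in _ + X]big1 ?addr0 => [|i' ne]; last first.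
  by rewrite big1 // => j' _; rewrite tensmxE mxE (negPf ne) mul0r mulr0.
transitivity ((tslice M i *m Q) r j); last by rewrite sQ mxE.
rewrite [RHS]mxE; apply: eq_bigr => j' _.
by rewrite tensmxE !mxE eqxx mul1r.
Qed.

End BinaryTensor.

(** * The representations V and V^* *)

Section BasicRepresentations.
Variable C : numClosedFieldType.

(* The cofactor matrix in the reversed dual basis, so that upper unitriangular
   matrices are mapped to upper unitriangular matrices. *)
Definition dual3 (g : 'M[C]_3) : 'M[C]_3 := let m := fun i j => g i j in
  mx3 (m o0 o0 * m o1 o1 - m o0 o1 * m o1 o0)
      (m o0 o2 * m o1 o0 - m o0 o0 * m o1 o2)
      (m o0 o1 * m o1 o2 - m o0 o2 * m o1 o1)
      (m o0 o1 * m o2 o0 - m o0 o0 * m o2 o1)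
      (m o0 o0 * m o2 o2 - m o0 o2 * m o2 o0)
      (m o0 o2 * m o2 o1 - m o0 o1 * m o2 o2)
      (m o1 o0 * m o2 o1 - m o1 o1 * m o2 o0)
      (m o1 o2 * m o2 o0 - m o1 o0 * m o2 o2)
      (m o1 o1 * m o2 o2 - m o1 o2 * m o2 o1).

Lemma dual3_mx3 (a b c d e f g h i : C) : dual3 (mx3 a b c d e f g h i) =
  mx3 (a * e - b * d) (c * d - a * f) (b * f - c * e)
      (b * g - a * h) (a * i - c * g) (c * h - b * i)
      (d * h - e * g) (f * g - d * i) (e * i - f * h).
Proof. by rewrite /dual3 !mxE. Qed.

Lemma dual3M (g h : 'M[C]_3) : dual3 (g *m h) = dual3 g *m dual3 h.
Proof.
rewrite [g]mx3_eta [h]mx3_eta mulmx3 !dual3_mx3 mulmx3.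
by congr mx3; ring.
Qed.

Lemma dual3_1 : dual3 1%:M = 1%:M.
Proof. by rewrite mx3_1 /diag3 dual3_mx3; congr mx3; ring. Qed.

Lemma dual3_upper x y z : dual3 (upper x y z) = upper (- z) (x * z - y) (- x).
Proof. by rewrite /upper dual3_mx3; congr mx3; ring. Qed.

Lemma dual3_diag3 a b c : dual3 (diag3 a b c) = diag3 (a * b) (a * c) (b * c).
Proof. by rewrite /diag3 dual3_mx3; congr mx3; ring. Qed.

Lemma diag3_row (a b c : C) :
  diag3 a b c = diag_mx (\row_i tnth [tuple a; b; c] i).
Proof. by rewrite diag_mx3 !mxE. Qed.

(** What V and V^* have in common, so that the Pieri filtration is built once; [e] lists the weights
    from the highest down. *)
Record elementary (t : 'M[C]_3 -> 'M[C]_3) (e : 3.-tuple (nat * nat * nat)) : Prop :=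
  Elementary {
  elem_star :> star_rep t;
  elem_upper : forall x y z, exists x' y' z', t (upper x y z) = upper x' y' z';
  elem_diag : forall a b c,
    t (diag3 a b c) = diag_mx (\row_i mono (tnth e i) a b c) }.

Lemma std_elementary : elementary id [tuple (1, 0, 0); (0, 1, 0); (0, 0, 1)]%N.
Proof.
have dE a b c : diag3 a b c = diag_mx (\row_i mono
    (tnth [tuple (1, 0, 0); (0, 1, 0); (0, 0, 1)]%N i) a b c).
  by rewrite diag_mx3 !mxE /mono /= !expr0 !expr1 !mulr1 !mul1r.
split; [|by move=> x y z; exists x, y, z|exact: dE].
split=> //; first by split=> // i j; exact: (@pcurve_entry C i j).
by exists (tnth [tuple (1, 0, 0); (0, 1, 0); (0, 0, 1)]%N) => a b c _; exact: dE.
Qed.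

Lemma dual3_elementary : elementary dual3 [tuple (1, 1, 0); (1, 0, 1); (0, 1, 1)]%N.
Proof.
have dE a b c : dual3 (diag3 a b c) = diag_mx (\row_i mono
    (tnth [tuple (1, 1, 0); (1, 0, 1); (0, 1, 1)]%N i) a b c).
  rewrite diag_mx3 !mxE /mono /= dual3_diag3.
  by rewrite !expr0 !expr1 !mulr1 !mul1r.
split; [|by move=> x y z; do 3!eexists; apply: dual3_upper|exact: dE].
split; first split.
- exact: dual3_1.
- by move=> g h _ _; apply: dual3M.
- by elim/ord3P; elim/ord3P; (apply: pcurve_ext; [by move=> g _; rewrite mxE /=; reflexivity
    | by apply: pcurveB; apply: pcurveM; apply: pcurve_entry]).
- move=> g _; rewrite [g]mx3_eta /hc tr_mx3 map_mx3 !dual3_mx3 tr_mx3 map_mx3.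
  by rewrite !rmorphB !rmorphM; congr mx3; ring.
by exists (tnth [tuple (1, 1, 0); (1, 0, 1); (0, 1, 1)]%N) => a b c _; exact: dE.
Qed.

End BasicRepresentations.

(** * The Pieri rule *)

Section Pieri.
Variable C : numClosedFieldType.

Local Notation E := (fun i : 'I_3 => delta_mx i 0 : 'cV[C]_3).

Section PieriRule.
Variables (t : 'M[C]_3 -> 'M[C]_3) (e : 3.-tuple (nat * nat * nat)).
Hypothesis et : elementary t e.

Lemma elem_fixed x y z : t (upper x y z) *m E o0 = E o0.
Proof.
have [x' [y' [z' ->]]] := elem_upper et x y z.
by apply/colP; elim/ord3P; rewrite mxE sum3 !mxE /= ; ring.
Qed.

Lemma elem_upper1 x y z : exists a, t (upper x y z) *m E o1 = E o1 + a *: E o0.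
Proof.
have [x' [y' [z' ->]]] := elem_upper et x y z; exists x'.
by apply/colP; elim/ord3P; rewrite mxE sum3 !mxE /= ; ring.
Qed.

Lemma elem_upper2 x y z : exists a b,
  t (upper x y z) *m E o2 = E o2 + (a *: E o0 + b *: E o1).
Proof.
have [x' [y' [z' ->]]] := elem_upper et x y z; exists y', z'.
by apply/colP; elim/ord3P; rewrite mxE sum3 !mxE /= ; ring.
Qed.

Lemma elem_wvec i : wvec t (E i) (tnth e i).
Proof.
move=> a b c _; rewrite (elem_diag et) mul_diag_mx; apply/colP => j; rewrite !mxE.
by have [->|] := eqVneq j i; rewrite ?mulr0.
Qed.

Variables (n : nat) (s : 'M[C]_3 -> 'M[C]_n) (w : 'cV[C]_n) (Q : 'M[C]_n) (l : nat * nat).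
Hypotheses (ss : star_rep s) (hw : hwv s w l) (cQ : cyc s w Q).

Local Notation S := (tensrep t s).
Local Notation v i := (tv (E i) w).

(** Certifies that [v i] lies outside the module generated by the earlier ones. A witness matrix is
    used because it can be carried from one model to another. *)
Definition separated (i : 'I_3) : Prop := exists m (M : 'M[C]_(m, 3 * n)),
  (forall (j : 'I_3) g, (j < i)%N -> \det g = 1 -> M *m (S g *m v j) = 0) /\
  M *m v i != 0.

Definition pieri_weight (i : 'I_3) : nat * nat * nat :=
  ((tnth e i).1.1 + (l.1 + l.2), (tnth e i).1.2 + l.2, (tnth e i).2)%N.

(** Leaves open whether a dominant candidate occurs; an explicit separation settles this
    afterwards. *)
Definition pieri_summand (i : 'I_3) (Qi : 'M[C]_(3 * n)) : Prop :=
  let p := pieri_weight i in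
  (~ separated i /\ Qi = 0) \/
  [/\ (p.1.2 <= p.1.1)%N, (p.2 <= p.1.2)%N & exists z,
     hwv S z (p.1.1 - p.1.2, p.1.2 - p.2)%N /\ cyc S z Qi].

(** The vectors e_i tensor w are [U]-fixed modulo the earlier ones, so three applications of
    [proj_step] filter the module that they generate, which turns out to be everything. *)
Lemma pieri : exists Q0 Q1 Q2,
  [/\ (1%:M : 'M_3) *t Q = Q0 + Q1 + Q2, pieri_summand o0 Q0,
      pieri_summand o1 Q1 & pieri_summand o2 Q2].
Proof.
have sS : star_rep S by apply: tens_star => //; apply: elem_star et.
have wv i : wvec S (v i) (pieri_weight i).
  by have := wvec_tens (elem_wvec i) (hwv_weight hw); rewrite /= addn0.
have Sv g u y : S g *m tv u y = tv (t g *m u) (s g *m y) by apply: tens_tv.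
have step (P0 : 'M_(3 * n)) (i : 'I_3) : projr S P0 ->
    (forall (j : 'I_3), (j < i)%N -> P0 *m v j = v j) ->
    (forall m (M : 'M_(m, 3 * n)),
      (forall (j : 'I_3) g, (j < i)%N -> \det g = 1 -> M *m (S g *m v j) = 0) -> M *m P0 = 0) ->
    (forall x y z, (1%:M - P0) *m (S (upper x y z) *m v i - v i) = 0) ->
    exists P1 Qi, [/\ P1 = P0 + Qi, projr S P1,
      forall (j : 'I_3), (j < i.+1)%N -> P1 *m v j = v j,
      forall m (M : 'M_(m, 3 * n)),
        (forall (j : 'I_3) g, (j < i.+1)%N -> \det g = 1 -> M *m (S g *m v j) = 0) -> M *m P1 = 0
    & pieri_summand i Qi].
  move=> pP0 P0v P0m P0u.
  have [P1 [pP1 P10 P1v P1m alt]] := proj_step sS pP0 (wv i) P0u.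
  have P1v' (j : 'I_3) : (j < i.+1)%N -> P1 *m v j = v j.
    rewrite ltnS leq_eqVlt => /predU1P[/val_inj -> //|ji].
    by rewrite -{1}(P0v j ji) mulmxA P10 P0v.
  have P1m' m (M : 'M_(m, 3 * n)) :
      (forall (j : 'I_3) g, (j < i.+1)%N -> \det g = 1 -> M *m (S g *m v j) = 0) ->
      M *m P1 = 0.
    move=> Mv; apply: P1m => [|g dg]; last exact: Mv.
    by apply: P0m => j g ji; apply: Mv; apply: ltnW.
  case: alt => [[z0 P1E]|[d1 d2 [z [Qi [hz cz P1E]]]]].
    exists P1, 0; split=> //; first by rewrite addr0.
    left; split=> // -[m [M [Mv]]] /negP[]; apply/eqP.
    have MP0 : M *m P0 = 0 by apply: P0m.
    transitivity (M *m ((1%:M - P0) *m v i)); last by rewrite z0 mulmx0.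
    by rewrite mulmxA mulmxBr MP0 subr0 mulmx1.
  by exists P1, Qi; split=> //; right; split=> //; exists z.
have vanish (P : 'M_(3 * n)) (u : 'cV_(3 * n)) : P *m u = u -> (1%:M - P) *m u = 0.
  by move=> Pu; rewrite mulmxBl mul1mx Pu subrr.
have [//|m M _|x y z|P1 [Q0 [E1 pP1 P1v P1m ps0]]] := step 0 o0 (projr0 _).
- by rewrite mulmx0.
- by rewrite Sv elem_fixed (hwv_fixed hw) subrr mulmx0.
have [x y z|P2 [Q1 [E2 pP2 P2v P2m ps1]]] := step P1 o1 pP1 P1v P1m.
  rewrite Sv (hwv_fixed hw); have [a ->] := elem_upper1 x y z.
  by rewrite tvDl tvZl addrAC subrr add0r -scalemxAr vanish ?scaler0 // P1v.
have [x y z|P3 [Q2 [E3 pP3 P3v P3m ps2]]] := step P2 o2 pP2 P2v P2m.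
  rewrite Sv (hwv_fixed hw); have [a [b ->]] := elem_upper2 x y z.
  rewrite tvDl addrAC subrr add0r tvDl !tvZl mulmxDr -!scalemxAr.
  by rewrite !vanish ?scaler0 ?addr0 // P2v.
exists Q0, Q1, Q2; split=> //; rewrite add0r in E1.
rewrite -E1 -E2 -E3.
have pQ : projr S ((1%:M : 'M_3) *t Q).
  split; first by rewrite hc_tens hc1 (projH cQ).
    by rewrite tensmx_mul mul1mx (projI cQ).
  by move=> g dg; rewrite /tensrep !tensmx_mul mul1mx mulmx1 (projC cQ).
have k1 : (1%:M - (1%:M : 'M_3) *t Q) *m P3 = 0.
  apply: P3m => j g _ dg; rewrite Sv; apply: vanish.
  by rewrite tens_tv mul1mx cyc_orbit.
(* Generation: e_i tensor s(g) w is g applied to (t(g^{-1}) e_i) tensor w, which is a combination of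
   the vectors [v j]. *)
have k2 : (1%:M - P3) *m ((1%:M : 'M_3) *t Q) = 0.
  apply: (tens1_eq0 cQ) => i g dg.
  have ug : g \in unitmx by rewrite unitmxE dg unitr1.
  have dV : \det (invmx g) = 1 by rewrite det_inv dg invr1.
  have -> : E i = t g *m (t (invmx g) *m E i).
    rewrite mulmxA -(repM (elem_star et)) // mulmxV //.
    by rewrite (rep1 (elem_star et)) mul1mx.
  rewrite -Sv; move: (t (invmx g) *m E i) => u.
  have -> : u = u o0 0 *: E o0 + u o1 0 *: E o1 + u o2 0 *: E o2.
    by apply/colP; elim/ord3P; rewrite !mxE /=; ring.
  have cP : (1%:M - P3) *m S g = S g *m (1%:M - P3).
    by rewrite mulmxBl mulmxBr mul1mx mulmx1 (projC pP3).
  rewrite !tvDl !tvZl mulmxA cP -mulmxA.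
  rewrite !mulmxDr -!scalemxAr !vanish; try exact: P3v.
  by rewrite !mulmx0 !scaler0 !addr0.
have E4 : P3 *m ((1%:M : 'M_3) *t Q) = (1%:M : 'M_3) *t Q.
  by apply/esym/eqP; rewrite -subr_eq0 -{1}[_ *t _]mul1mx -mulmxBl k2.
have E5 : ((1%:M : 'M_3) *t Q) *m P3 = P3.
  by apply/esym/eqP; rewrite -subr_eq0 -{1}[P3]mul1mx -mulmxBl k1.
have E6 := congr1 (@hc C _ _) E5; rewrite hcM (projH pP3) (projH pQ) in E6.
by rewrite -E4.
Qed.

(** Orbits of equal highest weight correspond under [star_intertwiner], so the separation may be
    tested in any convenient model. *)
Lemma separated_model n' (s' : 'M[C]_3 -> 'M[C]_n') w' (i : 'I_3) m (M : 'M[C]_(m, 3 * n')) :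
  star_rep s' -> hwv s' w' l ->
  (forall (j : 'I_3) g, (j < i)%N -> \det g = 1 ->
     M *m tv (t g *m E j) (s' g *m w') = 0) ->
  M *m tv (E i) w' != 0 -> separated i.
Proof.
move=> ss' hw' Mv Mi; have [J JE] := star_intertwiner ss hw ss' hw'.
exists m, (M *m ((1%:M : 'M_3) *t J)); split=> [j g ji dg|].
  by rewrite tens_tv -mulmxA tens_tv mul1mx JE // Mv.
have Jw : J *m w = w'.
  by have := JE 1%:M; rewrite det1 (rep1 ss) (rep1 ss') !mul1mx => ->.
by rewrite -mulmxA tens_tv mul1mx Jw.
Qed.

End PieriRule.

Definition fun3 n (x y : 'cV[C]_3) (w : 'cV[C]_n) : 'M[C]_(1, 3 * (3 * n)) :=
  x^T *t (y^T *t hc w).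

Lemma fun3E n (x y : 'cV[C]_3) (w : 'cV[C]_n) u v z :
  fun3 x y w *m tv u (tv v z) =
  ((x^T *m u) 0 0 * (y^T *m v) 0 0 * (hc w *m z) 0 0)%:M.
Proof.
transitivity ((x^T *m u) *t ((y^T *m v) *t (hc w *m z)) : 'M_1).
  apply: etrans (tensmx_mul x^T (y^T *t hc w) u (v *t z)) _.
  by congr (_ *t _); apply: (tensmx_mul y^T (hc w) v z).
have tens1 (A B D : 'M[C]_1) : A *t (B *t D) = (A 0 0 * B 0 0 * D 0 0)%:M :> 'M_1.
  apply/matrixP => i j; rewrite !mxE !ord1 eqxx mulr1n -mulrA.
  by congr (A _ _ * (B _ _ * D _ _)); rewrite ord1.
exact: tens1.
Qed.

Lemma E_tr (i : 'I_3) (u : 'cV[C]_3) : ((E i)^T *m u) 0 0 = u i 0.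
Proof.
rewrite mxE (bigD1 i) //= !mxE !eqxx mul1r big1 ?addr0 // => j ne.
by rewrite !mxE (negPf ne) mul0r.
Qed.

Lemma mulE (A : 'M[C]_3) i j : (A *m E j) i 0 = A i j.
Proof. by rewrite -colE mxE. Qed.

Definition trivrep (g : 'M[C]_3) : 'M[C]_1 := 1%:M.

Lemma triv_star : star_rep trivrep.
Proof.
split; first split=> //.
- by move=> g h _ _; rewrite mul1mx.
- by move=> i j; apply: pcurve_cst.
- by move=> g _; rewrite hc1.
exists (fun=> (0, 0, 0)%N) => a b c _; apply/matrixP => i j.
by rewrite !ord1 !mxE /mono /= !expr0 !mulr1.
Qed.

Lemma triv_hwv : hwv trivrep 1%:M (0, 0)%N.
Proof.
split; first exact: oner_neq0.
  by move=> x y z; rewrite mul1mx.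
by move=> a b c _; rewrite mul1mx /mono /= !expr0 !mulr1 scale1r.
Qed.

Lemma hwv_tens t e n (s : 'M[C]_3 -> 'M[C]_n) w l : elementary t e ->
  hwv s w l -> (tnth e o0).2 = 0%N -> ((tnth e o0).1.2 <= (tnth e o0).1.1)%N ->
  hwv (tensrep t s) (tv (E o0) w)
    ((tnth e o0).1.1 - (tnth e o0).1.2 + l.1, (tnth e o0).1.2 + l.2)%N.
Proof.
move=> et hw e0 ed; split.
- apply: tv_neq0 (hwv_neq0 hw); apply/matrix0Pn; exists o0, 0.
  by rewrite !mxE eqxx oner_neq0.
- by move=> x y z; rewrite tens_tv (elem_fixed et) (hwv_fixed hw).
have := wvec_tens (elem_wvec et o0) (hwv_weight hw); rewrite /= e0 addn0.
move: (tnth e o0) ed e0 => [[p q] r] /= ed e0.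
by rewrite (_ : p + (l.1 + l.2) = p - q + l.1 + (q + l.2))%N; last by lia.
Qed.

Lemma std_hwv n (s : 'M[C]_3 -> 'M[C]_n) w a b : hwv s w (a, b) ->
  hwv (tensrep id s) (tv (E o0) w) (a.+1, b).
Proof. by move=> hw; apply: (hwv_tens (std_elementary C) hw). Qed.

Lemma dual3_hwv n (s : 'M[C]_3 -> 'M[C]_n) w a b : hwv s w (a, b) ->
  hwv (tensrep (@dual3 C) s) (tv (E o0) w) (a, b.+1).
Proof. by move=> hw; apply: (hwv_tens (dual3_elementary C) hw). Qed.

(** Tensor powers of V and V^*, with the product of their highest weight vectors. The space is
    reducible in general; its cyclic part is the module wanted. *)
Lemma model_exists (l : nat * nat) : exists n (s : 'M[C]_3 -> 'M[C]_n) w,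
  star_rep s /\ hwv s w l.
Proof.
case: l => a b; elim: b => [|b [n [s [w [ss hw]]]]].
  elim: a => [|a [n [s [w [ss hw]]]]].
    exists 1%N, trivrep, 1%:M; split; [exact: triv_star | exact: triv_hwv].
  exists (3 * n)%N, (tensrep id s), (tv (E o0) w).
  by split; [apply: tens_star => //; apply: elem_star (std_elementary C) | apply: std_hwv].
exists (3 * n)%N, (tensrep (@dual3 C) s), (tv (E o0) w).
by split; [apply: tens_star => //; apply: elem_star (dual3_elementary C) | apply: dual3_hwv].
Qed.

(* Realise the highest weight vector as E_0 \otimes w': antisymmetrisation of
   the first two factors kills the orbit of E_0 \otimes E_0 \otimes w'. *)
Lemma separated_antisym t e n (s : 'M[C]_3 -> 'M[C]_n) w l
    n' (s' : 'M[C]_3 -> 'M[C]_n') w' :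
  elementary t e -> star_rep s -> hwv s w l -> star_rep s' -> w' != 0 ->
  hwv (tensrep t s') (tv (E o0) w') l -> separated t s w o1.
Proof.
move=> et ss hw ss' w'0 hw'.
pose M := fun3 (E o1) (E o0) w' - fun3 (E o0) (E o1) w'.
apply: (separated_model ss hw (M := M) (tens_star (elem_star et) ss') hw').
  move=> j g j0 dg; have {j j0}-> : j = o0 by apply: val_inj; case: j j0 => -[|[|[]]].
  by rewrite tens_tv mulmxBl !fun3E !E_tr [X in (X * _)%:M - _]mulrC subrr.
rewrite mulmxBl !fun3E !E_tr !mxE /= mul0r mul0r raddf0 subr0 !mul1r.
apply/matrix0Pn; exists 0, 0; rewrite mxE mulr1n.
by have := sqnorm_eq0 w'; rewrite mxE => ->.
Qed.

(* The contraction V^* \otimes V -> C kills the orbits of e_3^* \otimes e_1 and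
   e_2^* \otimes e_1, but not e_1^* \otimes e_1. *)
Lemma separated_contraction n (s : 'M[C]_3 -> 'M[C]_n) w l
    n' (s' : 'M[C]_3 -> 'M[C]_n') w' :
  star_rep s -> hwv s w l -> star_rep s' -> w' != 0 ->
  hwv (tensrep id s') (tv (E o0) w') l -> separated (@dual3 C) s w o2.
Proof.
move=> ss hw ss' w'0 hw'.
pose M := fun3 (E o2) (E o0) w' + fun3 (E o1) (E o1) w' + fun3 (E o0) (E o2) w'.
have et := dual3_elementary C.
apply: (separated_model ss hw (M := M) (tens_star (elem_star (std_elementary C)) ss') hw').
  move=> j g j0 dg; rewrite tens_tv !mulmxDl !fun3E !E_tr -!raddfD -!mulrDl.
  rewrite (_ : _ + _ + _ = 0) ?mul0r ?raddf0 // !mulE.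
  have {j0} [->|->] : j = o0 \/ j = o1.
    by case: j j0 => -[|[|[]]] // i0 _; [left|right]; apply: val_inj.
  - by rewrite !mxE /=; ring.
  - by rewrite !mxE /=; ring.
rewrite !mulmxDl !fun3E !E_tr !mxE /= !mul0r !raddf0 !addr0 !mul1r.
apply/matrix0Pn; exists 0, 0; rewrite mxE mulr1n.
by have := sqnorm_eq0 w'; rewrite mxE => ->.
Qed.

End Pieri.

(** * Decomposition into irreducible representations *)

Section Decomposition.
Variable C : numClosedFieldType.

Local Notation E := (fun i : 'I_3 => delta_mx i 0 : 'cV[C]_3).

Definition chi_torus (l : nat * nat) (a b c : C) : C :=
  chiw (a + b + c) (a * b + a * c + b * c) l.

Lemma chi_torusE p q a b c :
  chi_torus (p, q) a b c = chi (a + b + c) (a * b + a * c + b * c) p q.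
Proof. by []. Qed.

Lemma hwv_eq n (s : 'M[C]_3 -> 'M[C]_n) v l l' : hwv s v l -> l = l' -> hwv s v l'.
Proof. by move=> hv <-. Qed.

Lemma separated0 t n (s : 'M[C]_3 -> 'M[C]_n) w : w != 0 -> separated t s w o0.
Proof.
move=> w0; exists (3 * n)%N, 1%:M; split=> //; rewrite mul1mx tv_neq0 //.
by apply/matrix0Pn; exists o0, 0; rewrite !mxE eqxx oner_neq0.
Qed.

Lemma pieri_trace t n (s : 'M[C]_3 -> 'M[C]_n) Q Q0 Q1 Q2 g :
  (1%:M : 'M_3) *t Q = Q0 + Q1 + Q2 ->
  \tr (Q0 *m tensrep t s g) + \tr (Q1 *m tensrep t s g) + \tr (Q2 *m tensrep t s g)
    = \tr (t g) * \tr (Q *m s g).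
Proof.
move=> QE; rewrite -!raddfD -!mulmxDl /= -QE /tensrep tensmx_mul mul1mx.
exact: trace_tens.
Qed.

(** Traces and [chi] obey the same Pieri recursion: tensoring a smaller module with V or V^* gives
    the module wanted and others of smaller l.1 + l.2. By [cyc_trace] one model per weight is
    enough. *)
Lemma cyc_trace_chi l n (s : 'M[C]_3 -> 'M[C]_n) w Q :
  star_rep s -> hwv s w l -> cyc s w Q ->
  forall a b c, a * b * c = 1 -> \tr (Q *m s (diag3 a b c)) = chi_torus l a b c.
Proof.
pose Xeq l := forall n (s : 'M[C]_3 -> 'M[C]_n) w Q, star_rep s -> hwv s w l ->
  cyc s w Q -> forall a b c, a * b * c = 1 ->
  \tr (Q *m s (diag3 a b c)) = chi_torus l a b c.
suff X N : forall l, (l.1 + l.2 < N)%N -> Xeq l.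
  by move=> ss hw cQ; apply: (X (l.1 + l.2).+1 l (ltnSn _) _ _ _ _ ss hw cQ).
have of_model l' n' (s' : 'M[C]_3 -> 'M[C]_n') w' Q' : star_rep s' -> hwv s' w' l' ->
    cyc s' w' Q' -> (forall a b c, a * b * c = 1 ->
      \tr (Q' *m s' (diag3 a b c)) = chi_torus l' a b c) -> Xeq l'.
  move=> ss' hw' cQ' tE n1 s1 w1 Q1 ss1 hw1 cQ1 a b c abc.
  by rewrite (cyc_trace ss1 hw1 cQ1 ss' hw' cQ') ?tE // det_diag3.
elim: N => // N IH [p [|q]] /=.
  case: p => [_|p le_pN].
    have [Q0 cQ0] := cyc_exists 1%:M (triv_star C).
    apply: (of_model _ _ _ _ _ (triv_star C) (triv_hwv C) cQ0) => a b c abc.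
    have := cyc_id cQ0; rewrite mulmx1 => ->.
    by rewrite mxtrace1 /chi_torus /chiw chi00.
  have [n0 [s0 [w0 [ss0 hw0]]]] := model_exists C (p, 0)%N.
  have [Q0 cQ0] := cyc_exists w0 ss0.
  have et := std_elementary C; set t := id in et.
  have sS : star_rep (tensrep t s0) := tens_star (elem_star et) ss0.
  have [A0 [A1 [A2 [QE S0 S1 S2]]]] := pieri et ss0 hw0 cQ0.
  case: S0 => [[[]]|]; first exact: separated0 (hwv_neq0 hw0).
  move=> [_ _ [z [hz cz]]]; have {}hz : hwv (tensrep t s0) z (p.+1, 0)%N.
    by apply: hwv_eq hz _; rewrite /pieri_weight /=; congr (_, _); lia.
  apply: (of_model _ _ _ _ _ sS hz cz) => a b c abc.
  have := pieri_trace t s0 (diag3 a b c) QE.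
  (* For a weight (p, 0) the third candidate is not dominant. *)
  have -> : A2 = 0 by case: S2 => [[_ ->]//|[]]; rewrite /pieri_weight /=.
  rewrite (IH (p, 0)%N _ _ _ _ _ ss0 hw0 cQ0) //.
  have -> : \tr (t (diag3 a b c)) = a + b + c by rewrite /mxtrace sum3 !mxE.
  rewrite !chi_torusE pieri_x chiS0r addr0 mul0mx raddf0 addr0.
  suff -> : \tr (A1 *m tensrep t s0 (diag3 a b c)) =
      chiS (a + b + c) (a * b + a * c + b * c) p 2 by move/addIr.
  have sep1 : (0 < p)%N -> separated t s0 w0 o1.
    case: p {le_pN hz} hw0 {cQ0 S1 S2} => // p hw0 _.
    have [n1 [s1 [w1 [ss1 hw1]]]] := model_exists C (p, 0)%N.
    exact: (separated_antisym et ss0 hw0 ss1 (hwv_neq0 hw1) (std_hwv hw1)).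
  case: p {hz} hw0 {cQ0} S1 {S2} sep1 le_pN => [|p] hw0 S1 sep1 le_pN.
    rewrite chiS0l; case: S1 => [[_ ->]|[]]; first by rewrite mul0mx raddf0.
    by rewrite /pieri_weight.
  case: S1 => [[[]]|[_ _]]; first exact: sep1.
  move=> [z' [hz' cz']]; have {}hz' : hwv (tensrep t s0) z' (p, 1)%N.
    by apply: hwv_eq hz' _; rewrite /pieri_weight /=; congr (_, _); lia.
  by rewrite (IH (p, 1)%N _ _ _ _ _ sS hz' cz') //=; move: le_pN => /=; lia.
move=> le_N.
have [n0 [s0 [w0 [ss0 hw0]]]] := model_exists C (p, q)%N.
have [Q0 cQ0] := cyc_exists w0 ss0.
have et := dual3_elementary C; set t := @dual3 C in et.
have sS : star_rep (tensrep t s0) := tens_star (elem_star et) ss0.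
have [A0 [A1 [A2 [QE S0 S1 S2]]]] := pieri et ss0 hw0 cQ0.
case: S0 => [[[]]|]; first exact: separated0 (hwv_neq0 hw0).
move=> [_ _ [z [hz cz]]]; have {}hz : hwv (tensrep t s0) z (p, q.+1)%N.
  by apply: hwv_eq hz _; rewrite /pieri_weight /=; congr (_, _); lia.
apply: (of_model _ _ _ _ _ sS hz cz) => a b c abc.
have := pieri_trace t s0 (diag3 a b c) QE.
rewrite (IH (p, q) _ _ _ _ _ ss0 hw0 cQ0) //; last by move: le_N => /=; lia.
have -> : \tr (t (diag3 a b c)) = a * b + a * c + b * c.
  by rewrite /t dual3_diag3 /mxtrace sum3 !mxE.
rewrite !chi_torusE pieri_y.
have -> : \tr (A1 *m tensrep t s0 (diag3 a b c)) =
    chiS (a + b + c) (a * b + a * c + b * c) p.+2 q.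
  have sep1 : (0 < q)%N -> separated t s0 w0 o1.
    case: q {le_N hz S1 S2} hw0 {cQ0} => // q hw0 _.
    have [n1 [s1 [w1 [ss1 hw1]]]] := model_exists C (p, q)%N.
    exact: (separated_antisym et ss0 hw0 ss1 (hwv_neq0 hw1) (dual3_hwv hw1)).
  case: q {hz S2} hw0 {cQ0} S1 sep1 le_N => [|q] hw0 S1 sep1 le_N.
    (* On the wall the candidate weight is not dominant, matching the vanishing of [chiS]. *)
    rewrite chiS0r; case: S1 => [[_ ->]|[]]; first by rewrite mul0mx raddf0.
    by rewrite /pieri_weight.
  case: S1 => [[[]]|[_ _]]; first exact: sep1.
  move=> [z' [hz' cz']]; have {}hz' : hwv (tensrep t s0) z' (p.+1, q)%N.
    by apply: hwv_eq hz' _; rewrite /pieri_weight /=; congr (_, _); lia.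
  by rewrite (IH (p.+1, q) _ _ _ _ _ sS hz' cz') //=; move: le_N => /=; lia.
suff -> : \tr (A2 *m tensrep t s0 (diag3 a b c)) =
    chiS (a + b + c) (a * b + a * c + b * c) p q.+1 by move/addIr/addIr.
have sep2 : (0 < p)%N -> separated t s0 w0 o2.
  case: p {le_N hz S1 S2} hw0 {cQ0} => // p hw0 _.
  have [n1 [s1 [w1 [ss1 hw1]]]] := model_exists C (p, q)%N.
  exact: (separated_contraction ss0 hw0 ss1 (hwv_neq0 hw1) (std_hwv hw1)).
case: p {hz S1} hw0 {cQ0} S2 sep2 le_N => [|p] hw0 S2 sep2 le_N.
  rewrite chiS0l; case: S2 => [[_ ->]|[]]; first by rewrite mul0mx raddf0.
  by rewrite /pieri_weight /=; lia.
case: S2 => [[[]]|[_ _]]; first exact: sep2.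
move=> [z' [hz' cz']]; have {}hz' : hwv (tensrep t s0) z' (p, q)%N.
  by apply: hwv_eq hz' _; rewrite /pieri_weight /=; congr (_, _); lia.
by rewrite (IH (p, q) _ _ _ _ _ sS hz' cz') //=; move: le_N => /=; lia.
Qed.

Definition invariant_vec n (s : 'M[C]_3 -> 'M[C]_n) (v : 'cV[C]_n) : Prop :=
  forall g, \det g = 1 -> s g *m v = v.

Lemma cyc_invariant n (s : 'M[C]_3 -> 'M[C]_n) w Q l v :
  star_rep s -> hwv s w l -> cyc s w Q -> Q *m v = v -> invariant_vec s v ->
  exists c, v = c *: w /\ (l != (0, 0)%N -> c = 0).
Proof.
move=> ss hw cQ Qv vi; have nw : (hc w *m w) 0 0 != 0 by rewrite sqnorm_eq0 (hwv_neq0 hw).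
pose c := (hc w *m v) 0 0 / (hc w *m w) 0 0.
have v0 : v - c *: w = 0.
  apply: (cyc_ufixed0 ss hw cQ).
  - move=> x y z; rewrite mulmxBr vi ?det_upper // -scalemxAr.
    by rewrite (hwv_fixed hw).
  - by rewrite mulmxBr Qv -scalemxAr (cyc_id cQ).
  rewrite -[_ *m _]hcK hcM hcK hcE mulmxBr -scalemxAr.
  have -> : (hc w *m v - c *: (hc w *m w)) 0 0 = 0.
    move: nw; rewrite /c; move: (hc w *m v) (hc w *m w) => A B nB.
    by rewrite !mxE divfK ?subrr.
  by rewrite rmorph0.
have {}v0 : v = c *: w by apply/eqP; rewrite -subr_eq0 v0.
exists c; split=> // l0; apply/eqP/negPn/negP => c0.
have n2 : 2 != 0 :> C by rewrite pnatr_eq0.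
have abc : 2 * 1 * 2^-1 = 1 :> C by rewrite mulr1 divff.
(* This torus element acts on [w] by 2^(l.1 + l.2), which is 1 only for the zero weight. *)
have := vi (diag3 2 1 2^-1); rewrite det_diag3 abc => /(_ erefl).
rewrite v0 -scalemxAr (hwv_weight hw) // scalerA => /eqP.
rewrite -subr_eq0 -scalerBl scaler_eq0 (negPf (hwv_neq0 hw)) orbF.
rewrite -{2}[c]mulr1 -mulrBr mulf_eq0 (negPf c0) /= /mono /= expr1n expr0 !mulr1.
rewrite subr_eq0 -natrX -[1]/(1%:R) eqr_nat -[1%N](expn0 2) eqn_exp2l //.
by rewrite addn_eq0 => /andP[/eqP l1 /eqP l2]; case: l l0 l1 l2 {hw} => ? ? /= /eqP l0 l1 l2; case: l0; rewrite l1 l2.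
Qed.

Lemma hwv0_invariant n (s : 'M[C]_3 -> 'M[C]_n) w :
  star_rep s -> hwv s w (0, 0)%N -> invariant_vec s w.
Proof.
move=> ss hw; have [J JE] := star_intertwiner (triv_star C) (triv_hwv C) ss hw.
move=> g dg; rewrite -JE // -[X in _ = X](mul1mx w) -(rep1 ss) -JE ?det1 //.
Qed.

(** Induction on the rank: each cyclic summand adds its weight to [L], and its generator to [B]
    exactly when that weight is zero. Projectors keep the ambient representation fixed
    throughout. *)
Lemma decomposition n (s : 'M[C]_3 -> 'M[C]_n) P : star_rep s -> projr s P ->
  exists L : seq (nat * nat),
   (forall a b c, a * b * c = 1 ->
      \tr (P *m s (diag3 a b c)) = \sum_(l <- L) chi_torus l a b c) /\
   exists B : seq 'cV[C]_n, [/\ size B = count_mem (0, 0)%N L, free B &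
     forall v, v \in <<B>>%VS <-> (P *m v = v /\ invariant_vec s v)].
Proof.
move=> ss; have [N le_N] := ubnP (\rank P); elim: N P le_N => // N IH P le_N pP.
have [P0|P0] := eqVneq P 0.
  exists [::]; split=> [a b c _|]; first by rewrite big_nil P0 mul0mx raddf0.
  exists [::]; split=> //; first by rewrite nil_free.
  move=> v; rewrite span_nil memv0 P0; split=> [/eqP ->|[<- _]].
    by split=> [|g _]; rewrite mulmx0.
  by rewrite mul0mx.
have [w [l [Pw hw]]] := exists_hwv ss pP P0.
have [Q cQ] := cyc_exists w ss.
have PQ : P *m Q = Q.
  rewrite -[RHS]mul1mx; apply: (cyc_ext cQ) => g dg.
  by rewrite mul1mx mulmxA (projC pP) // -mulmxA Pw.
have QP : Q *m P = Q by rewrite -[Q]hcK -[P]hcK -hcM (projH pP) (projH cQ) PQ (projH cQ).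
have pP' := projrB pP (cyc_proj cQ) PQ.
have Q0 : Q != 0.
  by apply: contraNneq (hwv_neq0 hw) => Q0; rewrite -(cyc_id cQ) Q0 mul0mx.
have rk : (\rank (P - Q)%R < N)%N.
  apply: (@leq_trans (\rank P)); last by rewrite -ltnS.
  apply: rank_ltmx; rewrite ltmxE; apply/andP; split.
    have -> : P - Q = (P - Q) *m P by rewrite mulmxBl (projI pP) QP.
    exact: submxMl.
  apply: contra Q0 => /submxP[X PX].
  by rewrite -PQ PX -mulmxA mulmxBl PQ (projI cQ) subrr mulmx0.
have [L [trL [B [szB frB memB]]]] := IH _ rk pP'.
have P'w : (P - Q) *m w = 0 by rewrite mulmxBl Pw (cyc_id cQ) subrr.
exists (l :: L); split=> [a b c abc|].
  rewrite big_cons -trL // -(cyc_trace_chi ss hw cQ) // -raddfD -mulmxDl.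
  by rewrite [Q + _]addrC subrK.
have invQ v : invariant_vec s v -> invariant_vec s (Q *m v).
  by move=> vi g dg; rewrite mulmxA -(projC cQ) // -mulmxA vi.
have invP' v : invariant_vec s v -> invariant_vec s ((P - Q) *m v).
  by move=> vi g dg; rewrite mulmxA -(projC pP') // -mulmxA vi.
have PP' : P *m (P - Q) = P - Q by rewrite mulmxBr (projI pP) PQ.
have split_inv v : P *m v = v -> invariant_vec s v ->
    exists2 c, v - c *: w \in <<B>>%VS & (l != (0, 0)%N -> c = 0).
  move=> Pv vi; have [|c [Qv c0]] := cyc_invariant ss hw cQ (v := Q *m v) _ (invQ _ vi).
    by rewrite mulmxA (projI cQ).
  exists c => //; rewrite -Qv -{1}Pv -mulmxBl; apply/memB; split; last exact: invP'.
  by rewrite mulmxA (projI pP').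
have BP u : u \in <<B>>%VS -> P *m u = u.
  by case/memB => <- _; rewrite mulmxA PP'.
have [l0|l0] := eqVneq l (0, 0)%N; last first.
  exists B; split=> //; first by rewrite /= (negPf l0).
  move=> v; split=> [vB|[Pv vi]]; first by split; [apply: BP | case/memB: vB].
  by have [c vB c0] := split_inv v Pv vi; move: vB; rewrite c0 // scale0r subr0.
exists (w :: B); split=> [||v].
- by rewrite /= szB l0 eqxx.
- rewrite free_cons frB andbT; apply/negP => /memB[].
  by rewrite P'w => w0 _; case/eqP: (hwv_neq0 hw).
have wi : invariant_vec s w by apply: hwv0_invariant; rewrite -?l0.
rewrite span_cons; split=> [/memv_addP[u /vlineP[c ->] [u' u'B ->]]|[Pv vi]].
  have [_ u'i] := (memB u').1 u'B; split; first by rewrite mulmxDr -scalemxAr Pw BP.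
  by move=> g dg; rewrite mulmxDr -scalemxAr wi // u'i.
have [c vB _] := split_inv v Pv vi; apply/memv_addP; exists (c *: w).
  by apply/vlineP; exists c.
by exists (v - c *: w) => //; rewrite addrC subrK.
Qed.

End Decomposition.

(** * Embedding given irreducible representations into star representations *)

Section IrreducibleModels.
Variable R : realType.
Local Notation C := (R[i]).

Section OneIrreducible.
Variables (n m d : nat) (rho : 'M[C]_3 -> 'M[C]_d).
Hypothesis irr : irrep_of_weight n m rho.

Lemma rational_polyrep : polyrep rho.
Proof.
have [[r1 rM [p rp]] _ _] := irr; split=> //.
  by move=> g h dg dh; apply: rM; apply/eqP.
move=> i j G.
exists (\sum_(e <- msupp (p i j)) ((p i j)@_e)%:P * \prod_a (mxvec G 0 a) ^+ e a).
move=> z dz; rewrite rp; last by apply/eqP.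
rewrite mevalE horner_sum; apply: eq_bigr => e _.
rewrite hornerM hornerC horner_prod; congr (_ * _); apply: eq_bigr => a _.
by rewrite horner_exp -map_mxvec mxE.
Qed.

Lemma irrep_hwv : exists v, hwv rho v (n, m).
Proof.
have [_ _ [v [v0 uv tv]]] := irr; exists v; split=> // [x y z|a b c abc].
  apply: uv; apply/andP; split; first by apply/forallP; elim/ord3P; rewrite mxE.
  by apply/is_trig_mxP; elim/ord3P; elim/ord3P; rewrite !mxE.
rewrite diag3_row tv; last by rewrite -diag3_row -topredE /= /SL3 det_diag3 abc.
by congr (_ *: _); rewrite !mxE /mono /= exprMn exprD; ring.
Qed.

(** The representation sending g to rho(g^T)^T exchanges upper and lower matrices, so a vector fixed
    in it transposes to the required covector. *)
Lemma irrep_covector : exists l : 'rV[C]_d, l != 0 /\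
  forall x y z, l *m rho (lower x y z) = l.
Proof.
have pr := rational_polyrep; have [_ [d0 _] _] := irr.
have pr' : polyrep (fun g => (rho g^T)^T).
  split; first by rewrite trmx1 (rep1 pr) trmx1.
    by move=> g h dg dh; rewrite trmx_mul (repM pr) ?det_tr // trmx_mul.
  move=> i j G; have [q qE] := rep_pcurve pr j i G^T.
  by exists q => z dz; rewrite mxE map_trmx qE // -map_trmx det_tr.
have [v [v0 fv]] := exists_ufixed pr' d0.
exists v^T; split=> [|x y z]; first by rewrite trmx_eq0.
have := fv x y z; rewrite /upper tr_mx3 => /(congr1 trmx).
by rewrite trmx_mul trmxK.
Qed.

(** The orbit of a nonzero vector spans an invariant subspace, hence everything. *)
Lemma irrep_ext (v : 'cV[C]_d) k (M N : 'M[C]_(k, d)) : v != 0 ->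
  (forall g, \det g = 1 -> M *m (rho g *m v) = N *m (rho g *m v)) -> M = N.
Proof.
have pr := rational_polyrep; have [_ [_ irrU] _] := irr.
move=> v0 MN; pose F (g : sl3 C) := rho (sval g) *m v.
have [r [x [[L LA] sp]]] := span_family F; set A := cols F x in LA sp.
pose U := limg (linfun (mulmx A : 'cV_r -> 'cV_d)).
have UP u : u \in U <-> exists c, u = A *m c.
  split=> [/memv_imgP[c _ ->]|[c ->]]; first by exists c; rewrite lfunE.
  by apply/memv_imgP; exists c; rewrite ?memvf // lfunE.
have AL : A *m L = 1%:M.
  have [g u dg|U0|Uf] := irrU U.
  - case/UP => c ->; apply/UP.
    have dg1 : \det g = 1 by apply/eqP.
    have gA : rho g *m A = A *m (L *m (rho g *m A)).
      rewrite mulmx_cols; apply/matrixP => i j.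
      have [c' Fc] := sp (sl3M (exist _ g dg1) (x j)).
      have Fj : rho g *m F (x j) = A *m c'.
        by rewrite -Fc /F /= (repM pr) ?mulmxA // (svalP (x j)).
      transitivity ((A *m (L *m (rho g *m F (x j)))) i 0).
        by rewrite Fj [L *m _]mulmxA LA mul1mx -Fj mxE.
      rewrite mxE [RHS]mxE; apply: eq_bigr => k' _; congr (_ * _).
      by rewrite !mxE; apply: eq_bigr => k'' _; rewrite !mxE.
    by exists (L *m (rho g *m A) *m c); rewrite [LHS]mulmxA [X in X *m c = _]gA -!mulmxA.
  - case/eqP: v0; have : v \in U.
      apply/UP; have [c Fc] := sp (exist _ 1%:M (det1 _ _)).
      by exists c; rewrite -Fc /F /= (rep1 pr) mul1mx.
    by rewrite U0 memv0 => /eqP.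
  apply/matrixP => i j; have : (delta_mx j 0 : 'cV_d) \in U by rewrite Uf memvf.
  case/UP => c cE; have := congr1 (fun u => (A *m (L *m u)) i 0) cE.
  rewrite [L *m (A *m c)]mulmxA LA mul1mx -cE mulmxA -colE !mxE => ->.
  by rewrite eqxx andbT.
apply/eqP; rewrite -subr_eq0 -[M - N]mulmx1 -AL mulmxA mulmx_cols cols_eq0 ?mul0mx //.
by move=> j; rewrite mulmxBl MN ?subrr // (svalP (x j)).
Qed.

(** The common kernel of the translates of [l] is invariant and proper. This takes over the role
    that positivity has in [star_zero]. *)
Lemma irrep_zero (l : 'rV[C]_d) (u : 'cV[C]_d) : l != 0 ->
  (forall h, \det h = 1 -> l *m rho h *m u = 0) -> u = 0.
Proof.
have pr := rational_polyrep; have [_ [_ irrU] _] := irr.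
move=> l0 lu; pose F (g : sl3 C) := (l *m rho (sval g))^T.
have [r [x [[L LA] sp]]] := span_family F; set A := cols F x in LA sp.
pose U := lker (linfun (mulmx A^T : 'cV_d -> 'cV_r)).
have UP y : y \in U <-> forall h, \det h = 1 -> l *m rho h *m y = 0.
  rewrite memv_ker lfunE /=; split=> [/eqP Ay h dh|ly].
    have [c /(congr1 trmx)] := sp (exist _ h dh); rewrite /F /= trmxK trmx_mul => ->.
    by rewrite -mulmxA Ay mulmx0.
  apply/eqP/colP => j; rewrite [RHS]mxE.
  transitivity ((l *m rho (sval (x j)) *m y) 0 0).
    rewrite mxE [RHS]mxE; apply: eq_bigr => i _; congr (_ * _).
    by rewrite mxE mxE /F mxE.
  by rewrite ly ?(svalP (x j)) // mxE.
have [g y dg|U0|Uf] := irrU U.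
- move/UP => yU; apply/UP => h dh; have dg1 : \det g = 1 by apply/eqP.
  by rewrite mulmxA -[l *m rho h *m _]mulmxA -(repM pr) // yU ?det_mul1.
- by apply/eqP; rewrite -memv0 -U0; apply/UP.
case/eqP: l0; apply/matrixP => i j; rewrite ord1 [RHS]mxE.
have /UP/(_ 1%:M) : (delta_mx j 0 : 'cV_d) \in U by rewrite Uf memvf.
by rewrite det1 (rep1 pr) mulmx1 -colE => /(_ erefl)/matrixP/(_ 0 0); rewrite !mxE.
Qed.

(* A linear relation between the vectors rho(g_j) v holds iff the same relation
   holds between the vectors s(g_j) w: both are read off the functions
   h |-> hwfun (h g_j). *)
Lemma irrep_intertwiners N (s : 'M[C]_3 -> 'M[C]_N) w Q :
  star_rep s -> hwv s w (n, m) -> cyc s w Q ->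
  exists (J : 'M[C]_(N, d)) (J' : 'M[C]_(d, N)),
    [/\ J' *m J = 1%:M, J *m J' = Q,
        forall g, \det g = 1 -> J *m rho g = s g *m J
      & forall g, \det g = 1 -> J' *m s g = rho g *m J'].
Proof.
move=> ss hw cQ; have pr := rational_polyrep.
have [v hv] := irrep_hwv; have [l [l0 lf]] := irrep_covector.
have cE g : \det g = 1 -> (l *m rho g *m v) 0 0 = (l *m v) 0 0 * hwfun (n, m) g.
  by move=> dg; rewrite (coef_hwfun pr lf (hwv_fixed hv) (hwv_weight hv) erefl).
(* Otherwise all translates of [l] would kill [v]. *)
have lv : (l *m v) 0 0 != 0.
  apply: contraNneq (hwv_neq0 hv) => lv; apply/eqP/(irrep_zero l0) => h dh.
  by apply/matrixP => i j; rewrite !ord1 cE // lv mul0r mxE.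
have zero r (x : 'I_r -> sl3 C) c : \sum_j c j *: (rho (sval (x j)) *m v) = 0 <->
    forall h : sl3 C, \sum_j c j * hwfun (n, m) (sval h *m sval (x j)) = 0.
  have E (h : sl3 C) : (l *m rho (sval h) *m \sum_j c j *: (rho (sval (x j)) *m v)) 0 0
      = (l *m v) 0 0 * \sum_j c j * hwfun (n, m) (sval h *m sval (x j)).
    rewrite mulmx_sumr summxE mulr_sumr; apply: eq_bigr => j _.
    rewrite -scalemxAr mxE mulrCA; congr (_ * _); rewrite mulmxA -[l *m _ *m _]mulmxA.
    rewrite -(repM pr) ?(svalP h) ?(svalP (x j)) //.
    by rewrite cE // (svalP (sl3M h (x j))).
  split=> [z h|z]; first by apply: (mulfI lv); rewrite -E z mulmx0 mxE mulr0.
  apply: (irrep_zero l0) => h dh; apply/matrixP => i j; rewrite !ord1.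
  by have := E (exist _ h dh); rewrite z mulr0 /= => ->; rewrite mxE.
have [|J JE] := @lin_ext C (sl3 C) _ _ (fun g => rho (sval g) *m v) (fun g => s (sval g) *m w).
  by move=> r x c /zero z; apply/(star_zero _ _ ss hw).
have [|J0 J0E] := @lin_ext C (sl3 C) _ _ (fun g => s (sval g) *m w) (fun g => rho (sval g) *m v).
  by move=> r x c /(star_zero _ _ ss hw) z; apply/zero.
have {}JE g : \det g = 1 -> J *m (rho g *m v) = s g *m w.
  by move=> dg; apply: (JE (exist _ g dg)).
have {}J0E g : \det g = 1 -> J0 *m (s g *m w) = rho g *m v.
  by move=> dg; apply: (J0E (exist _ g dg)).
exists J, (J0 *m Q); split.
- apply: (irrep_ext (hwv_neq0 hv)) => g dg.
  by rewrite -!mulmxA JE // cyc_orbit // J0E // mul1mx.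
- rewrite mulmxA -[RHS]mul1mx; apply: (cyc_ext cQ) => g dg.
  by rewrite -mulmxA J0E // JE // mul1mx.
- move=> g dg; apply: (irrep_ext (hwv_neq0 hv)) => h dh.
  rewrite -!mulmxA JE // [rho g *m _]mulmxA -(repM pr) // JE ?det_mul1 //.
  by rewrite (repM ss) // mulmxA.
- move=> g dg; rewrite -mulmxA (projC cQ) // mulmxA [RHS]mulmxA.
  apply: (cyc_ext cQ) => h dh.
  rewrite -!mulmxA [s g *m _]mulmxA -(repM ss) // !J0E ?det_mul1 //.
  by rewrite (repM pr) // mulmxA.
Qed.

End OneIrreducible.

(** Identifies [rho] with the image of an invariant projector; all the data tensor factor by
    factor. *)
Record model (w : nat * nat) (d : nat) (rho : 'M[C]_3 -> 'M[C]_d) : Type := Model {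
  model_dim : nat;
  model_rep : 'M[C]_3 -> 'M[C]_model_dim;
  model_proj : 'M[C]_model_dim;
  model_in : 'M[C]_(model_dim, d);
  model_out : 'M[C]_(d, model_dim);
  model_star : star_rep model_rep;
  model_projr : projr model_rep model_proj;
  model_inK : model_out *m model_in = 1%:M;
  model_outK : model_in *m model_out = model_proj;
  model_inC : forall g, \det g = 1 -> model_in *m rho g = model_rep g *m model_in;
  model_outC : forall g, \det g = 1 -> model_out *m model_rep g = rho g *m model_out;
  model_trace : forall a b c, a * b * c = 1 ->
    \tr (model_proj *m model_rep (diag3 a b c)) = chi_torus w a b c }.

Lemma irrep_model w d (rho : 'M[C]_3 -> 'M[C]_d) :
  irrep_of_weight w.1 w.2 rho -> exists _ : model w rho, True.
Proof.
case: w => n m irr; have [N [s [u [ss hu]]]] := model_exists C (n, m).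
have [Q cQ] := cyc_exists u ss.
have [J [J' [J'J JJ' JC J'C]]] := irrep_intertwiners irr ss hu cQ.
have tr a b c (abc : a * b * c = 1) := cyc_trace_chi ss hu cQ abc.
by exists (Model ss (cyc_proj cQ) J'J JJ' JC J'C tr).
Qed.

(** * Tensor products over a finite index set and their invariants *)

Section MultiTensor.
Variable I : finType.

(** Rectangular form of [tensor_mx], for embeddings between spaces of different dimensions. On
    square matrices the two are convertible, which the rewrites with [-[LHS]/(rtmx _)] exploit. *)
Definition rtmx (d1 d2 : I -> nat) (A : forall E, 'M[C]_(d1 E, d2 E)) :
    'M[C]_(#|{: multi_index d1}|, #|{: multi_index d2}|) :=
  \matrix_(i, j) \prod_E A E (index_of i E) (index_of j E).

Lemma sum_index (V : nmodType) (d : I -> nat) (F : multi_index d -> V) :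
  \sum_j F (index_of j) = \sum_e F e.
Proof. by rewrite [RHS](reindex (@index_of I d)) //=; exact/onW_bij/enum_val_bij. Qed.

Lemma rtmx_mul d1 d2 d3 (A : forall E, 'M[C]_(d1 E, d2 E)) (B : forall E, 'M[C]_(d2 E, d3 E)) :
  rtmx A *m rtmx B = rtmx (fun E => A E *m B E).
Proof.
apply/matrixP => i j; rewrite !mxE.
under [RHS]eq_bigr do rewrite mxE.
rewrite distr_multi_index -sum_index; apply: eq_bigr => k _.
by rewrite !mxE -big_split.
Qed.

Lemma eq_rtmx d1 d2 (A B : forall E, 'M[C]_(d1 E, d2 E)) :
  (forall E, A E = B E) -> rtmx A = rtmx B.
Proof. by move=> AB; apply/matrixP => i j; rewrite !mxE; apply: eq_bigr => E _; rewrite AB. Qed.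

Lemma rtmx_diag d (v : forall E, 'rV[C]_(d E)) : rtmx (fun E => diag_mx (v E)) =
  diag_mx (\row_i \prod_E v E 0 (index_of i E)).
Proof.
apply/matrixP => i j; rewrite !mxE; have [->|ij] := eqVneq i j.
  by rewrite mulr1n; apply: eq_bigr => E _; rewrite mxE eqxx mulr1n.
rewrite mulr0n; have [E Eij] : exists E, index_of i E != index_of j E.
  apply/existsP; apply: contraR ij; rewrite negb_exists => /forallP h.
  apply/eqP/enum_val_inj/ffunP => E; apply/eqP; have := h E; by rewrite negbK.
by rewrite (bigD1 E) //= mxE (negPf Eij) mulr0n mul0r.
Qed.

Lemma rtmx1 (d : I -> nat) : rtmx (fun E => 1%:M : 'M[C]_(d E)) = 1%:M.
Proof.
rewrite -diag_const_mx -(eq_rtmx (A := fun E => diag_mx (const_mx 1))); last first.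
  by move=> E; rewrite diag_const_mx.
by rewrite rtmx_diag; congr diag_mx; apply/rowP => i; rewrite !mxE big1 // => E _; rewrite mxE.
Qed.

Lemma hc_rtmx d1 d2 (A : forall E, 'M[C]_(d1 E, d2 E)) :
  hc (rtmx A) = rtmx (fun E => hc (A E)).
Proof.
apply/matrixP => i j; rewrite hcE !mxE rmorph_prod; apply: eq_bigr => E _.
by rewrite hcE.
Qed.

Lemma trace_rtmx (d : I -> nat) (A : forall E, 'M[C]_(d E)) :
  \tr (rtmx A) = \prod_E \tr (A E).
Proof.
rewrite /mxtrace distr_multi_index -sum_index.
by apply: eq_bigr => i _; rewrite mxE.
Qed.

Lemma tensor_star (d : I -> nat) (s : forall E, 'M[C]_3 -> 'M[C]_(d E)) :
  (forall E, star_rep (s E)) -> star_rep (tensor_rep s).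
Proof.
move=> ss; split; first split.
- by rewrite -[LHS]/(rtmx _) -(rtmx1 d); apply: eq_rtmx => E; apply: rep1 (ss E).
- move=> g h dg dh; rewrite -[LHS]/(rtmx _) -[RHS]/(rtmx _ *m rtmx _) rtmx_mul.
  by apply: eq_rtmx => E; apply: repM (ss E) _ _ dg dh.
- move=> i j; apply: (@pcurve_ext _ (fun g => \prod_E s E g (index_of i E) (index_of j E))).
    by move=> g _; rewrite mxE.
  by apply: pcurve_prod => E; apply: rep_pcurve (ss E) _ _.
- move=> g dg; rewrite -[LHS]/(rtmx _) -[X in _ = hc X]/(rtmx _) hc_rtmx.
  by apply: eq_rtmx => E; apply: rep_star (ss E) _ dg.
pose e E := projT1 (cid (rep_diag (ss E))).
have eE E : forall a b c, a * b * c = 1 ->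
    s E (diag3 a b c) = diag_mx (\row_i mono (e E i) a b c).
  exact: (projT2 (cid (rep_diag (ss E)))).
exists (fun i => (\sum_E (e E (index_of i E)).1.1, \sum_E (e E (index_of i E)).1.2,
   \sum_E (e E (index_of i E)).2)%N).
move=> a b c abc; rewrite -[LHS]/(rtmx _).
rewrite (eq_rtmx (B := fun E => diag_mx (\row_i mono (e E i) a b c))); last first.
  by move=> E; rewrite eE.
rewrite rtmx_diag; congr diag_mx; apply/rowP => i.
rewrite !mxE /mono /= !expr_sum -!big_split.
by apply: eq_bigr => E _; rewrite mxE.
Qed.

Lemma tensor_invariants (w : I -> nat * nat) (d : I -> nat)
    (V : forall E, 'M[C]_3 -> 'M[C]_(d E)) :
  (forall E, irrep_of_weight (w E).1 (w E).2 (V E)) ->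
  exists L : seq (nat * nat),
   (forall a b c : C, a * b * c = 1 ->
      \prod_E chi_torus (w E) a b c = \sum_(l <- L) chi_torus l a b c) /\
   exists B : seq 'cV[C]_#|{: multi_index d}|,
    [/\ size B = count_mem (0, 0)%N L, free B &
       forall v, v \in <<B>>%VS <-> is_invariant (tensor_rep V) v].
Proof.
move=> irrV.
pose M E := projT1 (cid (irrep_model (irrV E))).
pose S := tensor_rep (fun E => model_rep (M E)).
pose P := rtmx (fun E => model_proj (M E)).
pose J := rtmx (fun E => model_in (M E)); pose J' := rtmx (fun E => model_out (M E)).
have sS : star_rep S by apply: tensor_star => E; apply: model_star.
have J'J : J' *m J = 1%:M.
  by rewrite rtmx_mul -rtmx1; apply: eq_rtmx => E; apply: model_inK.
have JJ' : J *m J' = P by rewrite rtmx_mul; apply: eq_rtmx => E; apply: model_outK.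
have JC g : \det g = 1 -> J *m tensor_rep V g = S g *m J.
  move=> dg; rewrite -[tensor_rep V g]/(rtmx _) -[S g]/(rtmx _) !rtmx_mul.
  by apply: eq_rtmx => E; apply: model_inC.
have J'C g : \det g = 1 -> J' *m S g = tensor_rep V g *m J'.
  move=> dg; rewrite -[tensor_rep V g]/(rtmx _) -[S g]/(rtmx _) !rtmx_mul.
  by apply: eq_rtmx => E; apply: model_outC.
have pP : projr S P.
  split.
  - by rewrite hc_rtmx; apply: eq_rtmx => E; apply: projH (model_projr _).
  - by rewrite rtmx_mul; apply: eq_rtmx => E; apply: projI (model_projr _).
  by move=> g dg; rewrite -JJ' -mulmxA J'C // mulmxA JC // mulmxA.
have [L [trL [B [szB frB memB]]]] := decomposition sS pP.
exists L; split=> [a b c abc|].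
  rewrite -trL // -[S _]/(rtmx _) rtmx_mul trace_rtmx; apply: eq_bigr => E _.
  by rewrite (model_trace (M E)).
pose f : 'Hom('cV[C]_#|{: multi_index (fun E => model_dim (M E))}|, 'cV[C]_#|{: multi_index d}|) :=
  linfun (mulmx J').
exists [seq f b | b <- B]; split.
- by rewrite size_map.
(* [J'] is injective on the span of [B], because [J] inverts it on the image of [P]. *)
- rewrite /free size_map -limg_span limg_dim_eq ?(eqP frB) //.
  apply/eqP; rewrite -subv0; apply/subvP => v; rewrite memv_cap memv_ker lfunE /=.
  case/andP => /memB[Pv _] /eqP J'v.
  by rewrite -Pv -JJ' -mulmxA J'v mulmx0 mem0v.
move=> v; rewrite -limg_span; split=> [/memv_imgP[u /memB[Pu ui] ->] g dg|vi].
  have dg1 : \det g = 1 by apply/eqP.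
  by rewrite lfunE /= mulmxA -J'C // -mulmxA ui.
apply/memv_imgP; exists (J *m v); last by rewrite lfunE /= mulmxA J'J mul1mx.
apply/memB; split; first by rewrite -JJ' -mulmxA [J' *m _]mulmxA J'J mul1mx.
by move=> g dg; rewrite mulmxA -JC // -mulmxA vi //; apply/eqP.
Qed.

End MultiTensor.
End IrreducibleModels.

(** * Triangulated polygons *)

Section Triangulations.
Variables (k : nat) (lam : {set {set 'I_k}}).
Hypothesis lamP : ideal_triangulation lam.
Implicit Types p q r u v : 'I_k.

Lemma edge_neq p q : [set p; q] \in lam -> p != q.
Proof.
have [c2 _ _ _] := lamP; move/c2 => e2; apply: contra_eqN e2 => /eqP ->.
by rewrite setUid cards1.
Qed.

Lemma edge_noncross a b c d : [set a; c] \in lam -> [set b; d] \in lam ->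
  (a < b)%N -> (b < c)%N -> (c < d)%N -> False.
Proof.
have [_ _ nc _] := lamP; move=> eL fL ab bc cd; have /negP := nc _ _ eL fL; apply.
apply/existsP; exists a; apply/existsP; exists b; apply/existsP; exists c.
by apply/existsP; exists d; rewrite ab bc cd !eqxx.
Qed.

Lemma edge_maximal p q : (p < q)%N ->
  (forall u v, (u < v)%N -> [set u; v] \in lam ->
     ~~ [&& u < p, p < v & v < q]%N /\ ~~ [&& p < u, u < q & q < v]%N) ->
  [set p; q] \in lam.
Proof.
move=> pq nc; have [_ _ _ mx] := lamP; apply: mx.
  by rewrite cards2; have -> : p != q by rewrite -(inj_eq val_inj) neq_ltn pq.
move=> f fL; apply/negP => /existsP[a /existsP[b /existsP[c /existsP[d]]]].
case/and4P => ab bc cd.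
have pair u v u' v' : (u < v)%N -> (u' < v')%N -> [set u; v] = [set u'; v'] -> u = u' /\ v = v'.
  move=> uv uv' E.
  have : u \in [set u'; v'] by rewrite -E set21.
  have : v \in [set u'; v'] by rewrite -E set22.
  rewrite !inE => /orP[]/eqP e1 /orP[]/eqP e2; subst=> //; try (by rewrite ltnn in uv).
  by have := ltn_trans uv uv'; rewrite ltnn.
case/orP => /andP[/eqP e1 /eqP e2].
  have [e3 e4] := pair _ _ _ _ pq (ltn_trans ab bc) e1; subst p q.
  rewrite e2 in fL; have [_ /negP[]] := nc b d (ltn_trans bc cd) fL.
  by rewrite ab bc cd.
have [e3 e4] := pair _ _ _ _ pq (ltn_trans bc cd) e1; subst p q.
rewrite e2 in fL; have [/negP[]] := nc a c (ltn_trans ab bc) fL.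
by rewrite ab bc cd.
Qed.

Lemma ordS_val p : (p.+1 < k)%N -> val (ordS p) = p.+1.
Proof. by move=> pk; rewrite /= modn_small. Qed.

Lemma boundary_succ p q : val q = p.+1 -> [set p; q] \in lam.
Proof.
have [_ bd _ _] := lamP; move=> qE; have := bd p.
by rewrite /boundary_edge (_ : ordS p = q) //; apply: val_inj; rewrite ordS_val -?qE //; apply: ltn_ord.
Qed.

Lemma apex p q : (p.+1 < q)%N -> [set p; q] \in lam ->
  exists r, [/\ (p < r)%N, (r < q)%N, [set p; r] \in lam & [set r; q] \in lam].
Proof.
move=> pq pqL; have pk : (p.+1 < k)%N := ltn_trans pq (ltn_ord q).
(* Take the farthest neighbour [r] of [p] before [q]; the boundary edge at [p] provides one. An edge
   crossing {r, q} would cross {p, r} or {p, q}, or give [p] a farther neighbour. *)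
pose P (i : 'I_k) := [&& p < i, i < q & [set p; i] \in lam]%N.
have P0 : P (ordS p).
  by rewrite /P ordS_val // ltnSn pq boundary_succ // ordS_val.
case: (arg_maxnP (fun i : 'I_k => val i) P0) => r /and3P[pr rq prL] mx.
exists r; split=> //; apply: edge_maximal => // u v uv uvL; split; apply/negP => /and3P[].
  move=> ur rv vq; case: (ltngtP u p) => up.
  - by apply: (edge_noncross uvL pqL up) => //; apply: ltn_trans rv.
  - by apply: (edge_noncross prL uvL up).
  have {up} up : u = p by apply: val_inj.
  have /mx /= : P v by rewrite /P vq -up uvL andbT uv.
  by rewrite leqNgt rv.
by move=> ru uq qv; apply: (edge_noncross pqL uvL _ uq qv); apply: ltn_trans ru.
Qed.

Section Apex.
Variables p q r : 'I_k.
Hypotheses (pr : (p < r)%N) (rq : (r < q)%N).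
Hypotheses (prL : [set p; r] \in lam) (rqL : [set r; q] \in lam).

Lemma edge_sides u v : [set u; v] \in lam -> (p <= u)%N -> (u < v)%N -> (v <= q)%N ->
  [\/ (v <= r)%N, (r <= u)%N | u = p /\ v = q].
Proof.
move=> uvL pu uv vq; case: (leqP v r) => [|rv]; first by constructor 1.
case: (leqP r u) => [|ur]; first by constructor 2.
case: (ltngtP p u) pu => // [pu _|/val_inj pu _].
  by case: (edge_noncross prL uvL pu ur rv).
case: (ltngtP v q) vq => // [vq _|/val_inj vq _]; last by constructor 3.
by rewrite -pu in uvL; case: (edge_noncross uvL rqL pr rv vq).
Qed.

Lemma apex_unique r' : (p < r')%N -> (r' < q)%N ->
  [set p; r'] \in lam -> [set r'; q] \in lam -> r' = r.
Proof.
move=> pr' r'q pr'L r'qL; case: (ltngtP r' r) => [lt|lt|/val_inj//].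
  by case: (edge_noncross prL r'qL pr' lt rq).
by case: (edge_noncross pr'L rqL pr lt r'q).
Qed.

End Apex.
End Triangulations.

Lemma div3_nat (z : int) :
  reflect (exists r : nat, z = (3 * r)%N%:Z) ((z%:~R / 3%:R : rat) \is a Num.nat).
Proof.
apply: (iffP idP) => [/natrP[r rE]|[r ->]].
  exists r; apply: (@intr_inj rat).
  by rewrite -pmulrn natrM mulrC -rE divfK ?pnatr_eq0.
by rewrite -pmulrn natrM mulrAC divff ?pnatr_eq0 // mul1r natr_nat.
Qed.

(* The nine rhombus numbers of a triangle are alpha_i := r_{i1} together with
   r_{i2} = m_{i+2} - alpha_{i+1} and r_{i3} = n_{i+1} - alpha_{i+2}, where
   (n_j, m_j) is the weight read on edge j; the parameters of lr_seq are
   (beta, gamma, delta) = (r_32, r_33, r_31). *)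
Lemma rhombus_lr (l m : nat * nat) (X Y a : int) :
  let A11 := (2 * l.1 + l.2)%N%:Z in let A12 := (l.1 + 2 * l.2)%N%:Z in
  let A21 := (2 * m.1 + m.2)%N%:Z in let A22 := (m.1 + 2 * m.2)%N%:Z in
  let nn (z : int) := (exists r : nat, z = (3 * r)%N%:Z) in
  [/\ nn (A22 + X - a), nn (a + Y - A11 - X) & nn (A21 + a - A12 - A22)] /\
  [/\ nn (Y + A11 - a), nn (a + A12 - A21 - A11) & nn (X + a - A22 - Y)] /\
  [/\ nn (A12 + A21 - a), nn (a + A22 - X - A21) & nn (A11 + a - Y - A12)] <->
  exists t, [/\ t \in lr_seq l m,
    Y = (2 * (lr_weight l m t).1 + (lr_weight l m t).2)%N,
    X = ((lr_weight l m t).1 + 2 * (lr_weight l m t).2)%N &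
    a = A12 + A21 - (3 * t.2)%N%:Z].
Proof.
case: l m => [n1 m1] [n2 m2] /=; split.
  case=> -[[r11 e11] [r12 e12] [r13 e13]] [[[r21 e21] [r22 e22] [r23 e23]]].
  case=> [[r31 e31] [r32 e32] [r33 e33]].
  by exists (r32, r33, r31); rewrite mem_lr_seq /lr_ok /=; split; lia.
case=> -[[b g] d]; rewrite mem_lr_seq /lr_ok /= => -[ok -> -> ->].
split; [|split].
- split; [exists (m2 - b)%N | exists (n1 + n2 + b - 2 * g - d - (n1 - g))%N | exists (n2 - d)%N]; lia.
- split; [exists (n1 - g)%N | exists (m1 - d)%N | exists (m1 + m2 + g - 2 * b - d - (m2 - b))%N]; lia.
- split; [exists d | exists b | exists g]; lia.
Qed.

(** * Cone points of the part cut off by an edge *)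

Section Cone.
Variables (k : nat) (lam : {set {set 'I_k}}).
Hypothesis lamP : ideal_triangulation lam.
Variable S : strand_set k.
Implicit Types (p q r u v : 'I_k) (c : coords lam).

Definition tri_nat c (t : triangle_dot lam) : bool :=
  [forall i : 'I_3, [&& rhombus1 c t i \is a Num.nat, rhombus2 c t i \is a Num.nat
      & rhombus3 c t i \is a Num.nat]].

Lemma tri_natE c t : tri_nat c t <->
  let nn (z : int) := (exists r : nat, z = (3 * r)%N%:Z) in
  let x := (val t).1.1 in let y := (val t).1.2 in let z := (val t).2 in
  let ev := edge_value c in let a := c (inr t) in
  [/\ nn (ev z y + ev z x - a), nn (a + ev x z - ev x y - ev z x)
    & nn (ev y z + a - ev y x - ev z y)] /\
  [/\ nn (ev x z + ev x y - a), nn (a + ev y x - ev y z - ev x y)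
    & nn (ev z x + a - ev z y - ev x z)] /\
  [/\ nn (ev y x + ev y z - a), nn (a + ev z y - ev z x - ev y z)
    & nn (ev x y + a - ev x z - ev y x)].
Proof.
have i01 : o0 + 1 = o1 by apply: val_inj.
have i02 : o0 + 2%:R = o2 by apply: val_inj.
have i11 : o1 + 1 = o2 by apply: val_inj.
have i12 : o1 + 2%:R = o0 by apply: val_inj.
have i21 : o2 + 1 = o0 by apply: val_inj.
have i22 : o2 + 2%:R = o1 by apply: val_inj.
have E (P : pred 'I_3) : [forall i, P i] <-> P o0 /\ P o1 /\ P o2.
  by split=> [/forallP h|[h0 [h1 h2]]]; [|apply/forallP; elim/ord3P].
rewrite /tri_nat; split.
  case/E => /and3P[/div3_nat h1 /div3_nat h2 /div3_nat h3].
  case=> /and3P[/div3_nat h4 /div3_nat h5 /div3_nat h6].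
  move=> /and3P[/div3_nat h7 /div3_nat h8 /div3_nat h9].
  move: h1 h2 h3 h4 h5 h6 h7 h8 h9.
  rewrite /a1 /a2 /a0 /left_value /right_value ?(i01, i02, i11, i12, i21, i22).
  by [].
move=> /= -[[h1 h2 h3] [[h4 h5 h6] [h7 h8 h9]]]; apply/E.
split; [|split]; apply/and3P; split; apply/div3_nat;
  by rewrite /a1 /a2 /a0 /left_value /right_value ?(i01, i02, i11, i12, i21, i22).
Qed.

Definition lowest (d : dot lam) : nat :=
  match d with inl e => minn (val e).1 (val e).2 | inr t => (val t).1.1 end.
Definition highest (d : dot lam) : nat :=
  match d with inl e => maxn (val e).1 (val e).2 | inr t => (val t).2 end.
Definition inside p q (d : dot lam) : bool := (p <= lowest d)%N && (highest d <= q)%N.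

(* The cone points of the part of the triangulated polygon cut off by the edge
   {p, q} and lying clockwise from p to q, extended by 0. *)
Definition conf p q c : Prop :=
  [/\ forall d, ~~ inside p q d -> c d = 0,
      forall t : triangle_dot lam, inside p q (inr t) -> tri_nat c t
    & forall E : 'I_k, (p <= E)%N -> (E < q)%N ->
        edge_value c E (ordS E) = (2 * n_in S E + n_out S E)%N /\
        edge_value c (ordS E) E = (n_in S E + 2 * n_out S E)%N].

(* The weight (n, m) of strands entering the adjacent triangle through {p, q}. *)
Definition has_type c p q (w : nat * nat) : Prop :=
  edge_value c p q = (2 * w.1 + w.2)%N /\ edge_value c q p = (w.1 + 2 * w.2)%N.

(** Solves the system of [has_type], whose determinant is 3. Absolute value and integer division
    only make the function total; the result is meaningful where [etypeP] applies. *)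
Definition etype c p q : nat * nat :=
  (absz (2 * edge_value c p q - edge_value c q p)%R %/ 3,
   absz (2 * edge_value c q p - edge_value c p q)%R %/ 3)%N.

Lemma etypeP c p q w : has_type c p q w -> etype c p q = w.
Proof.
case: w => a b [/= e1 e2]; rewrite /etype e1 e2; congr (_, _).
  rewrite (_ : _ - _ = (a * 3)%N%:Z); last by lia.
  by rewrite absz_nat mulnK.
rewrite (_ : _ - _ = (b * 3)%N%:Z); last by lia.
by rewrite absz_nat mulnK.
Qed.

Lemma edge_value_dot c (e : edge_dot lam) : edge_value c (val e).1 (val e).2 = c (inl e).
Proof.
rewrite /edge_value -surjective_pairing valK //.
Qed.

Lemma edge_value_insub c u v : [set u; v] \in lam ->
  exists2 e : edge_dot lam, val e = (u, v) & edge_value c u v = c (inl e).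
Proof.
move=> uvL; exists (Sub (u, v) uvL); first by rewrite SubK.
by rewrite /edge_value insubT.
Qed.

Lemma edge_value_congr c c' p q u v :
  (forall d, inside p q d -> c d = c' d) ->
  (p <= u <= q)%N -> (p <= v <= q)%N -> edge_value c u v = edge_value c' u v.
Proof.
move=> cc' /andP[pu uq] /andP[pv vq]; rewrite /edge_value; case: insubP => // e _ eE.
by apply: cc'; rewrite /inside /lowest /highest eE /= leq_min pu pv geq_max uq vq.
Qed.

Lemma triangle_lt (t : triangle_dot lam) :
  [/\ ((val t).1.1 < (val t).1.2)%N, ((val t).1.2 < (val t).2)%N,
      [set (val t).1.1; (val t).1.2] \in lam, [set (val t).1.2; (val t).2] \in lam
    & [set (val t).1.1; (val t).2] \in lam].
Proof.
have := valP t; rewrite inE => /and5P[h1 h2 h3 h4 h5]; split=> //.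
by rewrite setUC.
Qed.

Lemma tri_nat_congr c c' p q (t : triangle_dot lam) :
  (forall d, inside p q d -> c d = c' d) -> inside p q (inr t) ->
  tri_nat c t -> tri_nat c' t.
Proof.
move=> cc' tin; have [xy yz _ _ _] := triangle_lt t.
have /andP[/= px zq] := tin.
move=> /tri_natE h; apply/tri_natE; move: h; rewrite /= (cc' _ tin).
by rewrite !(@edge_value_congr c c' p q) ?px ?zq //=;
  rewrite ?(leq_trans px (ltnW xy)) ?(leq_trans (ltnW yz) zq) ?(leq_trans px (ltnW (ltn_trans xy yz)))
     ?(leq_trans (ltnW (ltn_trans xy yz)) zq).
Qed.

Definition restr p q c : coords lam := [ffun d => if inside p q d then c d else 0].

Lemma restr_inside p q c d : inside p q d -> restr p q c d = c d.
Proof. by rewrite ffunE => ->. Qed.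

Section Base.
Variables p q : 'I_k.
Hypothesis qE : q = p.+1 :> nat.

(** When p and q are consecutive, the part cut off is a single boundary edge without triangle, and
    all its values are forced. *)
Definition base_value (d : dot lam) : int :=
  match d with
  | inl e => if val e == (p, q) then (2 * n_in S p + n_out S p)%N%:Z
             else if val e == (q, p) then (n_in S p + 2 * n_out S p)%N%:Z else 0
  | inr _ => 0
  end.

Definition base_conf : coords lam := [ffun d => base_value d].

Lemma ordSp : ordS p = q.
Proof. by apply: val_inj; rewrite ordS_val -?qE //; apply: ltn_ord. Qed.

Lemma base_edge_value : edge_value base_conf p q = (2 * n_in S p + n_out S p)%N /\
  edge_value base_conf q p = (n_in S p + 2 * n_out S p)%N.
Proof.
have pqL := boundary_succ lamP qE; have qpL : [set q; p] \in lam by rewrite setUC.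
have [e eE ->] := edge_value_insub base_conf pqL.
have [e' eE' ->] := edge_value_insub base_conf qpL.
have pq : p == q = false by rewrite -(inj_eq val_inj) [X in _ == X]qE ltn_eqF.
by rewrite !ffunE /base_value eE eE' !eqxx xpair_eqE eq_sym pq.
Qed.

Lemma base_confP c : conf p q c <-> c = base_conf.
Proof.
have [v1 v2] := base_edge_value.
have noT (t : triangle_dot lam) : inside p q (inr t) = false.
  have [xy yz _ _ _] := triangle_lt t; apply/negP => /andP[px zq].
  by have := leq_trans (leq_ltn_trans (leq_ltn_trans px xy) yz) zq; rewrite qE ltnn.
split=> [[supp _ bd]|->].
  have [b1 b2] := bd p (leqnn _) (eq_leq (esym qE)); rewrite ordSp in b1 b2.
  apply/ffunP => -[e|t]; last by rewrite ffunE supp ?noT.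
  rewrite ffunE /base_value; case: eqP => [eE|ne1].
    by rewrite -edge_value_dot eE.
  case: eqP => [eE|ne2]; first by rewrite -edge_value_dot eE.
  apply: supp; apply/negP => /andP[]; rewrite /lowest /highest leq_min geq_max qE => /andP[h1 h2] /andP[h3 h4].
  have := edge_neq lamP (valP e); case: (val e) ne1 ne2 h1 h2 h3 h4 => u v /= ne1 ne2 h1 h2 h3 h4.
  rewrite -(inj_eq val_inj) /= => uv; case: (ltngtP u v) uv => // uv _.
    by case: ne1; congr (_, _); apply: val_inj; rewrite /= ?qE; lia.
  by case: ne2; congr (_, _); apply: val_inj; rewrite /= ?qE; lia.
split.
- move=> [e|t] nin; last by rewrite ffunE.
  rewrite ffunE /base_value; case: eqP => [eE|_].
    by move: nin; rewrite /inside /= eE /= qE; lia.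
  by case: eqP => // eE; move: nin; rewrite /inside /= eE /= qE; lia.
- by move=> t; rewrite noT.
move=> E pE Eq; have -> : E = p by apply: val_inj; rewrite /=; move: Eq; rewrite qE; lia.
by rewrite ordSp.
Qed.

End Base.

End Cone.

(** * Gluing two parts along the triangle between them *)

Section Gluing.
Variables (k : nat) (lam : {set {set 'I_k}}).
Hypothesis lamP : ideal_triangulation lam.
Variable S : strand_set k.
Implicit Types (c : coords lam).
Local Notation conf := (@conf k lam S).

Section Glue.
Variables p q r : 'I_k.
Hypotheses (pr : (p < r)%N) (rq : (r < q)%N) (pqL : [set p; q] \in lam).
Hypotheses (prL : [set p; r] \in lam) (rqL : [set r; q] \in lam).

Let l c := etype c p r.
Let m c := etype c r q.

(** The value at the triangle dot comes from solving r_31 = t.2. *)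
Definition glue_value (l m : nat * nat) (t : nat * nat * nat) (d : dot lam) : int :=
  let w := lr_weight l m t in
  match d with
  | inl e => if val e == (p, q) then (2 * w.1 + w.2)%N%:Z
             else if val e == (q, p) then (w.1 + 2 * w.2)%N%:Z else 0
  | inr T => if val T == (p, r, q)
             then (l.1 + 2 * l.2)%N%:Z + (2 * m.1 + m.2)%N%:Z - (3 * t.2)%N%:Z else 0
  end.

Definition glue c1 c2 (t : nat * nat * nat) : coords lam :=
  [ffun d => if inside p r d then c1 d else if inside r q d then c2 d
             else glue_value (l c1) (m c2) t d].

Lemma apex_triangle : exists T : triangle_dot lam, val T = (p, r, q).
Proof.
have tT : (p, r, q) \in triangles lam.
  by rewrite inE /= pr rq prL rqL setUC pqL.
by exists (Sub (p, r, q) tT); rewrite SubK.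
Qed.

Lemma dot_cases (d : dot lam) : inside p q d -> [\/ inside p r d, inside r q d |
  match d with inl e => val e = (p, q) \/ val e = (q, p) | inr T => val T = (p, r, q) end].
Proof.
case: d => [e|T] /andP[].
  have := edge_neq lamP (valP e); rewrite /inside /lowest /highest.
  have := valP e; case: (val e) => u v /=.
  rewrite !leq_min !geq_max => uvL; rewrite -(inj_eq val_inj) neq_ltn.
  case/orP => uv /andP[pu pv] /andP[uq vq].
    case: (edge_sides lamP pr prL rqL uvL pu uv vq) => [vr|ru|[-> ->]].
    - by constructor 1; rewrite pu pv vr (ltnW (leq_trans uv vr)).
    - by constructor 2; rewrite uq vq ru (ltnW (leq_ltn_trans ru uv)).
    - by constructor 3; left.
  rewrite setUC in uvL.
  case: (edge_sides lamP pr prL rqL uvL pv uv uq) => [vr|ru|[-> ->]].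
  - by constructor 1; rewrite pu pv vr (ltnW (leq_trans uv vr)).
  - by constructor 2; rewrite uq vq ru (ltnW (leq_ltn_trans ru uv)).
  - by constructor 3; right.
have [xy yz xyL yzL xzL] := triangle_lt T; rewrite /inside /lowest /highest => px zq.
case: (edge_sides lamP pr prL rqL xzL px (ltn_trans xy yz) zq) => [zr|rx|[xp zp]].
- by constructor 1; rewrite px zr.
- by constructor 2; rewrite rx zq.
constructor 3; move: xy yz xyL yzL; case: (val T) xp zp => [[x y] z] /= -> -> xy yz xyL yzL.
by rewrite (apex_unique lamP pr rq prL rqL xy yz xyL yzL).
Qed.

(** The two parts have only the puncture [r] in common, and no edge or triangle fits in it. *)
Lemma inside_disjoint (d : dot lam) : inside p r d -> inside r q d -> False.
Proof.
case: d => [e|T] /andP[] lo1 hi1 /andP[lo2 hi2].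
  have := edge_neq lamP (valP e); move: lo1 hi1 lo2 hi2; rewrite /lowest /highest.
  case: (val e) => u v /=; rewrite !leq_min !geq_max => _ /andP[ur vr] /andP[ru rv] _.
  rewrite -(inj_eq val_inj) /= eqn_leq.
  by rewrite (leq_trans ur rv) (leq_trans vr ru).
have [xy yz _ _ _] := triangle_lt T; move: hi1 lo2; rewrite /lowest /highest => zr rx.
by have := leq_trans (ltn_trans xy yz) (leq_trans zr rx); rewrite ltnn.
Qed.

Lemma inside_widen (d : dot lam) : inside p r d || inside r q d -> inside p q d.
Proof.
case/orP => /andP[lo hi]; apply/andP; split=> //.
  exact: leq_trans hi (ltnW rq).
exact: leq_trans (ltnW pr) lo.
Qed.

Lemma new_edge_outside (e : edge_dot lam) : val e = (p, q) \/ val e = (q, p) ->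
  inside p r (inl e) = false /\ inside r q (inl e) = false.
Proof.
by rewrite /inside /lowest /highest => -[] -> /=; split; apply/negP; lia.
Qed.

Lemma new_triangle_outside (T : triangle_dot lam) : val T = (p, r, q) ->
  inside p r (inr T) = false /\ inside r q (inr T) = false.
Proof.
rewrite /inside /lowest /highest => -> /=.
by rewrite [(q <= r)%N]leqNgt rq [(r <= p)%N]leqNgt pr andbF.
Qed.

Lemma glue_left c1 c2 t d : inside p r d -> glue c1 c2 t d = c1 d.
Proof. by rewrite ffunE => ->. Qed.

Lemma glue_right c1 c2 t d : inside r q d -> glue c1 c2 t d = c2 d.
Proof.
move=> ins; rewrite ffunE ins; case: ifP => // ins'.
by case: (inside_disjoint ins' ins).
Qed.

Lemma glue_type c1 c2 t : has_type (glue c1 c2 t) p q (lr_weight (l c1) (m c2) t).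
Proof.
have qpL : [set q; p] \in lam by rewrite setUC.
have pq : p == q = false.
  by rewrite -(inj_eq val_inj) ltn_eqF // (ltn_trans pr rq).
have [e eE Ee] := edge_value_insub (glue c1 c2 t) pqL.
have [e' eE' Ee'] := edge_value_insub (glue c1 c2 t) qpL.
have [i1 i2] := new_edge_outside (or_introl eE).
have [i1' i2'] := new_edge_outside (or_intror eE').
split; first by rewrite Ee ffunE i1 i2 /glue_value eE eqxx.
by rewrite Ee' ffunE i1' i2' /glue_value eE' xpair_eqE eq_sym pq eqxx.
Qed.

Lemma glue_triangle c1 c2 t (T : triangle_dot lam) : val T = (p, r, q) ->
  glue c1 c2 t (inr T) =
  ((l c1).1 + 2 * (l c1).2)%N%:Z + (2 * (m c2).1 + (m c2).2)%N%:Z - (3 * t.2)%N%:Z.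
Proof.
move=> TE; have [i1 i2] := new_triangle_outside TE.
by rewrite ffunE i1 i2 /glue_value TE eqxx.
Qed.

Lemma glue_edge_left c1 c2 t (u v : 'I_k) : (p <= u <= r)%N -> (p <= v <= r)%N ->
  edge_value (glue c1 c2 t) u v = edge_value c1 u v.
Proof. by apply: edge_value_congr => d; apply: glue_left. Qed.

Lemma glue_edge_right c1 c2 t (u v : 'I_k) : (r <= u <= q)%N -> (r <= v <= q)%N ->
  edge_value (glue c1 c2 t) u v = edge_value c2 u v.
Proof. by apply: edge_value_congr => d; apply: glue_right. Qed.

Lemma tri_nat_apex c (T : triangle_dot lam) l' m' : val T = (p, r, q) ->
  has_type c p r l' -> has_type c r q m' ->
  tri_nat c T <-> exists t, [/\ t \in lr_seq l' m', has_type c p q (lr_weight l' m' t) &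
    c (inr T) = (l'.1 + 2 * l'.2)%N%:Z + (2 * m'.1 + m'.2)%N%:Z - (3 * t.2)%N%:Z].
Proof.
move=> TE [h1 h2] [h3 h4].
have := rhombus_lr l' m' (edge_value c q p) (edge_value c p q) (c (inr T)).
have := tri_natE c T; rewrite TE /= h1 h2 h3 h4 => -> ->.
by split=> -[t [H1 H2 H3]]; exists t; [split|case: H2; split].
Qed.

Lemma conf_glue c1 c2 t : has_type c1 p r (l c1) -> has_type c2 r q (m c2) ->
  conf p r c1 -> conf r q c2 -> t \in lr_seq (l c1) (m c2) -> conf p q (glue c1 c2 t).
Proof.
move=> ht1 ht2 [supp1 tri1 bd1] [supp2 tri2 bd2] tL; split.
- move=> d nin; rewrite ffunE.
  case: ifP => [i1|_]; first by case/negP: nin; apply: inside_widen; rewrite i1.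
  case: ifP => [i1|_]; first by case/negP: nin; apply: inside_widen; rewrite i1 orbT.
  have pq := ltnW (ltn_trans pr rq).
  case: d nin => [e|T] nin; rewrite /glue_value.
    case: eqP => eE.
      by case/negP: nin; rewrite /inside /lowest /highest eE /= leq_min geq_max leqnn pq leqnn.
    case: eqP => // eE'.
    by case/negP: nin; rewrite /inside /lowest /highest eE' /= leq_min geq_max leqnn pq leqnn.
  case: eqP => // TE; case/negP: nin.
  by rewrite /inside /lowest /highest TE /= !leqnn.
- move=> T /dot_cases[Tin|Tin|TE].
  + by apply: (tri_nat_congr _ Tin (tri1 _ Tin)) => d din; rewrite glue_left.
  + by apply: (tri_nat_congr _ Tin (tri2 _ Tin)) => d din; rewrite glue_right.
  apply/(@tri_nat_apex _ _ (l c1) (m c2) TE).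
  + by rewrite /has_type !glue_edge_left ?leqnn ?(ltnW pr).
  + by rewrite /has_type !glue_edge_right ?leqnn ?(ltnW rq).
  by exists t; split=> //; [apply: glue_type | apply: glue_triangle].
move=> E pE Eq; case: (ltnP E r) => [Er|rE].
  have e1 : val (ordS E) = E.+1 by rewrite ordS_val // (leq_ltn_trans Er).
  have := bd1 _ pE Er; rewrite !glue_edge_left ?e1 ?(ltnW pE) ?Er ?pE ?(ltnW Er) //.
  - by rewrite (leq_trans pE).
  - by rewrite (leq_trans pE).
have e1 : val (ordS E) = E.+1 by rewrite ordS_val // (leq_ltn_trans Eq).
have := bd2 _ rE Eq; rewrite !glue_edge_right ?e1 ?(ltnW Eq) ?Eq ?rE //.
- by rewrite (leq_trans rE).
- by rewrite (leq_trans rE).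
Qed.

(** The two assumptions are supplied by the induction: they make the values on the inner sides
    genuine types, as [tri_nat_apex] requires. *)
Lemma conf_split c :
  (forall c1, conf p r c1 -> has_type c1 p r (l c1)) ->
  (forall c2, conf r q c2 -> has_type c2 r q (m c2)) ->
  conf p q c -> exists c1 c2 t,
    [/\ conf p r c1, conf r q c2, t \in lr_seq (l c1) (m c2) & c = glue c1 c2 t].
Proof.
move=> ht1 ht2 [supp tri bd].
pose c1 := restr p r c; pose c2 := restr r q c.
have C1 d : inside p r d -> c d = c1 d by move=> din; rewrite restr_inside.
have C2 d : inside r q d -> c d = c2 d by move=> din; rewrite restr_inside.
have conf1 : conf p r c1.
  split.
  - by move=> d /negPf nin; rewrite ffunE nin.
  - move=> T Tin; apply: (tri_nat_congr C1 Tin); apply: tri.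
    by apply: inside_widen; rewrite Tin.
  move=> E pE Er; have [b1 b2] := bd E pE (ltn_trans Er rq).
  have e1 : val (ordS E) = E.+1 by rewrite ordS_val // (leq_ltn_trans Er).
  rewrite -!(edge_value_congr C1) ?b1 ?b2 ?e1 ?pE ?(ltnW Er) ?Er ?andbT //.
  - exact: leq_trans pE (leqnSn _).
  - exact: leq_trans pE (leqnSn _).
have conf2 : conf r q c2.
  split.
  - by move=> d /negPf nin; rewrite ffunE nin.
  - move=> T Tin; apply: (tri_nat_congr C2 Tin); apply: tri.
    by apply: inside_widen; rewrite Tin orbT.
  move=> E rE Eq; have [b1 b2] := bd E (leq_trans (ltnW pr) rE) Eq.
  have e1 : val (ordS E) = E.+1 by rewrite ordS_val // (leq_ltn_trans Eq).
  rewrite -!(edge_value_congr C2) ?b1 ?b2 ?e1 ?rE ?(ltnW Eq) ?Eq ?andbT //.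
  - exact: leq_trans rE (leqnSn _).
  - exact: leq_trans rE (leqnSn _).
have [T TE] := apex_triangle.
have h1 : has_type c p r (l c1).
  have := ht1 _ conf1; rewrite /has_type !(edge_value_congr C1) ?leqnn ?(ltnW pr) //.
have h2 : has_type c r q (m c2).
  have := ht2 _ conf2; rewrite /has_type !(edge_value_congr C2) ?leqnn ?(ltnW rq) //.
have Tin : inside p q (inr T) by rewrite /inside /lowest /highest TE /= !leqnn.
have [t [tL [wt1 wt2] at_]] := (tri_nat_apex TE h1 h2).1 (tri _ Tin).
exists c1, c2, t; split=> //; apply/ffunP => d.
case: (boolP (inside p q d)) => [/dot_cases[din|din|]|nin].
- by rewrite glue_left // C1.
- by rewrite glue_right // C2.
- have [g1 g2] := glue_type c1 c2 t.
  case: d => [e [eE|eE]|T' T'E].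
  + by have := g1; have := wt1; rewrite -!(edge_value_dot _ e) eE => -> ->.
  + by have := g2; have := wt2; rewrite -!(edge_value_dot _ e) eE => -> ->.
  have -> : T' = T by apply: val_inj; rewrite T'E TE.
  by rewrite at_ glue_triangle.
rewrite supp // ffunE.
have /norP[/negPf -> /negPf ->] : ~~ (inside p r d || inside r q d).
  by apply: contra nin; apply: inside_widen.
case: d nin => [e|T'] nin; rewrite /glue_value.
  have pq := ltnW (ltn_trans pr rq).
  case: eqP => eE.
    by case/negP: nin; rewrite /inside /lowest /highest eE /= leq_min geq_max leqnn pq leqnn.
  case: eqP => // eE'.
  by case/negP: nin; rewrite /inside /lowest /highest eE' /= leq_min geq_max leqnn pq leqnn.
case: eqP => // TE'; case/negP: nin.
by rewrite /inside /lowest /highest TE' /= !leqnn.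
Qed.

Lemma glue_inj c1 c2 t c1' c2' t' :
  conf p r c1 -> conf r q c2 -> conf p r c1' -> conf r q c2' ->
  t \in lr_seq (l c1) (m c2) -> t' \in lr_seq (l c1') (m c2') ->
  glue c1 c2 t = glue c1' c2' t' -> [/\ c1 = c1', c2 = c2' & t = t'].
Proof.
move=> [s1 _ _] [s2 _ _] [s1' _ _] [s2' _ _] tL tL' E.
have E1 : c1 = c1'.
  apply/ffunP => d; case: (boolP (inside p r d)) => din; last by rewrite s1 // s1'.
  by rewrite -(glue_left c1 c2 t din) E glue_left.
have E2 : c2 = c2'.
  apply/ffunP => d; case: (boolP (inside r q d)) => din; last by rewrite s2 // s2'.
  by rewrite -(glue_right c1 c2 t din) E glue_right.
split=> //; rewrite -E1 -E2 in tL' E.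
have [T TE] := apex_triangle.
(* The triangle dot determines [d]; the weight on {p, q} then determines b - 2 g and g - 2 b, hence
   [b] and [g]. *)
have := glue_triangle c1 c2 t TE; rewrite E glue_triangle //.
have := etypeP (glue_type c1 c2 t); rewrite E (etypeP (glue_type c1 c2 t')).
move: tL tL'; rewrite !mem_lr_seq; move: (l c1) (m c2) => [n1 m1] [n2 m2].
case: t t' {E} => [[b g] d] [[b' g'] d'] /= ok ok' [w1 w2] w3.
by congr (_, _, _); lia.
Qed.

End Glue.

Lemma conf_sum (p q : 'I_k) : (p < q)%N -> [set p; q] \in lam ->
  exists s : seq (coords lam), [/\ uniq s, forall c, c \in s <-> conf p q c,
    forall c, conf p q c -> has_type c p q (etype c p q)
  & forall (A : comNzRingType) (x y : A), \sum_(c <- s) chiw x y (etype c p q) =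
      \prod_(E : 'I_k | (p <= E < q)%N) chiw x y (n_in S E, n_out S E)].
Proof.
have [N] := ubnP (q - p)%N; elim: N p q => // N IH p q le_N pq pqL.
have [pq1|pq1] := ltnP p.+1 q; last first.
  have qE : q = p.+1 :> nat by apply/eqP; rewrite eqn_leq pq1 pq.
  have ht : has_type (base_conf lam S p q) p q (n_in S p, n_out S p).
    exact: (base_edge_value lamP S qE).
  exists [:: base_conf lam S p q]; split=> // [c|c|A x y].
  - by rewrite inE; split=> [/eqP ->|/(base_confP lamP S qE) ->]; [apply/(base_confP lamP S qE)|rewrite eqxx].
  - by move=> /(base_confP lamP S qE) ->; rewrite (etypeP ht).
  rewrite big_seq1 (etypeP ht) (big_pred1 p) // => E.
  by rewrite qE ltnS -eqn_leq eq_sym.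
have [r [pr rq prL rqL]] := apex lamP pq1 pqL.
have [|s1 [u1 mem1 ht1 sum1]] := IH p r _ pr prL; first by lia.
have [|s2 [u2 mem2 ht2 sum2]] := IH r q _ rq rqL; first by lia.
pose G (x : coords lam * coords lam) t := glue p q r x.1 x.2 t.
pose ss := [seq (c1, c2) | c1 <- s1, c2 <- s2].
pose T (x : coords lam * coords lam) := lr_seq (etype x.1 p r) (etype x.2 r q).
pose s := [seq G x t | x <- ss, t <- T x].
have ssP x : x \in ss -> conf p r x.1 /\ conf r q x.2.
  by case/allpairsP => -[c1 c2] [/mem1 h1 /mem2 h2 ->].
have sP c : c \in s <-> conf p q c.
  split=> [/allpairsPdep[x [t [/ssP[h1 h2] tL ->]]]|cc].
    by apply: conf_glue => //; [apply: ht1 | apply: ht2].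
  have [c1 [c2 [t [h1 h2 tL ->]]]] := conf_split pr rq pqL prL rqL ht1 ht2 cc.
  apply/allpairsPdep; exists (c1, c2), t; split=> //.
  by apply: allpairs_f; [apply/mem1 | apply/mem2].
exists s; split=> //.
- apply: allpairs_uniq_dep.
  + by apply: allpairs_uniq => // -[? ?] [? ?].
  + by move=> x _; apply: lr_seq_uniq.
  move=> _ _ /allpairsPdep[x [t [xs tL ->]]] /allpairsPdep[x' [t' [xs' tL' ->]]] /= E.
  have [h1 h2] := ssP _ xs; have [h1' h2'] := ssP _ xs'.
  have [e1 e2 ->] := glue_inj pr rq pqL prL rqL h1 h2 h1' h2' tL tL' E.
  by rewrite (surjective_pairing x) (surjective_pairing x') e1 e2.
- move=> c /sP/allpairsPdep[x [t [_ _ ->]]].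
  have h := glue_type pr rq pqL prL rqL x.1 x.2 t.
  by rewrite /G (etypeP h).
move=> A x y; rewrite big_allpairs_dep /=.
transitivity (\sum_(c1 <- s1) \sum_(c2 <- s2) chiw x y (etype c1 p r) * chiw x y (etype c2 r q)).
  rewrite big_allpairs; apply: eq_bigr => c1 _; apply: eq_bigr => c2 _.
  rewrite chi_product; apply: eq_bigr => t _.
  by rewrite (etypeP (glue_type pr rq pqL prL rqL c1 c2 t)).
rewrite -big_distrlr /= sum1 sum2.
rewrite [RHS](bigID (fun E : 'I_k => (E < r)%N)) /=; congr (_ * _); apply: eq_bigl => E.
  by case: (ltnP E r) => Er; rewrite ?andbF ?andbT // (ltn_trans Er rq) andbT.
by rewrite -leqNgt; case: (leqP r E) => rE; rewrite ?andbF ?andbT //= (leq_trans (ltnW pr) rE).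
Qed.

End Gluing.

(** Roots of T^3 - x T^2 + y T - 1. This extends the trace identities from the torus to all x and y,
    as [chi_count] demands. *)
Lemma torus_surjective (C : numClosedFieldType) (x y : C) : exists a b c,
  [/\ a * b * c = 1, a + b + c = x & a * b + a * c + b * c = y].
Proof.
pose p := Poly [:: -1; y; - x; 1].
have sz : size p = 4%N by rewrite (@PolyK _ 0) //= oner_neq0.
have lp : lead_coef p = 1 by rewrite lead_coefE sz coef_Poly.
have [r pE] := closed_field_poly_normal p; rewrite lp scale1r in pE.
have szr : size r = 3%N by move: sz; rewrite pE size_prod_XsubC => -[].
case: r pE szr => [|a [|b [|c [|]]]] // pE _.
have E : p = 'X^3 - (a + b + c)%:P * 'X^2 + (a * b + a * c + b * c)%:P * 'X - (a * b * c)%:P.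
  by rewrite pE !big_cons big_nil !rmorphD !rmorphM /=; ring.
have cE i := congr1 (fun q : {poly C} => q`_i) E.
move: (cE 0%N) (cE 1%N) (cE 2%N).
rewrite !coef_Poly !(coefB, coefD, coefCM, coefC, coefXn, coefX) /=.
rewrite !(mulr0, mulr1, subr0, sub0r, addr0, add0r, oppr0) => e0 e1 e2.
by exists a, b, c; split=> //; apply: oppr_inj.
Qed.

(** Combinatorial Schur lemma: the zero weight appears only against the dual of [l], and there only
    for the triple (l.1, l.1, l.2). *)
Lemma count_lr_weight0 l m :
  count_mem (0, 0)%N [seq lr_weight l m t | t <- lr_seq l m] = (m == (l.2, l.1)).
Proof.
rewrite count_map; case: l m => [n1 m1] [n2 m2].
rewrite [in RHS]xpair_eqE -[(n1, m1).2]/m1 -[(n1, m1).1]/n1.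
have [/andP[/eqP -> /eqP ->]|ne] := boolP ((n2 == m1) && (m2 == n1)).
  have -> : count (preim (lr_weight (n1, m1) (m1, n1)) (pred1 (0, 0)%N)) (lr_seq (n1, m1) (m1, n1))
      = count_mem (n1, n1, m1) (lr_seq (n1, m1) (m1, n1)).
    apply: eq_in_count => -[[b g] d]; rewrite mem_lr_seq /lr_ok /= !xpair_eqE => ok.
    by apply/idP/idP; lia.
  rewrite (count_uniq_mem _ (lr_seq_uniq _ _)) mem_lr_seq /lr_ok /=.
  by rewrite !leqnn [(m1 + n1)%N]addnC leqnn.
apply/eqP; rewrite -leqn0 leqNgt -has_count; apply/hasPn => -[[b g] d].
rewrite mem_lr_seq /lr_ok /= !xpair_eqE => ok; apply: contra ne.
by lia.
Qed.

(** * The whole polygon and its last edge *)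

Section Polygon.
Variables (k : nat) (lam : {set {set 'I_k}}).
Hypotheses (k_ge3 : (3 <= k)%N) (lamP : ideal_triangulation lam).
Implicit Types (c : coords lam).

Lemma first_lt : (0 < k)%N. Proof. exact: leq_trans k_ge3. Qed.
Lemma last_lt : (k.-1 < k)%N. Proof. by rewrite ltn_predL first_lt. Qed.
Definition first_vx : 'I_k := Ordinal first_lt.
Definition last_vx : 'I_k := Ordinal last_lt.

Lemma ordS_last : ordS last_vx = first_vx.
Proof. by apply: val_inj; rewrite /= prednK ?modnn ?first_lt. Qed.

Lemma root_edge : [set first_vx; last_vx] \in lam.
Proof.
have [_ bd _ _] := lamP; have := bd last_vx.
by rewrite /boundary_edge ordS_last setUC.
Qed.

Lemma first_last : (first_vx < last_vx)%N.
Proof. by rewrite /=; have := k_ge3; lia. Qed.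

Lemma inside_all (d : dot lam) : inside first_vx last_vx d.
Proof.
apply/andP; split=> //; have le_last (v : 'I_k) : (v <= last_vx)%N.
  by rewrite /= -ltnS prednK ?ltn_ord ?first_lt.
by case: d => [e|T]; rewrite /highest ?geq_max ?le_last.
Qed.

(** Descends to the side of the apex that contains the edge, until the edge is a side of the current
    triangle. Signs of edge dots can then be read off in a triangle. *)
Lemma edge_in_triangle (p q u v : 'I_k) : (p.+1 < q)%N -> [set p; q] \in lam ->
  [set u; v] \in lam -> (p <= u)%N -> (u < v)%N -> (v <= q)%N ->
  exists x y z, (x, y, z) \in triangles lam /\
    [\/ (u, v) = (x, y), (u, v) = (y, z) | (u, v) = (x, z)].
Proof.
have [N] := ubnP (q - p)%N; elim: N p q => // N IH p q le_N pq pqL uvL pu uv vq.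
have [r [pr rq prL rqL]] := apex lamP pq pqL.
have tT : (p, r, q) \in triangles lam by rewrite inE /= pr rq prL rqL setUC pqL.
case: (edge_sides lamP pr prL rqL uvL pu uv vq) => [vr|ru|[-> ->]].
- have [pr1|pr1] := ltnP p.+1 r; first by apply: (IH p r); rewrite //; lia.
  exists p, r, q; split=> //; constructor 1.
  by congr (_, _); apply: val_inj => /=; lia.
- have [rq1|rq1] := ltnP r.+1 q; first by apply: (IH r q); rewrite //; lia.
  exists p, r, q; split=> //; constructor 2.
  by congr (_, _); apply: val_inj => /=; lia.
by exists p, r, q; split=> //; constructor 3.
Qed.

Lemma KT_coneE c : (c \in KT_cone lam) = [forall t, tri_nat c t].
Proof. by []. Qed.

Lemma KT_nonneg : {subset KT_cone lam <= nonneg_coords lam}.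
Proof.
move=> c; rewrite KT_coneE => /forallP cK.
have tri (x y z : 'I_k) : (x, y, z) \in triangles lam -> exists2 T : triangle_dot lam,
    val T = (x, y, z) & let ev := edge_value c in
    0 <= c (inr T) /\ [/\ 0 <= ev x y, 0 <= ev y x & 0 <= ev y z] /\
    [/\ 0 <= ev z y, 0 <= ev x z & 0 <= ev z x].
  move=> tT; exists (Sub (x, y, z) tT); first by rewrite SubK.
  set T := Sub _ _; have /tri_natE := cK T; rewrite /T SubK /= -/T.
  move: (edge_value c _ _) (edge_value c _ _) (edge_value c _ _) (edge_value c _ _).
  move: (edge_value c _ _) (edge_value c _ _) (c _) => e5 e6 a e1 e2 e3 e4.
  case=> -[[? ?] [? ?] [? ?]] [[[? ?] [? ?] [? ?]] [[? ?] [? ?] [? ?]]].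
  (* Each of the seven values is a nonnegative combination of the nine rhombus numbers. *)
  by split; [lia|split; split; lia].
apply/forallP => -[e|T]; last first.
  have := tri (val T).1.1 (val T).1.2 (val T).2; rewrite -!surjective_pairing.
  by move=> /(_ (valP T))[T' /val_inj ->] [].
rewrite -edge_value_dot; have := edge_neq lamP (valP e); have := valP e.
case: (val e) => u v /= uvL; rewrite -(inj_eq val_inj) neq_ltn => uv.
have pq1 : (first_vx.+1 < last_vx)%N by rewrite /=; have := k_ge3; lia.
have le_last (w : 'I_k) : (w <= last_vx)%N.
  by rewrite /= -ltnS prednK ?ltn_ord ?first_lt.
case/orP: uv => uv.
  have [x [y [z [tT side]]]] := edge_in_triangle pq1 root_edge uvL (leq0n _) uv (le_last v).
  have [T _ /= [_ [[h1 h2 h3] [h4 h5 h6]]]] := tri _ _ _ tT.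
  by case: side => -[-> ->].
rewrite setUC in uvL.
have [x [y [z [tT side]]]] := edge_in_triangle pq1 root_edge uvL (leq0n _) uv (le_last u).
have [T _ /= [_ [[h1 h2 h3] [h4 h5 h6]]]] := tri _ _ _ tT.
by case: side => -[-> ->].
Qed.

(** The last boundary edge runs clockwise from [last_vx] to [first_vx], but its type is read in the
    opposite direction; this exchanges left with right, hence [n_in] with [n_out]. *)
Lemma KT_cone_bdryE (S : strand_set k) c : c \in KT_cone_bdry lam S <->
  conf S first_vx last_vx c /\
  has_type c first_vx last_vx (n_out S last_vx, n_in S last_vx).
Proof.
rewrite -topredE /= /KT_cone_bdry KT_coneE; split.
  case/andP => /forallP tri /forallP bd; split.
    split=> [d|T _|E _ _]; [by rewrite inside_all|exact: tri|].
    by have /andP[/eqP e1 /eqP e2] := bd E.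
  have /andP[/eqP] := bd last_vx; rewrite /left_value /right_value ordS_last => e1 /eqP e2.
  by split; rewrite ?e1 ?e2 /=; congr Posz; lia.
case=> -[_ tri bd] [e1 e2]; apply/andP; split.
  by apply/forallP => T; apply: tri; apply: inside_all.
apply/forallP => E; rewrite /left_value /right_value.
have [El|lE] := ltnP E last_vx.
  by have [-> ->] := bd E (leq0n _) El; rewrite !eqxx.
have -> : E = last_vx.
  by apply: val_inj; have := ltn_ord E; move: lE => /=; have := k_ge3; lia.
rewrite ordS_last e1 e2 /=; apply/andP; split; apply/eqP; congr Posz; lia.
Qed.

End Polygon.

Lemma chi_prod_count (F : numFieldType) (s L : seq (nat * nat)) (w : nat * nat) :
  (forall x y : F, (\sum_(l <- s) chiw x y l) * chiw x y w = \sum_(l <- L) chiw x y l) ->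
  count_mem (0, 0)%N L = count_mem (w.2, w.1) s.
Proof.
move=> sL; pose L' := flatten [seq [seq lr_weight l w t | t <- lr_seq l w] | l <- s].
have E : forall x y : F, \sum_(l <- L) chiw x y l = \sum_(l <- L') chiw x y l.
  move=> x y; rewrite -sL big_flatten big_map mulr_suml; apply: eq_bigr => l _.
  by rewrite chi_product big_map.
rewrite (chi_count E) /L'; elim: s {sL L' E} => [//|l s IH].
pose f l' := [seq lr_weight l' w t | t <- lr_seq l' w].
rewrite -[LHS]/(count_mem (0, 0)%N (f l ++ flatten [seq f l' | l' <- s])).
rewrite count_cat IH count_lr_weight0; congr (nat_of_bool _ + _)%N.
by case: l w {f IH} => [a b] [c d]; rewrite !xpair_eqE /= [d == _]eq_sym [c == _]eq_sym andbC.
Qed.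

Theorem corollary93 (R : realType) (k : nat) (k_ge3 : (3 <= k)%N)
    (S : strand_set k)
    (lam : {set {set 'I_k}}) (lamP : ideal_triangulation lam)
    (d : 'I_k -> nat) (V : forall E : 'I_k, 'M[R[i]]_3 -> 'M[R[i]]_(d E))
    (VP : forall E : 'I_k, irrep_of_weight (n_in S E) (n_out S E) (V E)) :
  [/\ {subset KT_cone_bdry lam S <= KT_cone lam},
      {subset KT_cone lam <= nonneg_coords lam}
    & indexes_basis (KT_cone_bdry lam S) (is_invariant (tensor_rep V))].
Proof.
split; [by move=> c /andP[] | exact: KT_nonneg |].
pose w E := (n_in S E, n_out S E).
have [L [trL [B [szB frB memB]]]] := @tensor_invariants R 'I_k w d V VP.
set p := first_vx k_ge3; set q := last_vx k_ge3.
have [s [us mem_s ht sum_s]] := conf_sum lamP S (first_last k_ge3) (root_edge k_ge3 lamP).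
rewrite -/p -/q in mem_s ht sum_s.
(* So far the last edge was free; this keeps the points that carry the prescribed strands on it. *)
pose s' := [seq c <- s | etype c p q == ((w q).2, (w q).1)].
have szs : size B = size s'.
  rewrite szB size_filter (@chi_prod_count R[i] [seq etype c p q | c <- s] L (w q)).
    by rewrite count_map.
  move=> x y; have [a [b [c [abc <- <-]]]] := torus_surjective x y.
  rewrite big_map sum_s -[RHS](trL _ _ _ abc).
  rewrite [RHS](bigD1 q) //= mulrC; congr (_ * _); apply: eq_bigl => E.
  rewrite -(inj_eq val_inj) /= neq_ltn.
  by have := ltn_ord E; lia.
have us' : uniq s' by apply: filter_uniq.
(* Only the equality of cardinals is known, so points and basis vectors are matched by their
   positions. *)
pose b c := nth 0 B (index c s').
have bE : [seq b c | c <- s'] = B.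
  apply: (@eq_from_nth _ 0); rewrite size_map // => i lt_i.
  have [c0 _] : exists c0 : coords lam, True by exists 0.
  by rewrite (nth_map c0) // /b index_uniq.
exists s', b; split; rewrite ?bE //.
  move=> c; rewrite mem_filter; apply/andP/idP => [[/eqP ec /mem_s cc]|].
    apply/(KT_cone_bdryE k_ge3); split=> //.
    by have := ht c cc; rewrite ec.
  move/(KT_cone_bdryE k_ge3) => [cc hc]; split; last by apply/mem_s.
  by rewrite (etypeP hc).
Qed.
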